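(* Let $(B_i)_{i\in Q_0}\in\bigoplus_{i\in Q_0}\mathrm{Herm}(V_i)$ be a tuple of Hermitian operators, and let $a_{i,1}\leq\ldots\leq a_{i,d_i}$ be the eigenvalues of $B_i$ (with multiplicity) for each $i\in Q_0$. Then $(B_i)_i$ belongs to the image of $\mu_Q:R_{\mathbf d}(Q)\to\bigoplus_i\mathrm{Herm}(V_i)$ if and only if $$\sum_{i\in Q_0}\sum_{k=1}^{d_i}a_{i,k}=0\quad\text{and}\quad a_{\mathbf K}:=\sum_{i\in Q_0}\sum_{k\in K_i}a_{i,k}\geq 0\ \text{ for all }\mathbf K\in\hat S(\mathbf d).$$
   Context: $Q$ is a finite quiver with vertex set $Q_0$ and finitely many arrows $\alpha:i\to j$ (loops and multiple arrows allowed). $\mathbf d=(d_i)_{i\in Q_0}\in\mathbb N Q_0$ is a dimension vector, and $V_i$ is a complex vector space of dimension $d_i$ equipped with a Hermitian inner product. $R_{\mathbf d}(Q)=\bigoplus_{\alpha:i\to j}\mathrm{Hom}_{\mathbb C}(V_i,V_j)$, and the momentum map $\mu_Q:R_{\mathbf d}(Q)\to\bigoplus_{i\in Q_0}\mathrm{Herm}(V_i)$ is $$\mu_Q((f_\alpha)_\alpha)_i=\sum_{\alpha:j\to i}f_\alpha\circ f_\alpha^*-\sum_{\alpha:i\to j}f_\alpha^*\circ f_\alpha,$$ adjoints taken with respect to the Hermitian forms (a loop at $i$ contributes to both sums). For a tuple $\mathbf K=(K_i)_{i\in Q_0}$ of finite sets, its weight is $|\mathbf K|=(|K_i|)_i\in\mathbb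 NQ_0$; for $\mathbf e\in\mathbb NQ_0$ put $[\mathbf e]=(\{1,\ldots,e_i\})_i$. If $\mathbf K\subset[\mathbf d]$ (i.e. $K_i\subset\{1,\dots,d_i\}$ for all $i$) and $\mathbf L\subset[|\mathbf K|]$, write $K_i=\{k_{i,1}<\ldots<k_{i,|K_i|}\}$ and define the height $\mathrm{ht}(\mathbf K,\mathbf L)=\sum_{i\in Q_0}\sum_{j\in L_i}(k_{i,j}-j)$. The sets $\hat S(\mathbf e)$ (for $\mathbf e\in\mathbb NQ_0$) are defined recursively: a tuple $\mathbf K\subset[\mathbf e]$ belongs to $\hat S(\mathbf e)$ if and only if $$\mathrm{ht}(\mathbf K,\mathbf L)\geq\sum_{\alpha:i\to j}|L_i|\,(e_j-|K_j|)\quad\text{for all }\mathbf L\in\hat S(|\mathbf K|).$$ (For $\mathbf K=[\mathbf e]$ both sides are $0$, so $[\mathbf e]\in\hat S(\mathbf e)$; for $\mathbf K\neq[\mathbf e]$ the recursion refers only to $\hat S$ of strictly smaller dimension vectors, so the definition is well-founded.) *)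

(* Defs.v *)
From HB Require Import structures.
From mathcomp Require Import all_boot all_order all_algebra.
Set Implicit Arguments. Unset Strict Implicit. Unset Printing Implicit Defensive.
Import Order.TTheory GRing.Theory Num.Theory.
Local Open Scope ring_scope.

Definition adjmx (C : numClosedFieldType) (m n : nat) (A : 'M[C]_(m, n)) : 'M[C]_(n, m) :=
  (map_mx Num.conj A)^T.

Definition herm_mx (C : numClosedFieldType) (n : nat) (A : 'M[C]_n) : Prop :=
  adjmx A = A.

(* The momentum map.  f a : V_(src a) -> V_(tgt a) is a d(tgt a) x d(src a)
   matrix acting on column vectors.  conform_mx 0 M is M itself when the
   dimensions agree, which is the case for the arrows selected in each sum. *)
Definition mu (C : numClosedFieldType) (Q0 Ar : finType) (src tgt : Ar -> Q0)
    (d : Q0 -> nat) (f : forall a : Ar, 'M[C]_(d (tgt a), d (src a))) (i : Q0)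
    : 'M[C]_(d i) :=
  \sum_(a : Ar | tgt a == i) conform_mx 0 (f a *m adjmx (f a))
  - \sum_(a : Ar | src a == i) conform_mx 0 (adjmx (f a) *m f a).

(* Tuples K subset [e] are K : forall i, {set 'I_(e i)}, with the 0-based
   element k in 'I_(e i) standing for k+1 in {1,...,e_i}.  The weight is
   |K| = (#|K i|)_i. *)
Definition weight (Q0 : finType) (e : Q0 -> nat) (K : forall i, {set 'I_(e i)})
  : Q0 -> nat := fun i => #|K i|.

(* Height ht(K,L) = sum_i sum_(j in L_i) (k_(i,j) - j).  For the 0-based
   j0 in L_i (j = j0+1), k_(i,j) - 1 = enum_val j0 (the j0-th smallest
   element of K_i, 0-based), so k_(i,j) - j = enum_val j0 - j0. *)
Definition ht (Q0 : finType) (e : Q0 -> nat) (K : forall i, {set 'I_(e i)})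
    (L : forall i, {set 'I_(#|K i|)}) : int :=
  \sum_(i : Q0) \sum_(j in L i) ((nat_of_ord (enum_val j) : int) - (nat_of_ord j : int)).

Definition shat_rhs (Q0 Ar : finType) (src tgt : Ar -> Q0) (e : Q0 -> nat)
    (K : forall i, {set 'I_(e i)}) (L : forall i, {set 'I_(#|K i|)}) : int :=
  \sum_(a : Ar) ((#|L (src a)| : int) * ((e (tgt a) : int) - (#|K (tgt a)| : int))).

(* Fuel-indexed version of the recursive definition of \hat S(e).
   For fuel n > sum_i e_i this coincides with \hat S(e): for K <> [e] the
   recursion goes to |K| with strictly smaller total dimension, and for
   K = [e] the condition is trivially satisfied (both sides are 0). *)
Fixpoint Shat_fuel (Q0 Ar : finType) (src tgt : Ar -> Q0) (n : nat)
    (e : Q0 -> nat) (K : forall i, {set 'I_(e i)}) {struct n} : Prop :=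
  match n with
  | 0 => True
  | n'.+1 =>
      forall L : forall i, {set 'I_(#|K i|)},
        @Shat_fuel Q0 Ar src tgt n' (weight K) L ->
        @shat_rhs Q0 Ar src tgt e K L <= @ht Q0 e K L
  end.

Definition Shat (Q0 Ar : finType) (src tgt : Ar -> Q0) (e : Q0 -> nat)
    (K : forall i, {set 'I_(e i)}) : Prop :=
  @Shat_fuel Q0 Ar src tgt (\sum_(i : Q0) e i).+1 e K.

(* Main.v *)
(** Order the eigenvectors of the [B_i] at each vertex by eigenvalue and call [K] dominant when a generic
    representation has a subrepresentation in the Schubert position [K] with respect to the resulting flags.

    Dominance satisfies the recursion defining [Shat].  By the Jacobian criterion, [K] is dominant iff some
    differential is surjective.  If it is, restricting it to a subrepresentation in a dominant position [L]
    of the subrepresentation yields the inequality for [L] by counting dimensions.  Conversely, choose [f]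
    with a differential of maximal rank; the part of a position killed by an element of its kernel is itself
    dominant, and moving [f] to first order shows that the differential is surjective.

    Necessity: if [mu f = B] and [K] is dominant, some [g] arbitrarily close to [f] has a subrepresentation in
    position [K]; its orthogonal projection [P] satisfies [0 <= tr (P mu(g))] and [tr (P B) <= a_K].

    Sufficiency: [Phi f u = |mu f - u B u^*|^2], with [u] unitary, attains its minimum.  The field is only
    assumed to be real closed, so this uses quantifier elimination; boundedness comes from the minimisers
    of [Phi + eps |f|^2], which shift the eigenvalues of [beta = mu f - u B u^*] and hence are bounded
    independently of [eps].  At a minimum with [u = 1], [beta] commutes with [f] and [B], and a second-order
    variation shows that the span of the eigenvectors of [beta] with eigenvalue at least [lambda] is in
    dominant position.  The hypothesis then gives, by summation by parts, [0 <= tr (beta B) = - tr (beta^2)],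
    so [beta = 0]. *)

(* Dominance is computed by a rank, but necessity uses it in a stronger form: subrepresentations
   must exist arbitrarily near a given [f]. So the family of representations with a stable graph
   must contain an open set, not merely lie in no hypersurface, and a form of Chevalley's theorem
   enters.

   No limit process is used. A derivative is the linear coefficient of the restriction to a line,
   the Cayley transform replaces the exponential, and conclusions at [t = 0] are drawn from
   [0 <= c + t r(t)] with [r] bounded.

   Repeated eigenvalues leave the flags undetermined. The spans of eigenvectors of [beta] fit a flag
   of eigenvectors of [B] if ties among the eigenvalues of [B] are broken by those of [beta]. Hence
   dominance is studied for every compatible order of the basis; the recursion only counts elements,
   so it gives the same sets for each of them.

   The penalty [eps |f|^2] forces [[beta, f] = - (eps / 2) f] at a minimum: each arrow strictly
   lowers the eigenvalues of [beta], so [|f|^2] is controlled by traces of [mu f] against spectral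
   projections of [beta], whatever the size of [eps]. *)
Require Import Defs.
From Stdlib Require Import Classical FunctionalExtensionality.
From HB Require Import structures.
From mathcomp Require Import all_boot all_order all_algebra all_field.
From mathcomp Require Import spectral sesquilinear zify ring lra.
From mathcomp Require mpoly ordered_qelim qe_rcf.
Set Implicit Arguments. Unset Strict Implicit. Unset Printing Implicit Defensive.
Import Order.TTheory GRing.Theory Num.Theory.
Local Open Scope ring_scope.

(** * Polynomial maps and the Jacobian criterion *)

Section MPolyExtra.
Import mpoly.
Variable C : numFieldType.

Lemma mpoly_closed_ind n (P : {mpoly C[n]} -> Prop) :
  (forall c, P c%:MP) -> (forall i, P 'X_i) ->
  (forall p q, P p -> P q -> P (p + q)) -> (forall p q, P p -> P q -> P (p * q)) ->
  forall p, P p.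
Proof.
move=> PC PX PD PM p; elim/mpolyind: p => [|c m p _ _ IH]; first by rewrite -mpolyC0.
apply: (PD) => //; rewrite -mul_mpolyC; apply: (PM) => //.
rewrite mpolyXE_id; apply: (big_ind P) => [||i _]; [by rewrite -mpolyC1|move=> *; exact: (PM)|].
elim: (m i) => [|k IHk]; first by rewrite expr0 -mpolyC1.
by rewrite exprS; apply: (PM).
Qed.

Lemma submm n (m : 'X_{1..n}) : (m - m = 0)%MM.
Proof. by apply/mnmP => i; rewrite mnmBE mnm0E subnn. Qed.

Lemma mderiv_comp n k (lq : n.-tuple {mpoly C[k]}) (p : {mpoly C[n]}) (i : 'I_k) :
  (p \mPo lq)^`M(i) = \sum_(j < n) (p^`M(j) \mPo lq) * (tnth lq j)^`M(i).
Proof.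
elim/mpoly_closed_ind: p => [c|l|p q IHp IHq|p q IHp IHq].
- rewrite comp_mpolyC mderivC big1 // => j _.
  by rewrite mderivC comp_mpoly0 mul0r.
- rewrite comp_mpolyXU -tnth_nth (bigD1 l) //= big1 => [|j jl].
    by rewrite addr0 mderivX mnm1E eqxx submm mpolyX0 scale1r comp_mpoly1 mul1r.
  by rewrite mderivX mnm1E eq_sym (negbTE jl) scale0r comp_mpoly0 mul0r.
- rewrite comp_mpolyD mderivD IHp IHq -big_split; apply: eq_bigr => j _ /=.
  by rewrite mderivD comp_mpolyD mulrDl.
- rewrite rmorphM mderivM IHp IHq mulr_suml mulr_sumr -big_split.
  apply: eq_bigr => j _ /=; rewrite mderivM comp_mpolyD !rmorphM /=.
  by rewrite mulrDl; congr (_ + _); rewrite -?mulrA ?[_ * (q \mPo lq)]mulrC //.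
Qed.

Lemma msize_deriv_lt n (p : {mpoly C[n]}) i : p != 0 -> (msize p^`M(i) < msize p)%N.
Proof.
move=> p0; have [->|d0] := eqVneq p^`M(i) 0.
  by rewrite msize0 lt0n msize_poly_eq0.
rewrite -mlead_deg //; have : p^`M(i)@_(mlead p^`M(i)) != 0.
  by rewrite mleadc_eq0.
rewrite mcoeff_deriv mulrn_eq0 negb_or /= => h.
have := @msize_mdeg_lt _ _ p (mlead p^`M(i) + U_(i))%MM.
by rewrite mcoeff_msupp h mdegD mdeg1 addn1 => /(_ isT).
Qed.

Lemma mderiv_all0 n (p : {mpoly C[n]}) : (forall i, p^`M(i) = 0) -> p = (p@_0)%:MP.
Proof.
move=> h; apply/mpolyP => m; rewrite mcoeffC.
have [->|m0] := eqVneq m 0%MM; first by rewrite mulr1.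
rewrite mulr0; have [i mi] : exists i, (m i != 0)%N.
  apply/existsP; apply: contraNT m0; rewrite negb_exists => /forallP H.
  by apply/eqP/mnmP => i; rewrite mnm0E; apply/eqP; rewrite -[_ == _]negbK.
have e : m = ((m - U_(i)) + U_(i))%MM.
  by rewrite submK // lep1mP.
have := congr1 (mcoeff (m - U_(i))%MM) (h i).
by rewrite mcoeff_deriv -e mcoeff0 => /eqP; rewrite mulrn_eq0 /= => /eqP.
Qed.

Lemma meval_line n (p : {mpoly C[n]}) (x w : 'I_n -> C) :
  exists P : {poly C}, (forall t, p.@[fun i => x i + t * w i] = P.[t]) /\
    P`_1 = \sum_(i < n) (p^`M(i)).@[x] * w i.
Proof.
elim/mpoly_closed_ind: p => [c|l|p q [P [hP dP]] [Q [hQ dQ]]|p q [P [hP dP]] [Q [hQ dQ]]].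
- exists c%:P; split=> [t|]; first by rewrite mevalC hornerC.
  by rewrite coefC big1 // => i _; rewrite mderivC meval0 mul0r.
- exists ((x l)%:P + (w l) *: 'X); split=> [t|]; first by rewrite mevalXU !hornerE mulrC.
  rewrite coefD coefC coefZ coefX /= mulr1 add0r (bigD1 l) //= big1 ?addr0 => [|i il].
    by rewrite mderivX mnm1E eqxx submm mpolyX0 scale1r meval1 mul1r.
  by rewrite mderivX mnm1E eq_sym (negbTE il) scale0r meval0 mul0r.
- exists (P + Q); split=> [t|]; first by rewrite mevalD hP hQ hornerD.
  rewrite coefD dP dQ -big_split; apply: eq_bigr => i _ /=.
  by rewrite mderivD mevalD mulrDl.
- exists (P * Q); split=> [t|]; first by rewrite mevalM hP hQ hornerM.
  have ev0 (r : {mpoly C[n]}) R : (forall t, r.@[fun i => x i + t * w i] = R.[t]) -> R`_0 = r.@[x].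
    by move=> hR; rewrite -horner_coef0 -hR; apply: meval_eq => i; rewrite mul0r addr0.
  rewrite coefM 2!big_ord_recl big_ord0 addr0 /= dP dQ (ev0 _ _ hP) (ev0 _ _ hQ).
  rewrite addrC mulr_suml mulr_sumr; under [RHS]eq_bigr => i _ do rewrite mderivM mevalD !mevalM mulrDl.
  by rewrite big_split; congr (_ + _); apply: eq_bigr => i _; rewrite ?mulrA // mulrAC.
Qed.

Lemma poly_fun0 (P : {poly C}) : (forall t, P.[t] = 0) -> P = 0.
Proof.
move=> h; apply/eqP; apply: contraT => P0.
have := @max_poly_roots _ P [seq k%:R | k <- iota 0 (size P)] P0.
rewrite size_map size_iota ltnn; apply.
  by apply/allP => x _; rewrite rootE h.
by rewrite map_inj_uniq ?iota_uniq // => a b /eqP; rewrite eqr_nat => /eqP.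
Qed.

(** Induction on the degree: along a coordinate line [p] becomes a univariate polynomial with too
    many roots, so each partial derivative vanishes as a function too, and in characteristic zero a
    polynomial with zero gradient is constant. *)
Lemma mpoly_fun0 n (p : {mpoly C[n]}) : (forall x, p.@[x] = 0) -> p = 0.
Proof.
have [k] := ubnP (msize p); elim: k p => // k IH p; rewrite ltnS => pk h.
apply/eqP; apply: contraT => p0.
have dp i : p^`M(i) = 0.
  apply: IH => [|x]; first exact: leq_trans (msize_deriv_lt _ p0) pk.
  have [P [hP dP]] := meval_line p x (fun j => (j == i)%:R).
  have P0 : P = 0 by apply: poly_fun0 => t; rewrite -hP h.
  move: dP; rewrite P0 coef0 (bigD1 i) //= eqxx mulr1 big1 ?addr0 // => j /negbTE ->.
  by rewrite mulr0.
move: p0; rewrite (mderiv_all0 dp); have := h (fun=> 0).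
by rewrite {1}(mderiv_all0 dp) mevalC => ->; rewrite mpolyC0 eqxx.
Qed.

(** By the chain rule, the gradient of a relation [p], evaluated at [F], is killed by the Jacobian
    matrix of [F]. Multiplied by the lifts [W] of the basis vectors, that matrix becomes square and
    equals the identity at [x0], so its determinant is a nonzero polynomial; the partial derivatives
    of [p] are then relations of smaller degree. *)
Lemma submersive_comp_eq0 n m (F : m.-tuple {mpoly C[n]}) (x0 : 'I_n -> C) :
  (forall h : 'I_m -> C, exists w : 'I_n -> C, forall j,
     \sum_(i < n) ((tnth F j)^`M(i)).@[x0] * w i = h j) ->
  forall p : {mpoly C[m]}, p \mPo F = 0 -> p = 0.
Proof.
move=> surj; have [W hW] : exists W : 'I_m -> 'I_n -> C, forall l j,
     \sum_(i < n) ((tnth F j)^`M(i)).@[x0] * W l i = (l == j)%:R.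
  apply: (@fin_all_exists _ (fun=> 'I_n -> C) (fun l W => forall j,
    \sum_(i < n) ((tnth F j)^`M(i)).@[x0] * W i = (l == j)%:R)) => l.
  exact: (surj (fun j => (l == j)%:R)).
pose M : 'M[{mpoly C[n]}]_m := \matrix_(j, l) \sum_(i < n) (tnth F j)^`M(i) * (W l i)%:MP.
have detM : \det M != 0.
  apply/eqP => d0; have : (\det M).@[x0] = 0 by rewrite d0 meval0.
  rewrite -det_map_mx (_ : map_mx _ M = 1%:M) ?det1; last first.
    apply/matrixP => j l; rewrite !mxE raddf_sum /= eq_sym -hW.
    by apply: eq_bigr => i _; rewrite mevalM mevalC.
  by move/eqP; rewrite oner_eq0.
move=> p; have [k] := ubnP (msize p); elim: k p => // k IH p; rewrite ltnS => pk h.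
apply/eqP; apply: contraT => p0.
pose r : 'rV[{mpoly C[n]}]_m := \row_j (p^`M(j) \mPo F).
have rM : r *m M = 0.
  apply/rowP => l; rewrite !mxE.
  under eq_bigr => j _ do rewrite !mxE mulr_sumr.
  rewrite exchange_big big1 //= => i _.
  have := congr1 (mderiv i) h; rewrite mderiv_comp mderiv0 => e.
  transitivity ((\sum_(j < m) (p^`M(j) \mPo F) * (tnth F j)^`M(i)) * (W l i)%:MP).
    by rewrite mulr_suml; apply: eq_bigr => j _; rewrite mulrA.
  by rewrite e mul0r.
have r0 : r = 0.
  have : r *m M *m \adj M = 0 by rewrite rM mul0mx.
  rewrite -mulmxA mul_mx_adj mul_mx_scalar => /matrixP e.
  apply/matrixP => a j; have /eqP := e a j; rewrite !mxE mulf_eq0 (negbTE detM).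
  by move/eqP.
have dp j : p^`M(j) = 0.
  apply: IH; first exact: leq_trans (msize_deriv_lt _ p0) pk.
  by have := congr1 (fun r : 'rV_m => r 0 j) r0; rewrite !mxE.
move: p0 h; rewrite (mderiv_all0 dp) comp_mpolyC => p0 e.
have := congr1 (mcoeff 0%MM) e; rewrite mcoeffC eqxx mulr1 mcoeff0 => e0.
by rewrite e0 mpolyC0 eqxx in p0.
Qed.

(** Dimension count: the monomials in the [y_j] with [j] in [S] and exponents below [N] outnumber
    the monomials in [n] variables with exponents below [Bd], so some combination of them vanishes
    after substitution. *)
Lemma alg_dependent_card n k (y : k.-tuple {mpoly C[n]}) (S : {set 'I_k}) :
  (n < #|S|)%N ->
  exists P : {mpoly C[k]}, [/\ P != 0, P \mPo y = 0 & forall j, j \notin S -> P^`M(j) = 0].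
Proof.
move=> nS; pose D1 := (\max_(j < k) msize (tnth y j)).+1; pose D := (D1 + 2)%N.
pose N := ((k * D + 1) ^ n).+1; pose Bd := (k * N * D + 1)%N.
pose E := {ffun {x | x \in S} -> 'I_N}.
pose mon (e : E) : 'X_{1..k} := [multinom oapp (fun z => e z : nat) 0%N (insub j) | j < k].
have mon_inj : injective mon.
  move=> e e' /mnmP h; apply/ffunP => z; apply/val_inj.
  by have := h (val z); rewrite !mnmE valK.
pose G := {ffun 'I_n -> 'I_Bd}.
have mond e j : (mon e j <= N)%N.
  by rewrite mnmE; case: insubP => //= u _ _; apply: ltnW.
have szy e : (msize ('X_[mon e] \mPo y) <= Bd)%N.
  rewrite comp_mpolyX.
  apply: (@leq_trans (\sum_(j < k) (N * D) + 1)%N); last first.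
    by rewrite sum_nat_const card_ord mulnA.
  elim/big_rec2: _ => [|j b p _ IH]; first by rewrite msize1.
  have powle c : (msize (tnth y j ^+ c) <= c * D1 + 1)%N.
    elim: c => [|c IHc]; first by rewrite expr0 msize1.
    rewrite exprS; apply: leq_trans (msizeM_le _ _) _.
    have : (msize (tnth y j) < D1)%N by rewrite ltnS; apply: (leq_bigmax j).
    by move: IHc; rewrite mulSn; lia.
  apply: leq_trans (msizeM_le _ _) _.
  have := powle (mon e j); have : (mon e j * D1 <= N * D1)%N by rewrite leq_mul2r mond orbT.
  by move: IH; rewrite /D mulnDr; lia.
pose M : 'M[C]_(#|E|, #|G|) :=
  \matrix_(a, b) ('X_[mon (enum_val a : E)] \mPo y)@_[multinom ((enum_val b : G) i : nat) | i < n].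
have rk : (\rank M < #|E|)%N.
  apply: leq_ltn_trans (rank_leq_col _) _.
  rewrite !card_ffun !card_ord card_sig.
  have -> : #|[pred x | x \in S]| = #|S| by apply: eq_card.
  apply: (@leq_ltn_trans (N ^ n * (k * D + 1) ^ n)%N).
    case: (posnP n) => [->|n0]; first by rewrite !expn0.
    by rewrite -expnMn leq_exp2r // ?/Bd mulnDr muln1; lia.
  apply: (@leq_trans (N ^ n.+1)%N); last by rewrite leq_exp2l // /N ltnS expn_gt0 addn1.
  by rewrite expnSr ltn_pmul2l ?expn_gt0.
have [u u0 uM] : exists2 u : 'rV[C]_#|E|, u != 0 & u *m M = 0.
  have : kermx M != 0 by rewrite kermx_eq0 /row_free neq_ltn rk.
  move/rowV0Pn => [u /sub_kermxP uM u0]; by exists u.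
pose P : {mpoly C[k]} := \sum_a u 0 a *: 'X_[mon (enum_val a : E)].
exists P; split.
- have /rV0Pn [a ua] := u0; apply/eqP => P0.
  have := congr1 (mcoeff (mon (enum_val a))) P0.
  rewrite mcoeff0 raddf_sum /= (bigD1 a) //= big1 => [|b ba].
    by rewrite mcoeffZ mcoeffX eqxx mulr1 addr0; apply/eqP.
  rewrite mcoeffZ mcoeffX (_ : _ == _ = false) ?mulr0 //.
  by apply/eqP => /mon_inj/enum_val_inj e; rewrite e eqxx in ba.
- apply/mpolyP => m; rewrite mcoeff0.
  have PE : (P \mPo y)@_m = \sum_a u 0 a * ('X_[mon (enum_val a : E)] \mPo y)@_m.
    rewrite /P (raddf_sum (comp_mpoly y)) (raddf_sum (mcoeff m)); apply: eq_bigr => a _.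
    by rewrite /= comp_mpolyZ mcoeffZ.
  case: (boolP [forall i, (m i < Bd)%N]) => [/forallP mB|].
    pose b : G := [ffun i => Ordinal (mB i)].
    have := congr1 (fun r : 'rV_#|G| => r 0 (enum_rank b)) uM; rewrite !mxE => <-.
    rewrite PE; apply: eq_bigr => a _; rewrite !mxE enum_rankK.
    by congr (_ * _@_ _); apply/mnmP => i; rewrite mnmE ffunE.
  rewrite negb_forall => /existsP[i]; rewrite -leqNgt => Bi.
  rewrite PE big1 // => a _; apply/eqP; rewrite mulf_eq0; apply/orP; right.
  rewrite mcoeff_eq0; apply: msize_mdeg_ge; apply: leq_trans (szy _) _.
  by apply: leq_trans Bi _; rewrite mdegE (bigD1 i) //= leq_addr.
- move=> j jS; rewrite /P (raddf_sum (mderiv j)) big1 // => a _.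
  by rewrite /= mderivZ mderivX mnmE insubN //= scale0r scaler0.
Qed.

(* The relations [P l] below express the differential of each coordinate
   through those of a maximal algebraically independent set containing [F]. *)
Lemma alg_independent_submersive n m (F : m.-tuple {mpoly C[n]}) :
  (forall p : {mpoly C[m]}, p \mPo F = 0 -> p = 0) ->
  exists x0 : 'I_n -> C, forall h : 'I_m -> C, exists w : 'I_n -> C, forall j,
     \sum_(i < n) ((tnth F j)^`M(i)).@[x0] * w i = h j.
Proof.
(* Adjoining the coordinate functions makes the gradients of [y] span the whole space at every
   point. *)
move=> indF; pose y : (m + n).-tuple {mpoly C[n]} :=
  [tuple (match split a with inl j => tnth F j | inr i => 'X_i end) | a < m + n].
(* A relation among the members of [y] indexed by [S]; absence of the other variables is expressed
   by vanishing derivatives. *)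
pose rel (S : {set 'I_(m + n)}) (P : {mpoly C[m + n]}) :=
  P \mPo y = 0 /\ forall j, j \notin S -> P^`M(j) = 0.
pose ind S := forall P, rel S P -> P = 0.
pose SF : {set 'I_(m + n)} := [set lshift n j | j : 'I_m].
have indSF : ind SF.
  move=> P [Py dP].
  pose z : (m + n).-tuple {mpoly C[m]} :=
    [tuple (match split a with inl j => 'X_j | inr i => 0 end) | a < m + n].
  pose z' : m.-tuple {mpoly C[m + n]} := [tuple 'X_(lshift n j) | j < m].
  (* If the derivatives in the last [n] variables vanish, the value depends on the first [m] only:
     along the line joining [x] and [x'] the restriction of [P] has zero derivative at every [t]. *)
  have ev (x x' : 'I_(m + n) -> C) : (forall j, x (lshift n j) = x' (lshift n j)) -> P.@[x] = P.@[x'].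
    move=> xx'; have [Q [hQ dQ]] := meval_line P x (fun i => x' i - x i).
    have cQ : Q = (P.@[x])%:P.
      apply/eqP; rewrite -subr_eq0; apply/eqP.
      suff dQ0 : Q^`() = 0.
        have Qc : Q = (Q`_0)%:P.
          apply/polyP => [[|k]]; first by rewrite coefC.
          have := congr1 (fun q : {poly C} => q`_k) dQ0; rewrite coef_deriv coef0 coefC /=.
          by move/eqP; rewrite mulrn_eq0 /= => /eqP.
        have := hQ 0; rewrite Qc hornerC => <-.
        by apply/eqP; rewrite subr_eq0; apply/eqP; congr _%:P; apply: meval_eq => i; rewrite mul0r addr0.
      apply: poly_fun0 => t.
      pose xt := fun i => x i + t * (x' i - x i).
      have [R [hR dR]] := meval_line P xt (fun i => x' i - x i).
      have RQ : R = Q \Po ('X + t%:P).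
        apply/eqP; rewrite -subr_eq0; apply/eqP; apply: poly_fun0 => s.
        rewrite hornerD hornerN horner_comp !hornerE -hR -hQ.
        apply/eqP; rewrite subr_eq0; apply/eqP/meval_eq => i.
        by rewrite /xt -addrA -mulrDl addrC [t + s]addrC addrC.
      have -> : Q^`().[t] = R`_1.
        have := coef_deriv R 0; rewrite mulr1n => <-.
        rewrite RQ deriv_comp derivD derivX derivC addr0 mulr1 -horner_coef0.
        by rewrite horner_comp !hornerE.
      rewrite dR big1 // => i _.
      case: (splitP i) => j ij.
        have -> : i = lshift n j by apply/val_inj.
        by rewrite xx' subrr mulr0.
      rewrite dP ?meval0 ?mul0r //; apply/imsetP => [[j' _ e]].
      by have := congr1 val e; rewrite /= ij; have := ltn_ord j'; lia.
    have := hQ 1; rewrite cQ hornerC => <-.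
    by apply: meval_eq => i; rewrite mul1r addrC subrK.
  have Pz : P \mPo z = 0.
    apply: indF; apply: mpoly_fun0 => x; rewrite !comp_mpoly_meval.
    have := congr1 (meval x) Py; rewrite comp_mpoly_meval meval0 => e.
    rewrite -[RHS]e; apply: ev => j.
    by rewrite !tnth_mktuple (unsplitK (inl j)) mevalXU.
  apply: mpoly_fun0 => x.
  have := congr1 (meval (fun j => x (lshift n j))) Pz; rewrite meval0 comp_mpoly_meval => e.
  rewrite -[RHS]e; apply: ev => j.
  by rewrite tnth_mktuple (unsplitK (inl j)) mevalXU.
have [S [SFS indS maxS]] : exists S : {set 'I_(m + n)}, [/\ SF \subset S, ind S &
    forall l, l \notin S -> ~ ind (l |: S)].
  have : exists k, exists S : {set 'I_(m + n)}, [/\ SF \subset S, ind S & #|~: S| = k] by exists #|~: SF|; exists SF.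
  case=> k; have [k'] := ubnP k; elim: k' k => // k' IH k kk' [S [s i c]].
  case: (classic (forall l, l \notin S -> ~ ind (l |: S))) => [mx|]; first by exists S.
  move=> H; have [l Hl] := not_all_ex_not _ _ H.
  have [lS /NNPP il] := imply_to_and _ _ Hl.
  apply: (IH k.-1); last first.
    exists (l |: S); split=> //; first exact: subset_trans s (subsetUr _ _).
    by rewrite setCU setIC -setDE -c (cardsD1 l (~: S)) inE lS.
  rewrite -ltnS; apply: leq_trans kk'; rewrite -c (cardsD1 l (~: S)) inE lS.
  by [].
have cardS : (#|S| <= n)%N.
  rewrite leqNgt; apply/negP => /(alg_dependent_card y) [P [P0 Py dP]].
  by move/eqP: P0; apply; apply: indS.
(* If the derivative in the new variable [l] vanishes on [y], it is itself a relation of smaller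
   degree, and it is nonzero because [S] is independent; the descent ends at a relation whose
   derivative survives. *)
have rels l : l \notin S -> exists P, [/\ rel (l |: S) P & P^`M(l) \mPo y != 0].
  move=> lS; have [P0] : exists P, ~ (rel (l |: S) P -> P = 0).
    exact: (not_all_ex_not _ _ (maxS l lS)).
  move=> H; have [r0 nz0] := imply_to_and _ _ H; clear H.
  have [k] := ubnP (msize P0); elim: k P0 r0 nz0 => // k IH P0 r0 nz0; rewrite ltnS => sk.
  case: (eqVneq (P0^`M(l) \mPo y) 0) => [e|ne]; last by exists P0.
  have P0n : P0 != 0 by apply/eqP.
  apply: (IH P0^`M(l)).
  - split=> // j jS; rewrite mderiv_comm.
    by case: r0 => _ -> //; rewrite mderiv0.
  - move=> d0; apply: nz0; apply: indS; split; first by case: r0.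
    move=> j jS; have [->//|jl] := eqVneq j l.
    by case: r0 => _; apply; rewrite !inE negb_or jl.
  - exact: leq_trans (msize_deriv_lt _ P0n) sk.
have [P hP] : exists P : 'I_(m + n) -> {mpoly C[m + n]}, forall l,
   l \notin S -> rel (l |: S) (P l) /\ (P l)^`M(l) \mPo y != 0.
  apply: (@fin_all_exists _ (fun=> {mpoly C[m + n]}) (fun l P => l \notin S ->
    rel (l |: S) P /\ P^`M(l) \mPo y != 0)) => l; case: (boolP (l \in S)) => lS; first by exists 0.
  by have [P [h1 h2]] := rels l lS; exists P.
(* Where [g] is nonzero, each relation can be solved for the gradient of [y_l] in terms of the
   gradients indexed by [S]. *)
pose g := \prod_(l | l \notin S) ((P l)^`M(l) \mPo y).
have [x0 gx] : exists x, g.@[x] != 0.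
  apply: NNPP => /(not_ex_all_not _ _) h.
  have /eqP : g = 0 by apply: mpoly_fun0 => x; apply/eqP; have /negP := h x; rewrite negbK.
  by apply/negP/prodf_neq0 => l /hP [].
exists x0 => h.
pose Gr l : 'rV[C]_n := \row_i ((tnth y l)^`M(i)).@[x0].
pose MS : 'M[C]_(#|S|, n) := \matrix_s Gr (enum_val s).
have subS l : (Gr l <= MS)%MS.
  case: (boolP (l \in S)) => lS.
    have -> : Gr l = row (enum_rank_in lS l) MS by rewrite rowK enum_rankK_in.
    exact: row_sub.
  have [[Py dP] _] := hP l lS.
  pose c j := ((P l)^`M(j) \mPo y).@[x0].
  have cl : c l != 0.
    by move: gx; rewrite /g rmorph_prod /= => /prodf_neq0 /(_ _ lS).
  have rl : \sum_j c j *: Gr j = 0.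
    apply/rowP => i; rewrite summxE !mxE.
    have := congr1 (mderiv i) Py; rewrite mderiv0 mderiv_comp => e.
    have := congr1 (meval x0) e; rewrite meval0 raddf_sum /= => e1; rewrite -[RHS]e1.
    by apply: eq_bigr => j _; rewrite !mxE mevalM.
  have -> : Gr l = \sum_(j in S) (- (c l)^-1 * c j) *: Gr j.
    move: rl; rewrite (bigD1 l) //= => /eqP; rewrite addr_eq0 => /eqP e.
    apply: (scalerI cl); rewrite e scaler_sumr.
    rewrite (bigID (mem S)) /= [X in _ + X]big1 ?addr0; last first.
      move=> j /andP[jl jS]; rewrite /c dP ?comp_mpoly0 ?meval0 ?scale0r //.
      by rewrite !inE negb_or jl.
    rewrite -sumrN; apply: eq_big => j.
      by case: eqP => //= ->; rewrite (negbTE lS).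
    by move=> _; rewrite scalerA mulrA mulrN divff // mulN1r scaleNr.
  apply: summx_sub => j jS; apply: scalemx_sub.
  have -> : Gr j = row (enum_rank_in jS j) MS by rewrite rowK enum_rankK_in.
  exact: row_sub.
have full : row_full MS.
  rewrite -sub1mx; apply/row_subP => i.
  have -> : row i 1%:M = Gr (rshift m i).
    apply/rowP => j; rewrite !mxE tnth_mktuple (unsplitK (inr i)) mderivX mnm1E.
    have [<-|ij] := eqVneq; first by rewrite submm mpolyX0 scale1r meval1.
    by rewrite scale0r meval0.
  exact: subS.
(* At most [n] gradients span a space of dimension [n], so they are linearly independent, and those
   of [F] are among them. *)
have free : row_free MS.
  by rewrite /row_free eqn_leq rank_leq_row (leq_trans cardS) // col_leq_rank.
have [W hW] := row_freeP free.
pose hh : 'cV[C]_#|S| := \col_s (match split (enum_val s) with inl j => h j | inr _ => 0 end).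
exists (fun i => (W *m hh) i 0) => j.
have jS : lshift n j \in S by apply: (subsetP SFS); apply: imset_f.
have := congr1 (fun M : 'cV_#|S| => M (enum_rank_in jS (lshift n j)) 0) (mulmxA MS W hh).
rewrite hW mul1mx [RHS]mxE enum_rankK_in // (unsplitK (inl j)) => <-.
rewrite mxE; apply: eq_bigr => i _.
by rewrite !mxE enum_rankK_in // tnth_mktuple (unsplitK (inl j)).
Qed.


(** Coordinates are indexed by an arbitrary type, so that entries of tuples of matrices need no
    numbering. Closure under pointwise equality is a constructor, so that functions may be replaced
    without functional extensionality. *)
Inductive polyfun (Z : Type) : ((Z -> C) -> C) -> Prop :=
| polyfun_const c : polyfun (fun _ => c)
| polyfun_var z : polyfun (fun x => x z)
| polyfun_add p q : polyfun p -> polyfun q -> polyfun (fun x => p x + q x)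
| polyfun_mul p q : polyfun p -> polyfun q -> polyfun (fun x => p x * q x)
| polyfun_ext p q : p =1 q -> polyfun p -> polyfun q.

Lemma polyfun_opp (Z : Type) (p : (Z -> C) -> C) : polyfun p -> polyfun (fun x => - p x).
Proof.
move=> hp; apply: (@polyfun_ext _ (fun x => -1 * p x)); first by move=> x; rewrite mulN1r.
by apply: polyfun_mul => //; apply: polyfun_const.
Qed.

Lemma polyfun_sub (Z : Type) (p q : (Z -> C) -> C) :
  polyfun p -> polyfun q -> polyfun (fun x => p x - q x).
Proof. by move=> hp hq; apply: polyfun_add => //; apply: polyfun_opp. Qed.

Lemma polyfun_sum (Z I : Type) (r : seq I) (P : pred I) (p : I -> (Z -> C) -> C) :
  (forall i, P i -> polyfun (p i)) -> polyfun (fun x => \sum_(i <- r | P i) p i x).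
Proof.
move=> h; elim: r => [|i r IH].
  by apply: (@polyfun_ext _ (fun=> 0)); [move=> x; rewrite big_nil|apply: polyfun_const].
case Pi: (P i).
  apply: (@polyfun_ext _ (fun x => p i x + \sum_(i <- r | P i) p i x)).
    by move=> x; rewrite big_cons Pi.
  by apply: polyfun_add => //; apply: h.
by apply: (polyfun_ext _ IH) => x; rewrite big_cons Pi.
Qed.

Lemma polyfun_prod (Z I : Type) (r : seq I) (P : pred I) (p : I -> (Z -> C) -> C) :
  (forall i, P i -> polyfun (p i)) -> polyfun (fun x => \prod_(i <- r | P i) p i x).
Proof.
move=> h; elim: r => [|i r IH].
  by apply: (@polyfun_ext _ (fun=> 1)); [move=> x; rewrite big_nil|apply: polyfun_const].
case Pi: (P i).
  apply: (@polyfun_ext _ (fun x => p i x * \prod_(i <- r | P i) p i x)).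
    by move=> x; rewrite big_cons Pi.
  by apply: polyfun_mul => //; apply: h.
by apply: (polyfun_ext _ IH) => x; rewrite big_cons Pi.
Qed.

Definition polymx (Z : Type) a b (M : (Z -> C) -> 'M[C]_(a, b)) :=
  forall i j, polyfun (fun x => M x i j).

Lemma polymx_mul (Z : Type) a b c (M : (Z -> C) -> 'M[C]_(a, b)) (M' : (Z -> C) -> 'M[C]_(b, c)) :
  polymx M -> polymx M' -> polymx (fun x => M x *m M' x).
Proof.
move=> h h' i j; apply: (@polyfun_ext _ (fun x => \sum_k M x i k * M' x k j)).
  by move=> x; rewrite mxE.
by apply: polyfun_sum => k _; apply: polyfun_mul.
Qed.

Lemma polymx_add (Z : Type) a b (M M' : (Z -> C) -> 'M[C]_(a, b)) :
  polymx M -> polymx M' -> polymx (fun x => M x + M' x).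
Proof.
move=> h h' i j; apply: (@polyfun_ext _ (fun x => M x i j + M' x i j)).
  by move=> x; rewrite mxE.
exact: polyfun_add.
Qed.

Lemma polymx_opp (Z : Type) a b (M : (Z -> C) -> 'M[C]_(a, b)) :
  polymx M -> polymx (fun x => - M x).
Proof.
move=> h i j; apply: (@polyfun_ext _ (fun x => - M x i j)).
  by move=> x; rewrite mxE.
exact: polyfun_opp.
Qed.

Lemma polymx_const (Z : Type) a b (M : 'M[C]_(a, b)) : polymx (fun _ : Z -> C => M).
Proof. by move=> i j; apply: polyfun_const. Qed.

Lemma polyfun_det (Z : Type) a (M : (Z -> C) -> 'M[C]_a) :
  polymx M -> polyfun (fun x => \det (M x)).
Proof.
move=> h; apply: polyfun_sum => s _; apply: polyfun_mul; first exact: polyfun_const.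
by apply: polyfun_prod => i _.
Qed.

Lemma polyfun_comp (Z W : Type) (p : (W -> C) -> C) (F : W -> (Z -> C) -> C) :
  polyfun p -> (forall j, polyfun (F j)) -> polyfun (fun x => p (fun j => F j x)).
Proof.
move=> hp hF; elim: hp => [c|z|p1 q1 _ h1 _ h2|p1 q1 _ h1 _ h2|p1 q1 e _ h1].
- exact: polyfun_const.
- exact: hF.
- exact: polyfun_add.
- exact: polyfun_mul.
- by apply: (polyfun_ext _ h1) => x; apply: e.
Qed.

Lemma polyfun_mpoly (Z : finType) (p : (Z -> C) -> C) : polyfun p ->
  exists P : {mpoly C[#|Z|]}, forall x, p x = P.@[fun i => x (enum_val i)].
Proof.
elim=> [c|z|p1 q1 _ [P hP] _ [Q hQ]|p1 q1 _ [P hP] _ [Q hQ]|p1 q1 e _ [P hP]].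
- by exists c%:MP => x; rewrite mevalC.
- by exists 'X_(enum_rank z) => x; rewrite mevalXU enum_rankK.
- by exists (P + Q) => x; rewrite mevalD hP hQ.
- by exists (P * Q) => x; rewrite mevalM hP hQ.
- by exists P => x; rewrite -e.
Qed.

Lemma mpoly_polyfun (Z : finType) (P : {mpoly C[#|Z|]}) :
  polyfun (fun x : Z -> C => P.@[fun i => x (enum_val i)]).
Proof.
elim/mpoly_closed_ind: P => [c|i|p q hp hq|p q hp hq].
- by apply: (polyfun_ext _ (polyfun_const _ c)) => x; rewrite mevalC.
- by apply: (polyfun_ext _ (polyfun_var (enum_val i))) => x; rewrite mevalXU.
- by apply: (polyfun_ext _ (polyfun_add hp hq)) => x; rewrite mevalD.
- by apply: (polyfun_ext _ (polyfun_mul hp hq)) => x; rewrite mevalM.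
Qed.

Lemma polyfun_line (Z : Type) (p : (Z -> C) -> C) (x w : Z -> C) : polyfun p ->
  exists P : {poly C}, forall t, p (fun z => x z + t * w z) = P.[t].
Proof.
elim=> [c|z|p1 q1 _ [P hP] _ [Q hQ]|p1 q1 _ [P hP] _ [Q hQ]|p1 q1 e _ [P hP]].
- by exists c%:P => t; rewrite hornerC.
- by exists ((x z)%:P + (w z) *: 'X) => t; rewrite !hornerE mulrC.
- by exists (P + Q) => t; rewrite hornerD hP hQ.
- by exists (P * Q) => t; rewrite hornerM hP hQ.
- by exists P => t; rewrite -e.
Qed.

Lemma polyfun_eq1 (Z : Type) (p : (Z -> C) -> C) (x y : Z -> C) :
  polyfun p -> x =1 y -> p x = p y.
Proof.
move=> hp xy; elim: hp => // [p1 q1 _ -> _ ->|p1 q1 _ -> _ ->|p1 q1 e _] //.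
by rewrite !e.
Qed.

(** [O] contains a nonempty principal Zariski-open set. *)
Definition generic (Z : Type) (O : (Z -> C) -> Prop) :=
  exists p, [/\ polyfun p, exists x, p x != 0 & forall x, p x != 0 -> O x].

Lemma poly_nonroot (P : {poly C}) s : P.[s] != 0 -> forall Q u, Q.[u] != 0 ->
  exists t, P.[t] != 0 /\ Q.[t] != 0.
Proof.
move=> Ps Q u Qu; apply: NNPP => h.
have PQ : P * Q = 0.
  apply: poly_fun0 => t; apply/eqP; rewrite hornerM mulf_eq0.
  apply: contraT; rewrite negb_or => /andP[a b]; by case: h; exists t.
have : P * Q != 0.
  by rewrite mulf_neq0 //; apply/eqP => e; move: Ps Qu; rewrite e horner0 eqxx.
by rewrite PQ eqxx.
Qed.

(** Irreducibility of affine space: on the line joining two witnesses both polynomials are nonzero,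
    hence so is their product. *)
Lemma generic_and (Z : Type) (O1 O2 : (Z -> C) -> Prop) :
  generic O1 -> generic O2 -> generic (fun x => O1 x /\ O2 x).
Proof.
move=> [p [hp [x px] p1]] [q [hq [y qy] q1]].
exists (fun x => p x * q x); split; first exact: polyfun_mul.
  have [P hP] := polyfun_line x (fun z => y z - x z) hp.
  have [Q hQ] := polyfun_line x (fun z => y z - x z) hq.
  have Ps : P.[0] != 0.
    rewrite -hP (polyfun_eq1 (y := x) hp) // => z; by rewrite mul0r addr0.
  have Qs : Q.[1] != 0.
    rewrite -hQ (polyfun_eq1 (y := y) hq) // => z; by rewrite mul1r addrC subrK.
  have [t [Pt Qt]] := poly_nonroot Ps Qs.
  by exists (fun z => x z + t * (y z - x z)); rewrite hP hQ mulf_neq0.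
by move=> z; rewrite mulf_eq0 negb_or => /andP[a b]; split; [apply: p1|apply: q1].
Qed.

Lemma generic_imp (Z : Type) (O1 O2 : (Z -> C) -> Prop) :
  (forall x, O1 x -> O2 x) -> generic O1 -> generic O2.
Proof. by move=> h [p [hp e p1]]; exists p; split=> // x /p1 /h. Qed.

Lemma generic_true (Z : Type) : generic (fun _ : Z -> C => True).
Proof.
exists (fun=> 1); split=> //; first exact: polyfun_const.
by exists (fun=> 0); rewrite oner_eq0.
Qed.

Lemma generic_all (Z : Type) (I : finType) (O : I -> (Z -> C) -> Prop) :
  (forall i, generic (O i)) -> generic (fun x => forall i, O i x).
Proof.
move=> h; suff: generic (fun x => forall i, i \in enum I -> O i x).
  by apply: generic_imp => x hx i; apply: hx; rewrite mem_enum.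
elim: (enum I) => [|i r IH]; first by apply: generic_imp (generic_true Z).
apply: generic_imp (generic_and (h i) IH) => x [h1 h2] j.
by rewrite inE => /orP[/eqP ->|/h2].
Qed.

Lemma generic_ex (Z : Type) (O : (Z -> C) -> Prop) : generic O -> exists x, O x.
Proof. by move=> [p [_ [x px] h]]; exists x; apply: h. Qed.

(** Lower semicontinuity of the rank: the bases that normalise [M x0] give a compression of [M x] to
    an [r] by [r] matrix, equal to the identity at [x0]. *)
Lemma generic_rank (Z : Type) a b (M : (Z -> C) -> 'M[C]_(a, b)) x0 :
  polymx M -> generic (fun x => (\rank (M x0) <= \rank (M x))%N).
Proof.
move=> hM; set r := \rank (M x0).
pose A := pid_mx r *m invmx (col_ebase (M x0)) : 'M[C]_(r, a).
pose B := invmx (row_ebase (M x0)) *m pid_mx r : 'M[C]_(b, r).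
exists (fun x => \det (A *m M x *m B)); split.
- by apply: polyfun_det; do ?apply: polymx_mul => //; apply: polymx_const.
- exists x0; rewrite -(mulmx_ebase (M x0)) /A /B.
  rewrite !mulmxA mulmxKV ?col_ebase_unit // -!mulmxA [row_ebase _ *m _]mulmxA.
  rewrite mulmxV ?row_ebase_unit // mul1mx !mulmxA.
  rewrite !pid_mx_id ?rank_leq_row ?rank_leq_col // ?leqnn //.
  by rewrite pid_mx_1 det1 oner_eq0.
- move=> x dx; have : \rank (A *m M x *m B) = r by apply/eqP; rewrite -[_ == _]/(row_free _) row_free_unit unitmxE unitfE.
  move=> <-; apply: leq_trans (mxrankM_maxl _ _) _; exact: mxrankM_maxr.
Qed.

(** If [u *m E] were outside the row space of [A], adjoining it to a basis would give rank
    [\rank A + 1] at [t = 0], hence also at some nonzero [t]. But there [u *m E] is a multiple of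
    [u *m (A + t *: E)], so [A + t *: E] itself would exceed the maximal rank. *)
Lemma max_rank_deformation a b (A E : 'M[C]_(a, b)) (u : 'rV_a) :
  (forall t, (\rank (A + t *: E)%R <= \rank A)%N) -> u *m A = 0 -> (u *m E <= A)%MS.
Proof.
move=> mx uA; apply: contraT => nsub.
pose P := row_base A *m pinvmx A.
have PA : P *m A = row_base A by rewrite mulmxKpV // eq_row_base.
pose M (x : unit -> C) := col_mx (P *m (A + x tt *: E)) (u *m E).
have hM : polymx M.
  move=> i j; rewrite /M; case: (split_ordP i) => k ->.
    apply: (@polyfun_ext _ (fun x => (P *m A) k j + x tt * (P *m E) k j)).
      by move=> x; rewrite col_mxEu mulmxDr -scalemxAr !mxE.
    apply: polyfun_add; [exact: polyfun_const|].
    by apply: polyfun_mul; [apply: polyfun_var|apply: polyfun_const].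
  by apply: (@polyfun_ext _ (fun x => (u *m E) k j)); [move=> x; rewrite col_mxEd|apply: polyfun_const].
have r0 : \rank (M (fun=> 0)) = (\rank A).+1.
  rewrite /M scale0r addr0 PA -addsmxE.
  have cap0 : (row_base A :&: u *m E)%MS = 0.
    apply/eqP; rewrite -submx0; apply/rV_subP => w; rewrite sub_capmx => /andP[wA].
    move/sub_rVP => [c ec]; rewrite submx0 ec; have [->|c0] := eqVneq c 0; first by rewrite scale0r.
    case/negP: nsub; move: wA; rewrite eq_row_base ec => /(scalemx_sub c^-1).
    by rewrite scalerA mulVf // scale1r.
  rewrite mxrank_disjoint_sum // eq_row_base.
  suff -> : \rank (u *m E) = 1%N by rewrite addn1.
  apply/eqP; rewrite eqn_leq rank_leq_row lt0n mxrank_eq0.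
  by apply: contraNneq nsub => ->; apply: sub0mx.
have gen1 : generic (fun x : unit -> C => x tt != 0).
  by exists (fun x => x tt); split=> //; [apply: polyfun_var|exists (fun=> 1); rewrite oner_eq0].
have [x [x0]] := generic_ex (generic_and gen1 (generic_rank (fun=> 0) hM)).
rewrite r0 ltnNge; apply: contraNT => _; apply: leq_trans (mx (x tt)).
apply: mxrankS; rewrite col_mx_sub submxMl /=.
have -> : u *m E = (x tt)^-1 *: (u *m (A + x tt *: E)).
  by rewrite mulmxDr uA add0r -scalemxAr scalerA mulVf // scale1r.
by apply: scalemx_sub; apply: submxMl.
Qed.

Definition dirder (Z : Type) (p : (Z -> C) -> C) (x w : Z -> C) (c : C) :=
  exists P : {poly C}, (forall t, p (fun z => x z + t * w z) = P.[t]) /\ P`_1 = c.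

Section Jacobian.
Variables (Z W : finType) (F : W -> (Z -> C) -> C).
Hypothesis polyF : forall j, polyfun (F j).

Lemma polyfun_tuple : exists Fm : #|W|.-tuple {mpoly C[#|Z|]},
  forall j x, F j x = (tnth Fm (enum_rank j)).@[fun i => x (enum_val i)].
Proof.
have [Fm hFm] := @fin_all_exists _ (fun=> {mpoly C[#|Z|]})
  (fun j P => forall x, F j x = P.@[fun i => x (enum_val i)]) (fun j => polyfun_mpoly (polyF j)).
by exists [tuple Fm (enum_val i) | i < #|W|] => j x; rewrite tnth_mktuple enum_rankK.
Qed.

Lemma dirder_mpoly (Fm : #|W|.-tuple {mpoly C[#|Z|]}) j x w c :
  (forall j x, F j x = (tnth Fm (enum_rank j)).@[fun i => x (enum_val i)]) ->
  dirder (F j) x w c <->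
  \sum_(i < #|Z|) ((tnth Fm (enum_rank j))^`M(i)).@[fun i => x (enum_val i)] * w (enum_val i) = c.
Proof.
move=> hF.
have [Q [hQ dQ]] := meval_line (tnth Fm (enum_rank j)) (fun i => x (enum_val i)) (fun i => w (enum_val i)).
have PQ P : (forall t, F j (fun z => x z + t * w z) = P.[t]) -> P = Q.
  move=> hP; apply/eqP; rewrite -subr_eq0; apply/eqP/poly_fun0 => t.
  by rewrite hornerD hornerN -hP hF hQ subrr.
split=> [[P [/PQ -> <-]]|<-]; first by rewrite dQ.
by exists Q; split=> // t; rewrite hF hQ.
Qed.

(** First half of the Jacobian criterion: a submersion at one point is a dominant map. *)
Lemma polyfun_submersive_eq0 (p : (W -> C) -> C) (x0 : Z -> C) :
  (forall h : W -> C, exists w, forall j, dirder (F j) x0 w (h j)) ->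
  polyfun p -> (forall x, p (fun j => F j x) = 0) -> forall y, p y = 0.
Proof.
move=> surj hp p0 y; have [Fm hF] := polyfun_tuple; have [P hP] := polyfun_mpoly hp.
suff P0 : P = 0 by rewrite hP P0 meval0.
apply: (@submersive_comp_eq0 _ _ Fm (fun i => x0 (enum_val i))).
  move=> h; have [w hw] := surj (fun j => h (enum_rank j)).
  exists (fun i => w (enum_val i)) => j.
  by have /(dirder_mpoly _ _ _ _ hF) := hw (enum_val j); rewrite enum_valK.
apply: mpoly_fun0 => x; rewrite comp_mpoly_meval.
have := p0 (fun z => x (enum_rank z)); rewrite hP => e; rewrite -[RHS]e.
apply: meval_eq => j; rewrite hF enum_valK; apply: meval_eq => i.
by rewrite enum_valK.
Qed.

(** Second half, which rests on characteristic zero: a dominant map is a submersion somewhere. *)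
Lemma polyfun_dominant_submersive :
  (forall p : (W -> C) -> C, polyfun p -> (forall x, p (fun j => F j x) = 0) -> forall y, p y = 0) ->
  exists x0, forall h : W -> C, exists w, forall j, dirder (F j) x0 w (h j).
Proof.
move=> dom; have [Fm hF] := polyfun_tuple.
have [p pF|x0 surj] := alg_independent_submersive (F := Fm).
  apply: mpoly_fun0 => y.
  have := dom _ (mpoly_polyfun p) _ (fun j => y (enum_rank j)) => /= <- //.
    by apply: meval_eq => i; rewrite enum_valK.
  move=> x; have := congr1 (meval (fun i => x (enum_val i))) pF.
  rewrite meval0 comp_mpoly_meval => e; rewrite -[RHS]e.
  by apply: meval_eq => j; rewrite hF enum_valK.
exists (fun z => x0 (enum_rank z)) => h.
have [w hw] := surj (fun j => h (enum_val j)).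
exists (fun z => w (enum_rank z)) => j; apply/(dirder_mpoly _ _ _ _ hF).
have := hw (enum_rank j); rewrite enum_rankK => <-; apply: eq_bigr => i _.
by rewrite enum_valK; congr (_ * _); apply: meval_eq => k; rewrite enum_valK.
Qed.

End Jacobian.

End MPolyExtra.


(** * Dominant Schubert positions *)

Section Positions.
Variables (C : numFieldType) (Q0 Ar : finType) (src tgt : Ar -> Q0).
Variables (N : nat) (v : 'I_N -> Q0) (lt : rel 'I_N).
Hypothesis lt_v : forall y x, lt y x -> v y = v x.
Hypothesis lt_trans : transitive lt.
Hypothesis lt_irr : irreflexive lt.
Hypothesis lt_total : forall x y, v x = v y -> x != y -> lt x y || lt y x.

Notation mat := 'M[C]_N.
Notation set := {set 'I_N}.
Notation Z := (Ar * 'I_N * 'I_N)%type.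
Implicit Types (T Q K L M : set) (f g h : Ar -> mat) (phi psi : mat).

(* All the spaces of a representation are merged into one space with basis ['I_N], [v] giving the vertex
   of a basis vector and [lt] the flags.  The graphs of the maps [phi] with [isH T Q phi] form the
   Schubert cell of position [T] inside the span of [T :|: Q], and [subat f K Q psi] says that the graph
   of [psi] is stable under [f].  [del f] is the linearisation of this condition at a stable coordinate
   subspace, so [dominant T Q] says that the subrepresentations in position [T] sweep out a dense set
   of representations. *)
Definition hpos T Q y x := [&& y \in Q, x \in T & lt y x].
Definition apos Q T (z : Z) :=
  [&& z.1.2 \in Q, z.2 \in T, v z.2 == src z.1.1 & v z.1.2 == tgt z.1.1].
Definition isH T Q phi := forall y x, ~~ hpos T Q y x -> phi y x = 0.
Definition del f phi (z : Z) := (phi *m f z.1.1 - f z.1.1 *m phi) z.1.2 z.2.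
Definition surj T Q f := forall h : Z -> C, exists phi,
  isH T Q phi /\ forall z, apos Q T z -> del f phi z = h z.
Definition dominant T Q := exists f, surj T Q f.

Definition conjf psi f : Ar -> mat := fun a => (1%:M - psi) *m f a *m (1%:M + psi).
Definition subat f K Q psi := isH K Q psi /\
  forall z, apos Q K z -> conjf psi f z.1.1 z.1.2 z.2 = 0.

Definition mxf (g : Z -> C) : Ar -> mat := fun a => \matrix_(y, x) g (a, y, x).
Definition fmx f : Z -> C := fun z => f z.1.1 z.1.2 z.2.

Lemma mxfK f a : mxf (fmx f) a = f a.
Proof. by apply/matrixP => y x; rewrite mxE. Qed.
Lemma fmxK (g : Z -> C) z : fmx (mxf g) z = g z.
Proof. by case: z => [[a y] x]; rewrite /fmx mxE. Qed.

Lemma isH_hpos T Q phi y x : isH T Q phi -> phi y x != 0 -> hpos T Q y x.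
Proof. by move=> h; apply: contraNT => /h ->. Qed.

Lemma isH_v T Q phi y x : isH T Q phi -> phi y x != 0 -> v y = v x.
Proof. by move=> h /(isH_hpos h) /and3P[_ _ /lt_v]. Qed.

Lemma isH_mul0 T Q T' Q' phi phi' : isH T Q phi -> isH T' Q' phi' ->
  [disjoint T & Q'] -> phi *m phi' = 0.
Proof.
move=> h h' dis; apply/matrixP => y x; rewrite !mxE big1 // => z _.
case: (boolP (z \in T)) => zT; last by rewrite h ?mul0r // /hpos (negbTE zT) andbF.
rewrite h' ?mulr0 // /hpos; have := disjointFr dis zT => -> //.
Qed.

Lemma isH_comp T Q L phi psi : isH T Q phi -> isH L (T :\: L) psi -> L \subset T ->
  isH T Q (phi *m (1%:M + psi)).
Proof.
move=> h h' LT y x nh; rewrite mulmxDr mulmx1 mxE h // add0r mxE big1 // => z _.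
apply/eqP; apply: contraNT nh; rewrite mulf_eq0 negb_or => /andP[/(isH_hpos h) h1 /(isH_hpos h') h2].
case/and3P: h1 => yQ _ yz; case/and3P: h2 => _ xL zx.
by rewrite /hpos yQ (subsetP LT) //= (lt_trans yz zx).
Qed.

(** [psi] maps the span of [K] into that of [Q], on which it vanishes, so its square is zero. *)
Lemma unip_mulK psi K Q : isH K Q psi -> [disjoint K & Q] ->
  (1%:M - psi) *m (1%:M + psi) = 1%:M /\ (1%:M + psi) *m (1%:M - psi) = 1%:M.
Proof.
move=> h d; have p2 := isH_mul0 h h d.
split; rewrite mulmxDl mul1mx mulmxDr mulmx1 ?mulNmx ?mulmxN p2 oppr0 addr0.
  by rewrite addrK.
by rewrite subrK.
Qed.

Definition Hs T Q := {p : 'I_N * 'I_N | hpos T Q p.1 p.2}.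
Definition As Q T := {z : Z | apos Q T z}.

Definition Hmx T Q (s : Hs T Q) : mat := delta_mx (val s).1 (val s).2.

(** The differential [del f] acting on row vectors: surjectivity is [row_full], and left kernel
    vectors are the maps that it annihilates. *)
Definition dmx T Q f : 'M[C]_(#|{: Hs T Q}|, #|{: As Q T}|) :=
  \matrix_(s, z) del f (Hmx (enum_val s)) (val (enum_val z)).

Definition toH T Q (u : 'rV[C]_#|{: Hs T Q}|) : mat := \sum_s u 0 s *: Hmx (enum_val s).
Definition ofH T Q phi : 'rV[C]_#|{: Hs T Q}| := \row_s phi (val (enum_val s)).1 (val (enum_val s)).2.

Lemma toH_isH T Q u : isH T Q (@toH T Q u).
Proof.
move=> y x nh; rewrite /toH summxE big1 // => s _; rewrite !mxE.
case: eqP => [e1|_]; last by rewrite mulr0.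
case: eqP => [e2|_]; last by rewrite mulr0.
by move: nh; rewrite e1 e2 (valP (enum_val s)).
Qed.

Lemma toHE T Q u y x (hp : hpos T Q y x) :
  @toH T Q u y x = u 0 (enum_rank (exist _ (y, x) hp : Hs T Q)).
Proof.
rewrite /toH summxE (bigD1 (enum_rank (exist _ (y, x) hp : Hs T Q))) //= !mxE enum_rankK /=.
rewrite !eqxx mulr1 big1 ?addr0 // => s sn; rewrite !mxE.
case: eqP => //= [e1|_]; last by rewrite mulr0.
case: eqP => //= [e2|_]; last by rewrite mulr0.
case/eqP: sn; apply: enum_val_inj; rewrite enum_rankK; apply: val_inj => /=.
by rewrite e1 e2 -surjective_pairing.
Qed.

Lemma ofHK T Q phi : isH T Q phi -> toH (ofH T Q phi) = phi.
Proof.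
move=> h; apply/matrixP => y x; case: (boolP (hpos T Q y x)) => hp; last first.
  by rewrite toH_isH // h.
by rewrite (toHE _ hp) mxE enum_rankK.
Qed.

Lemma toHK T Q u : ofH T Q (@toH T Q u) = u.
Proof.
apply/rowP => s; rewrite mxE; case E: (enum_val s) => [[y x] hp] /=.
by rewrite (toHE _ hp) -E enum_valK.
Qed.

Lemma del_sum f (I : finType) (c : I -> C) (phi : I -> mat) z :
  del f (\sum_i c i *: phi i) z = \sum_i c i * del f (phi i) z.
Proof.
rewrite /del mulmx_suml mulmx_sumr -sumrB summxE; apply: eq_bigr => i _.
by rewrite -scalemxAl -scalemxAr -scalerBr mxE.
Qed.

Lemma mul_dmx T Q f (u : 'rV_#|{: Hs T Q}|) z :
  (u *m dmx T Q f) 0 z = del f (toH u) (val (enum_val z)).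
Proof. by rewrite mxE del_sum; apply: eq_bigr => s _; rewrite mxE. Qed.

Lemma surjP T Q f : surj T Q f <-> row_full (dmx T Q f).
Proof.
split=> [sj|/row_fullP [G hG] h].
  rewrite -sub1mx; apply/row_subP => z.
  have [phi [hphi e]] := sj (fun z' => (z' == val (enum_val z))%:R).
  apply/submxP; exists (ofH T Q phi); apply/rowP => z'.
  rewrite mul_dmx ofHK // e ?(valP (enum_val z')) // !mxE eq_sym (inj_eq val_inj).
  by rewrite (inj_eq enum_val_inj).
pose hr : 'rV[C]_#|{: As Q T}| := \row_z h (val (enum_val z)).
exists (toH (hr *m G)); split=> [|z az]; first exact: toH_isH.
have := mul_dmx f (hr *m G) (enum_rank (exist _ z az : As Q T)).
by rewrite enum_rankK /= -mulmxA hG mulmx1 mxE enum_rankK => <-.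
Qed.

Lemma surj_card T Q f : surj T Q f -> (#|{: As Q T}| <= #|{: Hs T Q}|)%N.
Proof. by move/surjP => h; rewrite -(eqP h) rank_leq_row. Qed.

Lemma delD f g t phi z : del (fun a => f a + t *: g a) phi z = del f phi z + t * del g phi z.
Proof.
rewrite /del mulmxDr mulmxDl -scalemxAr -scalemxAl opprD addrACA -scalerBr.
by rewrite [LHS]mxE; congr (_ + _); rewrite mxE.
Qed.

Lemma delDr f phi psi z : del f (phi + psi) z = del f phi z + del f psi z.
Proof. by rewrite /del mulmxDl mulmxDr opprD addrACA mxE. Qed.

Lemma dmxD T Q f g t : dmx T Q (fun a => f a + t *: g a) = dmx T Q f + t *: dmx T Q g.
Proof. by apply/matrixP => s z; rewrite !mxE delD. Qed.

Lemma polyfun_del T Q phi (z : Z) : polyfun (fun g : Z -> C => del (mxf g) phi z).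
Proof.
apply: (@polyfun_ext _ _ (fun g : Z -> C => \sum_k phi z.1.2 k * g (z.1.1, k, z.2)
    - \sum_k g (z.1.1, z.1.2, k) * phi k z.2)).
  move=> g; rewrite /del !mxE; congr (_ - _); apply: eq_bigr => k _; by rewrite mxE.
by apply: polyfun_sub; apply: polyfun_sum => k _; apply: polyfun_mul;
  do ?[exact: polyfun_const|exact: polyfun_var].
Qed.

Lemma polymx_dmx T Q : polymx (fun g : Z -> C => dmx T Q (mxf g)).
Proof.
move=> s z; apply: (@polyfun_ext _ _ (fun g : Z -> C => del (mxf g) (Hmx (enum_val s)) (val (enum_val z)))).
  by move=> g; rewrite mxE.
exact: polyfun_del.
Qed.

Lemma eq_del f g phi z : f z.1.1 = g z.1.1 -> del f phi z = del g phi z.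
Proof. by rewrite /del => ->. Qed.

Lemma eq_dmx T Q f g : f =1 g -> dmx T Q f = dmx T Q g.
Proof. by move=> e; apply/matrixP => s z; rewrite !mxE; apply: eq_del. Qed.

Lemma generic_surj T Q f : surj T Q f -> generic (fun g : Z -> C => surj T Q (mxf g)).
Proof.
move=> /surjP sf; refine (generic_imp _ (generic_rank (fmx f) (@polymx_dmx T Q))) => g.
rewrite (eq_dmx _ _ (mxfK f)) (eqP sf) => r; apply/surjP.
by rewrite /row_full eqn_leq rank_leq_col.
Qed.

(** [phi] goes from the span of [T] to that of [Q], so only the blocks of [f] inside [T] and inside
    [Q] enter the commutator. *)
Lemma del_local T Q f g phi z : isH T Q phi -> apos Q T z ->
  (forall y x, y \in T -> x \in T -> v x = src z.1.1 -> v y = tgt z.1.1 -> f z.1.1 y x = g z.1.1 y x) ->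
  (forall y x, y \in Q -> x \in Q -> v x = src z.1.1 -> v y = tgt z.1.1 -> f z.1.1 y x = g z.1.1 y x) ->
  del f phi z = del g phi z.
Proof.
case: z => [[a y] x] h /and4P[/= yQ xT /eqP vx /eqP vy] e1 e2.
rewrite /del /= !mxE; congr (_ - _); apply: eq_bigr => k _.
  have [->|n0] := eqVneq (phi y k) 0; first by rewrite !mul0r.
  have /and3P[_ kT /lt_v yk] := isH_hpos h n0.
  by rewrite e1 // -vy yk.
have [->|n0] := eqVneq (phi k x) 0; first by rewrite !mulr0.
have /and3P[kQ _ /lt_v kx] := isH_hpos h n0.
by rewrite e2 // -vx kx.
Qed.

Lemma surj_local T Q f g :
  (forall a y x, y \in T -> x \in T -> v x = src a -> v y = tgt a -> f a y x = g a y x) ->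
  (forall a y x, y \in Q -> x \in Q -> v x = src a -> v y = tgt a -> f a y x = g a y x) ->
  surj T Q f -> surj T Q g.
Proof.
move=> e1 e2 sf h; have [phi [hp e]] := sf h; exists phi; split=> // z az.
rewrite -e //; symmetry; apply: del_local hp az _ _ => y x *; [exact: e1|exact: e2].
Qed.

Lemma sum_As Q T (G : Z -> C) :
  \sum_(k < #|{: As Q T}|) G (val (enum_val k)) = \sum_(z | apos Q T z) G z.
Proof.
rewrite [RHS](reindex_omap (val : As Q T -> Z) insub) /=; last first.
  by move=> z az; rewrite insubT.
rewrite [RHS](reindex (@enum_val _ (mem {: As Q T}))) /=; last by apply: onW_bij; apply: enum_val_bij.
by apply: eq_bigl => k; rewrite (valP (enum_val k)) valK eqxx.
Qed.

(** * The differential under a unipotent change of basis *)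

Section Conj.
Variables (T Q L : set) (psi : mat).
Hypotheses (dTQ : [disjoint T & Q]) (LT : L \subset T) (hpsi : isH L (T :\: L) psi).

Let dL : [disjoint L & T :\: L].
Proof. by rewrite disjoint_sym; apply/setDidPl; rewrite setDDl setUid. Qed.

Lemma psi_row0 (A : mat) y x : y \in Q -> (psi *m A) y x = 0.
Proof.
move=> yQ; rewrite mxE big1 // => k _; rewrite hpsi ?mul0r // /hpos inE.
by rewrite (disjointFl dTQ yQ) andbF.
Qed.

Lemma psi_mul_isH phi : isH T Q phi -> psi *m phi = 0.
Proof.
by move=> h; apply: (isH_mul0 hpsi h); apply: disjointWl dTQ.
Qed.

(** In the basis moved by [psi] the differential is the old one followed by [1 + psi]: [psi] kills
    the image of [phi] and has zero rows on [Q], so the left factor [1 - psi] is not seen. *)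
Lemma del_conj f phi z : isH T Q phi -> z.1.2 \in Q ->
  del (conjf psi f) (phi *m (1%:M + psi)) z =
  ((phi *m f z.1.1 - f z.1.1 *m phi) *m (1%:M + psi)) z.1.2 z.2.
Proof.
move=> h yQ; rewrite /del /conjf; have [e1 e2] := unip_mulK hpsi dL.
rewrite -!mulmxA [(1%:M + psi) *m (_ *m _)]mulmxA e2 mul1mx.
rewrite [(1%:M + psi) *m (_ *m _)]mulmxA [(1%:M + psi) *m phi]mulmxDl mul1mx psi_mul_isH // addr0.
rewrite [(1%:M - psi) *m _]mulmxBl mul1mx [in RHS]mulmxBl -!mulmxA.
set A := phi *m _; set B := f _ *m _.
have : (psi *m B) z.1.2 z.2 = 0 by apply: psi_row0.
by move: (psi *m B) => D e; clearbody A B; rewrite !mxE e oppr0 addr0.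
Qed.

Lemma apos_psi a y x z : apos Q T (a, y, x) -> (1%:M + psi) z x != 0 -> apos Q T (a, y, z).
Proof.
rewrite !mxE => /and4P[/= yQ xT vx vy]; have [-> _|zx /=] := eqVneq z x.
  by rewrite /apos /= yQ xT vx vy.
rewrite add0r => /(isH_hpos hpsi) /and3P[]; rewrite inE => /andP[_ zT] _ /lt_v e.
by rewrite /apos /= yQ zT e vx vy.
Qed.

Lemma surj_conj f : surj T Q f -> surj T Q (conjf psi f).
Proof.
move=> sf h.
have [phi [hp e]] := sf (fun z => (mxf h z.1.1 *m (1%:M - psi)) z.1.2 z.2).
exists (phi *m (1%:M + psi)); split; first exact: (isH_comp hp hpsi LT).
move=> [[a y] x] az; rewrite del_conj //=; last by case/and4P: az.
have [e1 _] := unip_mulK hpsi dL.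
transitivity (((mxf h a *m (1%:M - psi)) *m (1%:M + psi)) y x).
  rewrite [LHS]mxE [RHS]mxE; apply: eq_bigr => z _.
  have [->|n0] := eqVneq ((1%:M + psi) z x) 0; first by rewrite !mulr0.
  by have := e (a, y, z) (apos_psi az n0); rewrite /del /= => ->.
by rewrite -mulmxA e1 mulmx1 mxE.
Qed.

(** Substituting [phi *m (1 + psi)] in the source and multiplying by [1 - psi] in the target, which
    is the matrix [Tm], recovers the old differential from the new one. *)
Lemma rank_conj f : (\rank (dmx T Q f) <= \rank (dmx T Q (conjf psi f)))%N.
Proof.
pose Tm : 'M[C]_#|{: As Q T}| := \matrix_(z', z)
  (((val (enum_val z')).1 == (val (enum_val z)).1)%:R * (1%:M - psi) (val (enum_val z')).2 (val (enum_val z)).2).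
apply: leq_trans (mxrankM_maxl _ Tm); apply: mxrankS; apply/row_subP => s.
rewrite -[row s _]mul1mx.
set phi := Hmx (enum_val s); have hphi : isH T Q phi.
  move=> y x nh; rewrite /phi mxE; case: eqP => //= e1; case: eqP => //= e2.
  by move: nh; rewrite e1 e2 (valP (enum_val s)).
apply/submxP; exists (ofH T Q (phi *m (1%:M + psi))).
apply/rowP => z; rewrite mulmxA [RHS]mxE mul1mx !mxE.
case E: (enum_val z) => [[[a y] x] az] /=.
have [yQ xT vx vy] := and4P az.
pose X (z' : Z) := del (conjf psi f) (phi *m (1%:M + psi)) z'.
transitivity (\sum_(k < #|{: As Q T}|) X (val (enum_val k)) *
   (((val (enum_val k)).1 == (a, y))%:R * (1%:M - psi) (val (enum_val k)).2 x)); last first.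
  apply: eq_bigr => k _; rewrite mul_dmx ofHK; last exact: (isH_comp hphi hpsi LT).
  by rewrite !mxE E.
rewrite (sum_As Q T (fun z' => X z' * ((z'.1 == (a, y))%:R * (1%:M - psi) z'.2 x))).
rewrite big_mkcond /=.
rewrite -(pair_bigA _ (fun p x' => if apos Q T (p, x') then
   X (p, x') * ((p == (a, y))%:R * (1%:M - psi) x' x) else 0)) /=.
rewrite (bigD1 (a, y)) //= [X in _ + X]big1 ?addr0; last first.
  by move=> p /negbTE pn; rewrite big1 // => x' _; rewrite pn mul0r mulr0; case: ifP.
have [_ e2] := unip_mulK hpsi dL.
transitivity (((phi *m f a - f a *m phi) *m (1%:M + psi) *m (1%:M - psi)) y x).
  by rewrite -mulmxA e2 mulmx1.
rewrite [LHS]mxE; apply: eq_bigr => x' _; rewrite eqxx mul1r.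
case: ifPn => az'; first by rewrite /X del_conj.
suff -> : (1%:M - psi) x' x = 0 by rewrite mulr0.
apply/eqP; apply: contraNT az' => n0; apply: (apos_psi az).
have [e|ne] := eqVneq x' x; last by move: n0; rewrite !mxE (negbTE ne) !add0r oppr_eq0.
by move: n0; rewrite e !mxE (@hpsi x x) ?oppr0 // /hpos lt_irr !andbF.
Qed.

End Conj.

Lemma disjointD T L : [disjoint L & T :\: L].
Proof. by rewrite disjoint_sym; apply/setDidPl; rewrite setDDl setUid. Qed.

(** Column reduction along the flags. A column of [phi] is put in [L] when it depends on earlier
    ones; subtracting that combination, encoded in [psi], makes it zero, while the remaining columns
    are independent and admit a left inverse [G]. Thus the graph of [psi] over [L] is the kernel of
    [phi] on the span of [T], in its Schubert position. *)
Lemma echelon T Q phi : isH T Q phi ->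
  exists L psi G, [/\ L \subset T, isH L (T :\: L) psi,
    forall y x, x \in L -> (phi *m (1%:M + psi)) y x = 0 &
    forall x x', x \in T :\: L -> x' \in T :\: L ->
      (G *m (phi *m (1%:M + psi))) x x' = (x == x')%:R].
Proof.
move=> hphi; pose c x : 'rV[C]_N := row x phi^T.
(* Columns at different vertices have disjoint supports, so linear relations split into relations at
   single vertices. *)
have cv x y : c x 0 y != 0 -> v y = v x by rewrite !mxE; apply: (isH_v hphi).
pose L := [set x in T | (c x <= \sum_(x' in T | lt x' x) <<c x'>>)%MS].
have LT : L \subset T by apply/subsetP => x; rewrite inE => /andP[].
(* Replacing dependent columns recursively expresses every column through independent ones that do
   not come later. *)
have cspan x : x \in T -> (c x <= \sum_(z in (T :\: L)%SET | (z == x) || lt z x) <<c z>>)%MS.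
  have [k] := ubnP #|[set z | lt z x]|; elim: k x => // k IH x; rewrite ltnS => kx xT.
  case: (boolP (x \in L)) => xL; last first.
    apply: (sumsmx_sup x); last by rewrite genmxE.
    by rewrite eqxx andbT in_setD xL xT.
  move: (xL); rewrite inE xT /= => /submx_trans; apply; apply/sumsmx_subP => x' /andP[x'T x'x].
  rewrite genmxE; apply: submx_trans (IH _ _ x'T) _.
    apply: leq_trans kx; apply: proper_card; apply/properP; split.
      by apply/subsetP => z; rewrite !inE => /lt_trans; apply.
    by exists x'; rewrite !inE ?lt_irr.
  apply/sumsmx_subP => z /andP[zT zx']; apply: (sumsmx_sup z) => //.
  by rewrite zT /=; case/orP: zx' => [/eqP ->|/lt_trans ->]; rewrite ?x'x ?orbT.
have [cf hcf] : exists cf : 'I_N -> 'I_N -> C, forall x, x \in L ->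
    c x = \sum_(z in T :\: L | lt z x) cf x z *: c z.
  apply: (@fin_all_exists _ (fun=> 'I_N -> C) (fun x cf => x \in L ->
    c x = \sum_(z in T :\: L | lt z x) cf z *: c z)) => x.
  case: (boolP (x \in L)) => xL; last by exists (fun=> 0).
  have := cspan x (subsetP LT x xL).
  rewrite (eq_bigl (fun z => (z \in T :\: L) && lt z x)) => [|z]; last first.
    by case: eqP => //= ->; rewrite !inE lt_irr andbF; move: xL; rewrite inE => ->.
  move/sub_sumsmxP => [u ->].
  have [w hw] : exists w : 'I_N -> C, forall z, u z *m <<c z>>%MS = w z *: c z.
    apply: (@fin_all_exists _ (fun=> C) (fun z w => u z *m <<c z>>%MS = w *: c z)) => z.
    by apply/sub_rVP; rewrite (submx_trans (submxMl _ _)) // genmxE.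
  by exists w => _; apply: eq_bigr => z _.
pose psi : mat := \matrix_(z, x) if hpos L (T :\: L) z x then - cf x z else 0.
have hpsi : isH L (T :\: L) psi by move=> z x /negbTE n; rewrite mxE n.
pose k := #|T :\: L|.
pose Mt : 'M[C]_(k, N) := \matrix_(i < k) c (enum_val i).
(* In a nontrivial relation, a column with nonzero coefficient and the most predecessors would
   depend on earlier columns at its own vertex, hence belong to [L]. *)
have free : row_free Mt.
  apply: inj_row_free => u; rewrite mulmx_sum_row => e.
  apply/eqP; apply: contraT => /rV0Pn [i0 ui0].
  pose P i := u 0 i != 0; pose m (i : 'I_k) := #|[set z | lt z (enum_val i)]|.
  case: (@arg_maxnP _ i0 P m ui0) => i1 Pi1 mx1.
  set z1 := enum_val i1; have z1T : z1 \in T :\: L := enum_valP i1.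
  have lti i : P i -> i != i1 -> v (enum_val i) = v z1 -> lt (enum_val i) z1.
    move=> Pi ii1 vi; have /orP[//|l] := lt_total vi (contra_neq (@enum_val_inj _ _ i i1) ii1).
    have := mx1 i Pi; rewrite /geq /= leqNgt => /negP; case; apply: proper_card; apply/properP; split.
      by apply/subsetP => z; rewrite !inE => /lt_trans; apply.
    by exists z1; rewrite !inE ?lt_irr.
  have : z1 \in L.
    move: (z1T); rewrite !inE => /andP[_ ->] /=.
    have -> : c z1 = \sum_(i | P i && (i != i1) && (v (enum_val i) == v z1)) (- (u 0 i1)^-1 * u 0 i) *: c (enum_val i).
      apply/rowP => y; rewrite summxE.
      have [vy|vy] := eqVneq (v y) (v z1); last first.
        have -> : c z1 0 y = 0 by apply/eqP; apply: contraNT vy => /cv ->.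
        rewrite big1 // => i /andP[_ /eqP vi]; rewrite mxE.
        have -> : c (enum_val i) 0 y = 0 by apply/eqP; apply: contraNT vy => /cv ->; rewrite vi.
        by rewrite mulr0.
      have := congr1 (fun r : 'rV_N => r 0 y) e; rewrite summxE [RHS]mxE (bigD1 i1) //= rowK mxE.
      move/eqP; rewrite addr_eq0 => /eqP e1.
      apply: (mulfI Pi1); rewrite e1 mulr_sumr -sumrN.
      rewrite [LHS](bigID (fun i => P i && (v (enum_val i) == v z1))) /= [X in _ + X]big1 ?addr0.
        apply: eq_big => [i|i _]; first by rewrite andbA [(i != i1) && _]andbC.
        by rewrite rowK !mxE mulrA mulrA mulrN divff // mulN1r mulNr.
      move=> i /andP[_]; rewrite negb_and rowK => /orP[|vi].
        by rewrite negbK => /eqP ui; rewrite mxE ui mul0r oppr0.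
      have -> : (u 0 i *: c (enum_val i)) 0 y = 0; last by rewrite oppr0.
      rewrite mxE (_ : c _ 0 y = 0) ?mulr0 //; apply/eqP; apply: contraNT vi => /cv <-.
      by rewrite vy.
    apply: summx_sub => i /andP[/andP[Pi ii1] /eqP vi]; apply: scalemx_sub.
    apply: (sumsmx_sup (enum_val i)); last by rewrite genmxE.
    by rewrite lti // andbT; have := enum_valP i; rewrite inE => /andP[].
  by move: z1T; rewrite inE => /andP[/negbTE ->].
have [W hW] := row_freeP free.
have nL x y : x \notin L -> (phi *m (1%:M + psi)) y x = phi y x.
  move=> xL; rewrite mulmxDr mulmx1 mxE [X in _ + X]mxE big1 ?addr0 // => z _.
  by rewrite hpsi ?mulr0 // /hpos (negbTE xL) andbF.
exists L, psi, (\matrix_(z, y) \sum_(i < k | enum_val i == z) W y i); split=> //.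
- move=> y x xL; rewrite mulmxDr mulmx1 mxE [X in _ + X]mxE.
  have := congr1 (fun r : 'rV_N => r 0 y) (hcf x xL); rewrite !mxE summxE => ->.
  rewrite [X in _ + X](bigID (fun z => hpos L (T :\: L) z x)) /= [X in _ + (_ + X)]big1 ?addr0; last first.
    by move=> z n; rewrite mxE (negbTE n) mulr0.
  rewrite (eq_bigl (fun z => hpos L (T :\: L) z x)); last by move=> z; rewrite /hpos xL.
  rewrite -big_split big1 //= => z hz; rewrite !mxE hz mulrN mulrC subrr //.
- move=> x x' xT x'T; rewrite mxE.
  have x'L : x' \notin L by move: x'T; rewrite inE => /andP[].
  under eq_bigr => y _ do rewrite nL // mxE.
  rewrite (eq_bigr (fun y => W y (enum_rank_in xT x) * phi y x')); last first.
    move=> y _; congr (_ * _); rewrite (bigD1 (enum_rank_in xT x)) /=; last by rewrite enum_rankK_in.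
    rewrite big1 ?addr0 // => i /andP[/eqP e /eqP n]; case: n; apply: enum_val_inj.
    by rewrite e enum_rankK_in.
  have := congr1 (fun M : 'M_k => M (enum_rank_in x'T x') (enum_rank_in xT x)) hW.
  rewrite mxE => e; transitivity (\sum_y Mt (enum_rank_in x'T x') y * W y (enum_rank_in xT x)).
    by apply: eq_bigr => y _; rewrite !mxE enum_rankK_in // mulrC.
  rewrite e mxE; congr (_ %:R); congr nat_of_bool; apply/eqP/eqP => [e1|e1].
    by rewrite -(enum_rankK_in xT xT) -e1 enum_rankK_in.
  by apply: enum_val_inj; rewrite !enum_rankK_in // e1.
Qed.

Lemma dirder_uniq (Y : Type) (p : (Y -> C) -> C) x w c c' :
  dirder p x w c -> dirder p x w c' -> c = c'.
Proof.
move=> [P [hP <-]] [P' [hP' <-]]; congr (_ `_ _); congr polyseq.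
apply/eqP; rewrite -subr_eq0; apply/eqP/poly_fun0 => t.
by rewrite hornerD hornerN -hP -hP' subrr.
Qed.

Lemma mx_addsubE (A M B : mat) y x : (A + M - B) y x = M y x + (A - B) y x.
Proof. by rewrite !mxE addrCA addrA. Qed.

(** * The family of representations with a stable graph in a given position *)

Section Family.
Variables (K Q : set).
Hypothesis dKQ : [disjoint K & Q].
Notation Y := (Hs K Q + Z)%type.

Definition psiof (x : Y -> C) : mat := \matrix_(y, y')
  if insub (y, y') is Some s then x (inl (s : Hs K Q)) else 0.
Definition msk (r : Z -> C) (a : Ar) : mat := \matrix_(y, y') if apos Q K (a, y, y') then 0 else r (a, y, y').
(** In the basis moved by [psi], stability means that the block from [K] to [Q] is zero: [msk]
    deletes this block from free parameters [r], and conjugation moves back. [Ffam] below is the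
    resulting polynomial parametrisation, by [psi] and [r], of all stable [f]. *)
Definition fam (r : Z -> C) psi (a : Ar) : mat := (1%:M + psi) *m msk r a *m (1%:M - psi).
Definition Ffam (z : Z) (x : Y -> C) : C := fam (fun z => x (inr z)) (psiof x) z.1.1 z.1.2 z.2.

Lemma psiof_isH x : isH K Q (psiof x).
Proof.
move=> y y' n; rewrite mxE; case: insubP => // s /= hs e.
by rewrite hs in n.
Qed.

Lemma polymx_psiof : polymx psiof.
Proof.
move=> y y'; case E: (insub (y, y') : option (Hs K Q)) => [s|].
  apply: (polyfun_ext _ (polyfun_var C (inl s : Y))) => x; by rewrite mxE E.
by apply: (polyfun_ext _ (polyfun_const Y (0 : C))) => x; rewrite mxE E.
Qed.

Lemma polymx_msk a : polymx (fun r : Z -> C => msk r a).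
Proof.
move=> y y'; case E: (apos Q K (a, y, y')).
  by apply: (polyfun_ext _ (polyfun_const _ (0 : C))) => x; rewrite mxE E.
by apply: (polyfun_ext _ (polyfun_var C (a, y, y'))) => x; rewrite mxE E.
Qed.

Lemma polymx_fam psi a : polymx (fun r : Z -> C => fam r psi a).
Proof.
by apply: polymx_mul; [apply: polymx_mul; [apply: polymx_const|apply: polymx_msk]|apply: polymx_const].
Qed.

Lemma polyfun_Ffam z : polyfun (Ffam z).
Proof.
have hm : polymx (fun x : Y -> C => msk (fun z => x (inr z)) z.1.1).
  move=> y y'; apply: (polyfun_comp (F := fun z (x : Y -> C) => x (inr z)) (polymx_msk z.1.1 y y')).
  by move=> j; apply: polyfun_var.
suff h : polymx (fun x : Y -> C => (1%:M + psiof x) *m msk (fun z => x (inr z)) z.1.1 *m (1%:M - psiof x)).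
  exact: h.
apply: polymx_mul; [apply: polymx_mul => //; apply: polymx_add|apply: polymx_add].
- exact: polymx_const.
- exact: polymx_psiof.
- exact: polymx_const.
- by apply: polymx_opp; apply: polymx_psiof.
Qed.

Lemma psiof_line x w t : psiof (fun z => x z + t * w z) = psiof x + t *: psiof w.
Proof.
by apply/matrixP => y y'; rewrite !mxE; case: insub => [s|] //; rewrite mulr0 addr0.
Qed.

Lemma msk_line (x w : Z -> C) t a :
  msk (fun z => x z + t * w z) a = msk x a + t *: msk w a.
Proof.
by apply/matrixP => y y'; rewrite !mxE; case: ifP => _ //; rewrite mulr0 addr0.
Qed.

Lemma cubic_expand (A B R S A' : mat) t :
  (A + t *: B) *m (R + t *: S) *m (A' - t *: B) =
  A *m R *m A' + t *: (B *m R *m A' + A *m S *m A' - A *m R *m B +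
    t *: (B *m S *m A' - B *m R *m B - A *m S *m B + t *: - (B *m S *m B))).
Proof.
rewrite !(mulmxDl, mulmxDr, mulmxN, mulNmx) -?(scalemxAl, scalemxAr) -?(scalemxAl, scalemxAr).
move: (A *m R *m A') (B *m R *m A') (A *m S *m A') (A *m R *m B) (B *m S *m A') (B *m R *m B) (A *m S *m B) (B *m S *m B).
by move=> ????????; apply/matrixP => i j; rewrite !mxE; ring.
Qed.

(** The linear coefficient of a cubic in [t]. At [psi = 0] it is [B *m R - R *m B + S]: the
    differential [del] plus the directions left free by [msk]. *)
Lemma dirder_Ffam x w z :
  let A := 1%:M + psiof x in let A' := 1%:M - psiof x in let B := psiof w in
  let R := msk (fun z => x (inr z)) z.1.1 in let S := msk (fun z => w (inr z)) z.1.1 in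
  dirder (Ffam z) x w ((B *m R *m A' + A *m S *m A' - A *m R *m B) z.1.2 z.2).
Proof.
move=> A A' B R S.
pose c0 := A *m R *m A'.
pose c1 := B *m R *m A' + A *m S *m A' - A *m R *m B.
pose c2 := B *m S *m A' - B *m R *m B - A *m S *m B.
pose c3 := - (B *m S *m B).
exists (Poly [:: c0 z.1.2 z.2; c1 z.1.2 z.2; c2 z.1.2 z.2; c3 z.1.2 z.2]); split; last by rewrite coef_Poly.
move=> t; rewrite /Ffam /fam psiof_line.
rewrite (_ : msk _ _ = R + t *: S); last exact: msk_line.
rewrite opprD !addrA -/A -/A' -/B.
rewrite cubic_expand -/c0 -/c1 -/c2 -/c3.
rewrite horner_Poly /= mul0r add0r; clearbody c0 c1 c2 c3; rewrite !mxE.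
ring.
Qed.

Lemma conjf_fam r psi a : isH K Q psi -> conjf psi (fam r psi) a = msk r a.
Proof.
move=> h; have [e1 e2] := unip_mulK h dKQ.
by rewrite /conjf /fam -!mulmxA e1 mulmx1 mulmxA e1 mul1mx.
Qed.

Lemma fam_subat r psi : isH K Q psi -> subat (fam r psi) K Q psi.
Proof. by move=> h; split=> // [[[a y] x]] az; rewrite conjf_fam // mxE az. Qed.

Lemma subat_fam f psi a : subat f K Q psi -> fam (fmx (conjf psi f)) psi a = f a.
Proof.
move=> [h z0]; have [e1 e2] := unip_mulK h dKQ.
rewrite /fam (_ : msk _ a = conjf psi f a).
  by rewrite /conjf !mulmxA e2 mul1mx -mulmxA e2 mulmx1.
by apply/matrixP => y x; rewrite mxE; case: ifP => // /z0 /= ->.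
Qed.

(** At [psi = 0] the family is a submersion: [del] reaches the entries deleted by [msk], and the
    parameters [r] reach the others. *)
Lemma dominant_dense : dominant K Q -> forall p : (Z -> C) -> C, polyfun p ->
  (exists x, p x != 0) -> exists r psi, isH K Q psi /\ p (fmx (fam r psi)) != 0.
Proof.
move=> [f0 sf] p hp [x px]; apply: NNPP => H.
have p0 (w : Y -> C) : p (fun z => Ffam z w) = 0.
  apply/eqP; apply: contraT => n; case: H.
  by exists (fun z => w (inr z)), (psiof w); split; [apply: psiof_isH|].
pose x0 (w : Y) : C := if w is inr z then fmx f0 z else 0.
have psi0 : psiof x0 = 0 by apply/matrixP => y y'; rewrite !mxE; case: insub.
(* [msk] changes only the block from [K] to [Q], which does not occur in [del]. *)
have sm : surj K Q (msk (fmx f0)).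
  apply: surj_local sf => a y y' yK y'K _ _; rewrite mxE; case: ifP => // /and4P[/= h1 h2 _ _].
    by rewrite (disjointFr dKQ yK) in h1.
  by rewrite (disjointFl dKQ y'K) in h2.
move: px; rewrite (polyfun_submersive_eq0 polyfun_Ffam (x0 := x0) _ hp p0) ?eqxx // => h.
have [phi [hphi e]] := sm h.
pose w (s : Y) : C := match s with inl s => phi (val s).1 (val s).2
  | inr z => h z - del (msk (fmx f0)) phi z end.
have pw : psiof w = phi.
  apply/matrixP => y y'; rewrite mxE; case: insubP => [s _ /= ->//|n].
  by rewrite hphi.
exists w => [[[a y] y']].
have := dirder_Ffam x0 w (a, y, y'); cbv zeta; rewrite psi0 addr0 subr0 !mul1mx !mulmx1 pw /=.
rewrite mx_addsubE -[X in _ + X]/(del (msk (fmx f0)) phi (a, y, y')) mxE; case: ifP => az.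
  by rewrite add0r e.
by rewrite subrK.
Qed.

(** If [K] is not dominant, the second half of the Jacobian criterion confines the whole family to a
    hypersurface, and off this hypersurface no representation is stable on a graph in position
    [K]. *)
Lemma generic_subat :
  generic (fun g : Z -> C => forall psi, subat (mxf g) K Q psi -> dominant K Q).
Proof.
case: (classic (dominant K Q)) => [dom|ndom].
  exact: generic_imp (generic_true _ _).
have [p [hp pF [y py]]] : exists p : (Z -> C) -> C, [/\ polyfun p,
    forall x : Y -> C, p (fun z => Ffam z x) = 0 & exists y, p y != 0].
  apply: NNPP => H; apply: ndom.
  have [p hp pF y|x0 sx] := polyfun_dominant_submersive polyfun_Ffam.
    by apply/eqP; apply: contraT => py; case: H; exists p; split=> //; exists y.
  (* The point where the family is a submersion may have nonzero [psi]; conjugation by [A] and [A']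
     transports its differential to [psi = 0]. *)
  exists (msk (fun z => x0 (inr z))) => h.
  have hA := psiof_isH x0; have [e1 e2] := unip_mulK hA dKQ.
  set A := 1%:M + psiof x0 in e1 e2; set A' := 1%:M - psiof x0 in e1 e2.
  have [w hw] := sx (fmx (fun a => A *m mxf h a *m A')).
  have hB := psiof_isH w; set B := psiof w in hB.
  have AB : A' *m B = B by rewrite mulmxBl mul1mx (isH_mul0 hA hB dKQ) subr0.
  have BA : B *m A = B by rewrite mulmxDr mulmx1 (isH_mul0 hB hA dKQ) addr0.
  have key a : B *m msk (fun z => x0 (inr z)) a + msk (fun z => w (inr z)) a
      - msk (fun z => x0 (inr z)) a *m B = mxf h a.
    set R := msk (fun z => x0 (inr z)) a; set S := msk (fun z => w (inr z)) a.
    have E : B *m R *m A' + A *m S *m A' - A *m R *m B = A *m mxf h a *m A'.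
      apply/matrixP => y y'; exact: (dirder_uniq (dirder_Ffam x0 w (a, y, y')) (hw (a, y, y'))).
    move: E; clearbody A A' B R S => E; have := congr1 (fun X => A' *m X *m A) E.
    rewrite !(mulmxDl, mulmxDr, mulmxN, mulNmx) !mulmxA AB e1 !mul1mx.
    by rewrite -!mulmxA e1 !mulmx1 BA.
  exists B; split=> // [[[a y] y']] az; rewrite /del /=.
  have := congr1 (fun X : mat => X y y') (key a); rewrite [in RHS]mxE => <-.
  by rewrite mx_addsubE (_ : msk (fun z => w (inr z)) a y y' = 0) ?add0r // mxE az.
exists p; split=> // [|g pg psi sg]; first by exists y.
case/eqP: pg; pose w (s : Y) : C := match s with inl s => psi (val s).1 (val s).2
  | inr z => fmx (conjf psi (mxf g)) z end.
have [hpsi _] := sg.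
have pw : psiof w = psi.
  apply/matrixP => y1 y'; rewrite mxE; case: insubP => [s _ /= ->//|n].
  by rewrite hpsi.
rewrite -(pF w); apply: (polyfun_eq1 hp) => z.
rewrite /Ffam pw subat_fam //; by have := fmxK g z; rewrite /fmx => ->.
Qed.

End Family.

Lemma subat_eq f g K Q psi : f =1 g -> subat f K Q psi -> subat g K Q psi.
Proof. by move=> e [h z0]; split=> // z az; rewrite /conjf -e; apply: z0. Qed.

(** Choose a representation with a stable graph in position [L], then change its free entries so
    that its restriction to that graph is stable in position [M]. Both times density keeps it off
    the hypersurface of [generic_subat] for [M] in [T], so the composite graph proves dominance. *)
Lemma dominant_trans T L M : M \subset L -> L \subset T ->
  dominant L (T :\: L) -> dominant M (L :\: M) -> dominant M (T :\: M).
Proof.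
move=> ML LT dL dM.
have [p [hp px hsub]] := generic_subat (disjointD T M).
have [r0 [psi [hpsi pr0]]] := dominant_dense (disjointD T L) dL hp px.
pose p' (r : Z -> C) := p (fmx (fam L (T :\: L) r psi)).
have hp' : polyfun p'.
  apply: (polyfun_comp (F := fun z (r : Z -> C) => fam L (T :\: L) r psi z.1.1 z.1.2 z.2) hp) => z.
  exact: polymx_fam.
have [r1 [chi [hchi pr1]]] := dominant_dense (disjointD L M) dM hp' (ex_intro _ r0 pr0).
set r := fmx (fam M (L :\: M) r1 chi) in pr1.
have [_ rz] := fam_subat (disjointD L M) r1 hchi.
pose f := fam L (T :\: L) r psi.
have MT := subset_trans ML LT.
pose PM : mat := \matrix_(y, x) ((y == x) && (x \in M))%:R.
have mulPM (A : mat) y x : (A *m PM) y x = if x \in M then A y x else 0.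
  rewrite mxE (bigD1 x) //= mxE eqxx /= big1 ?addr0.
    by case: ifP; rewrite ?mulr1 ?mulr0.
  by move=> k /negbTE kx; rewrite mxE kx mulr0.
(* On the span of [M], [1 + om] is the composite of [1 + chi] and [1 + psi]. *)
pose om : mat := (chi + psi + psi *m chi) *m PM.
have hom : isH M (T :\: M) om.
  move=> y x n; rewrite mulPM; case: ifP => // xM.
  have e1 : chi y x = 0.
    apply/eqP; apply: contraNT n => /(isH_hpos hchi) /and3P[]; rewrite inE => /andP[yM yL] _ l.
    by rewrite /hpos inE yM (subsetP LT) // xM.
  have e2 : psi y x = 0.
    apply/eqP; apply: contraNT n => /(isH_hpos hpsi) /and3P[]; rewrite inE => /andP[yL yT] _ l.
    by rewrite /hpos inE yT xM l (contra (subsetP ML y) yL).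
  have e3 : (psi *m chi) y x = 0.
    rewrite mxE big1 // => k _; apply/eqP; apply: contraNT n; rewrite mulf_eq0 negb_or => /andP[].
    move=> /(isH_hpos hpsi) /and3P[]; rewrite inE => /andP[yL yT] _ l1.
    move=> /(isH_hpos hchi) /and3P[_ _ l2].
    by rewrite /hpos inE yT xM (lt_trans l1 l2) (contra (subsetP ML y) yL).
  by rewrite mxE [X in X + _]mxE e1 e2 e3 !addr0.
have : subat f M (T :\: M) om.
  split=> // [[[a y] x]] /and4P[/=]; rewrite inE => /andP[yM yT] xM /eqP vx /eqP vy.
  have xL := subsetP ML x xM.
  pose cx (A : mat) : 'cV[C]_N := col x A.
  pose Pi : mat := \matrix_(u, w) ((u == w) && ((u \in T) && (v u == tgt a)))%:R.
  have PiE k (A : 'M[C]_(N, k)) u w : (Pi *m A) u w = if (u \in T) && (v u == tgt a) then A u w else 0.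
    rewrite mxE (bigD1 u) //= mxE eqxx /= big1 ?addr0.
      by case: ifP; rewrite ?mul1r ?mul0r.
    by move=> j /negbTE ju; rewrite mxE eq_sym ju mul0r.
  have PiR (A : mat) u w : (A *m Pi) u w = if (w \in T) && (v w == tgt a) then A u w else 0.
    rewrite mxE (bigD1 w) //= mxE eqxx /= big1 ?addr0.
      by case: ifP; rewrite ?mulr1 ?mulr0.
    by move=> j /negbTE ju; rewrite mxE ju mulr0.
  have Picomm K' Q' (h : mat) : isH K' Q' h -> K' \subset T -> Q' \subset T -> Pi *m h = h *m Pi.
    move=> hh KT QT; apply/matrixP => u w; rewrite PiE PiR.
    have [->|n0] := eqVneq (h u w) 0; first by do 2 case: ifP.
    have /and3P[uQ wK /lt_v e] := isH_hpos hh n0.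
    by rewrite (subsetP QT) // (subsetP KT) // e.
  have TL : T :\: L \subset T := subsetDl _ _.
  have TM : T :\: M \subset T := subsetDl _ _.
  have LMT : L :\: M \subset T := subset_trans (subsetDl _ _) LT.
  have Cpsi := Picomm _ _ _ hpsi LT TL.
  have Cchi := Picomm _ _ _ hchi MT LMT.
  have Com := Picomm _ _ _ hom MT TM.
  have [ep1 ep2] := unip_mulK hpsi (disjointD T L).
  have [ec1 ec2] := unip_mulK hchi (disjointD L M).
  have [eo1 eo2] := unip_mulK hom (disjointD T M).
  pose R := msk L (T :\: L) r a.
  have omM (c : 'cV[C]_N) : (forall u, u \notin M -> c u 0 = 0) ->
      (1%:M + om) *m c = (1%:M + psi) *m ((1%:M + chi) *m c).
    move=> c0; rewrite mulmxA !mulmxDl !mulmxDr !mul1mx !mulmx1 !mulmxDl mul1mx -!addrA; congr (_ + _).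
    have PMc : PM *m c = c.
      apply/colP => u; rewrite mxE (bigD1 u) //= mxE eqxx /= big1 ?addr0.
        by case: (boolP (u \in M)) => [_|/c0 ->]; rewrite ?mul1r ?mulr0.
      by move=> j /negbTE ju; rewrite mxE eq_sym ju mul0r.
    by rewrite /om -mulmxA PMc !mulmxDl -!addrA.
  pose ex : 'cV[C]_N := delta_mx x 0.
  have exM u : u \notin M -> ex u 0 = 0.
    by move=> uM; rewrite mxE; case: eqP => // e; rewrite e xM in uM.
  (* The image of the basis vector [ex], projected to the target vertex inside [T] and written in
     the basis moved by [chi]; stability amounts to the vanishing of its coordinates outside [M]. *)
  pose c := (1%:M - chi) *m (Pi *m (R *m ((1%:M + chi) *m ex))).
  have colE (A : mat) u : (A *m ex) u 0 = A u x.
    by rewrite mxE (bigD1 x) //= mxE !eqxx mulr1 big1 ?addr0 // => j /negbTE jx; rewrite mxE jx mulr0.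
  have cM u : u \notin M -> c u 0 = 0.
    move=> uM; rewrite /c mulmxA.
    have -> : (1%:M - chi) *m Pi = Pi *m (1%:M - chi) by rewrite mulmxBl mulmxBr mul1mx mulmx1 Cchi.
    rewrite -mulmxA PiE; case: ifP => // /andP[uT /eqP vu].
    rewrite !mulmxA colE.
    case: (boolP (u \in L)) => uL; last first.
      have -> : ((1%:M - chi) *m R *m (1%:M + chi)) u x = (R *m (1%:M + chi)) u x.
        rewrite -mulmxA mulmxBl mul1mx mxE [X in _ + X]mxE [X in - X]mxE.
        rewrite big1 ?subr0 // => k _; rewrite hchi ?mul0r // /hpos !inE (negbTE uL) andbF //.
      rewrite mxE big1 // => k _; have [->|n0] := eqVneq ((1%:M + chi) k x) 0; first by rewrite mulr0.
      rewrite mxE; case: ifPn => [_|]; first by rewrite mul0r.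
      case/negP; rewrite /apos /= !inE uL uT vu eqxx andbT /=.
      move: n0; rewrite !mxE; have [->|kx] := eqVneq k x; first by rewrite xL vx eqxx.
      by rewrite add0r => /(isH_hpos hchi) /and3P[]; rewrite inE => /andP[_ ->] _ /lt_v ->; rewrite vx eqxx.
    have := rz (a, u, x); rewrite /apos /= !inE uM uL xM vx vu !eqxx => /(_ isT) <-.
    rewrite /conjf /=; rewrite [LHS]mxE [RHS]mxE; apply: eq_bigr => k _.
    have [->|n0] := eqVneq ((1%:M + chi) k x) 0; first by rewrite !mulr0.
    have kL : k \in L.
      move: n0; rewrite !mxE; have [->//|kx] := eqVneq k x.
      by rewrite add0r => /(isH_hpos hchi) /and3P[]; rewrite inE => /andP[_ ->].
    congr (_ * _); rewrite [LHS]mxE [RHS]mxE; apply: eq_bigr => w _.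
    have [->|n1] := eqVneq ((1%:M - chi) u w) 0; first by rewrite !mul0r.
    congr (_ * _); rewrite mxE ifF ?fmxK //; apply/negbTE/negP => /and4P[/=].
    rewrite inE => /andP[wL _] _ _ _; move: n1; rewrite !mxE.
    have [e|uw] := eqVneq u w; first by rewrite e (negbTE wL) in uL.
    rewrite add0r oppr_eq0 => /(isH_hpos hchi) /and3P[_ wM _].
    by rewrite (subsetP ML) in wL.
  have -> : conjf om f a y x = ((1%:M - om) *m (Pi *m (f a *m ((1%:M + om) *m ex)))) y 0.
    rewrite mulmxA; have -> : (1%:M - om) *m Pi = Pi *m (1%:M - om) by rewrite mulmxBl mulmxBr mul1mx mulmx1 Com.
    rewrite -[Pi *m _ *m _]mulmxA PiE yT vy eqxx /= /conjf; move: (f a) => fa.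
    by rewrite !mulmxA colE.
  rewrite omM //.
  have -> : f a *m ((1%:M + psi) *m ((1%:M + chi) *m ex)) = (1%:M + psi) *m (R *m ((1%:M + chi) *m ex)).
    by rewrite /f /fam -/R -!mulmxA [(1%:M - psi) *m (_ *m _)]mulmxA ep1 mul1mx.
  rewrite [Pi *m (_ *m _)]mulmxA.
  have -> : Pi *m (1%:M + psi) = (1%:M + psi) *m Pi by rewrite mulmxDl mulmxDr mul1mx mulmx1 Cpsi.
  rewrite -[(1%:M + psi) *m Pi *m _]mulmxA.
  have -> : Pi *m (R *m ((1%:M + chi) *m ex)) = (1%:M + chi) *m c by rewrite /c [RHS]mulmxA ec2 mul1mx.
  by rewrite -omM // mulmxA eo1 mul1mx cM.
move=> sf; apply: (hsub (fmx f)) (subat_eq _ sf) => //.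
by move=> a; rewrite mxfK.
Qed.

(** Some [f] is surjective for [T] and also stable on a graph in position [L]. After conjugation
    this graph is the span of [L], and [f'] has no entries from [L] to [T :\: L]; keeping only the
    columns of [phi] in [L] then still gives a surjection, between spaces of the two dimensions
    compared. *)
Lemma dominant_card T Q L : [disjoint T & Q] -> L \subset T ->
  dominant T Q -> dominant L (T :\: L) -> (#|{: As Q L}| <= #|{: Hs L Q}|)%N.
Proof.
move=> dTQ LT [f0 sf0] dL.
have [p [hp px hsurj]] := generic_surj sf0.
have [r [psi [hpsi pr]]] := dominant_dense (disjointD T L) dL hp px.
have := surj_conj dTQ LT hpsi (hsurj _ pr).
set f' := conjf _ _ => sf.
have f'z z : apos (T :\: L) L z -> f' z.1.1 z.1.2 z.2 = 0.
  move=> az; have [_ h0] := fam_subat (disjointD T L) r hpsi.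
  by rewrite -(h0 z az) /f' /conjf mxfK.
clearbody f'; apply: (@surj_card _ _ f') => h; have [phi [hphi e]] := sf h.
pose PL : mat := \matrix_(y, x) ((y == x) && (x \in L))%:R.
have mulPL (A : mat) y x : (A *m PL) y x = if x \in L then A y x else 0.
  rewrite mxE (bigD1 x) //= mxE eqxx /= big1 ?addr0.
    by case: ifP; rewrite ?mulr1 ?mulr0.
  by move=> k /negbTE kx; rewrite mxE kx mulr0.
exists (phi *m PL); split.
  move=> y x n; rewrite mulPL; case: ifP => // xL; apply: hphi; apply: contraNN n.
  by rewrite /hpos xL => /and3P[-> _ ->].
move=> [[a y] x] az; have /and4P[/= yQ xL vx vy] := az.
have az' : apos Q T (a, y, x) by rewrite /apos /= yQ vx vy (subsetP LT).
rewrite -(e _ az') /del /= !mulmxA.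
set X2 := f' a *m phi; rewrite mxE [in RHS]mxE; congr (_ + _); last first.
  by rewrite [LHS]mxE [RHS]mxE mulPL xL.
rewrite [LHS]mxE [RHS]mxE; apply: eq_bigr => k _; rewrite mulPL; case: ifPn => // kL.
have [->|n0] := eqVneq (phi y k) 0; first by rewrite !mul0r.
have /and3P[_ kT /lt_v yk] := isH_hpos hphi n0.
by rewrite (f'z (a, k, x)) ?mulr0 // /apos /= !inE kL kT xL vx -yk vy.
Qed.

Lemma bounded_max (X : Type) (x0 : X) (m : X -> nat) b :
  (forall x, (m x <= b)%N) -> exists x, forall y, (m y <= m x)%N.
Proof.
move=> mb; have [k] := ubnP (b - m x0)%N; elim: k x0 => // k IH x0; rewrite ltnS => kx.
case: (classic (forall y, (m y <= m x0)%N)) => [|H]; first by exists x0.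
have [y /negP] := not_all_ex_not _ _ H; rewrite -ltnNge => ly.
by apply: (IH y); have := mb y; lia.
Qed.

Definition mixf L f g : Ar -> mat := fun a =>
  \matrix_(y, x) if (y \in L) && (x \in L) then f a y x else g a y x.

(** The conjugation in the next proof depends on the representation, so it spoils the genericity of
    the block inside [L], but it leaves the block inside [Q] alone. Hence the form of the statement:
    a generic [g] can be completed by some block inside [L]. *)
Lemma generic_mix L Q : generic (fun g : Z -> C =>
  dominant L Q -> exists r, surj L Q (mixf L r (mxf g))).
Proof.
case: (classic (dominant L Q)) => [[f1 s1]|n]; last by apply: generic_imp (generic_true _ _).
pose M (g : Z -> C) := dmx L Q (mixf L f1 (mxf g)).
have hM : polymx M.
  move=> s z; pose F (z' : Z) (g : Z -> C) :=
    if (z'.1.2 \in L) && (z'.2 \in L) then fmx f1 z' else g z'.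
  have hF z' : polyfun (F z').
    by rewrite /F; case: ((z'.1.2 \in L) && (z'.2 \in L)); [apply: polyfun_const|apply: polyfun_var].
  refine (polyfun_ext _ (polyfun_comp (F := F) (@polymx_dmx L Q s z) hF)) => g.
  rewrite /M; congr (fun_of_matrix _ s z); apply: eq_dmx => a; apply/matrixP => y x.
  by rewrite !mxE /F.
refine (generic_imp _ (generic_rank (fmx f1) hM)) => g rk _; exists f1.
apply/surjP; rewrite /row_full eqn_leq rank_leq_col; apply: leq_trans rk.
have -> : M (fmx f1) = dmx L Q f1.
  by apply: eq_dmx => a; apply/matrixP => y x; rewrite !mxE; case: ifP.
by rewrite (eqP (proj1 (surjP _ _ _) s1)).
Qed.

(** For a generic [f] of maximal rank, either the differential is injective, and the count for
    [L = T] makes it onto, or the kernel of a nonzero [phi] in its kernel is stable, in a smaller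
    position [L]. By induction [L] is dominant against [Q], which reaches the entries from [L];
    maximality of the rank reaches those from [T :\: L]. *)
Lemma dominant_of_card T Q : [disjoint T & Q] ->
  (forall L, L \subset T -> dominant L (T :\: L) -> (#|{: As Q L}| <= #|{: Hs L Q}|)%N) ->
  dominant T Q.
Proof.
have [n] := ubnP #|T|; elim: n T => // n IH T; rewrite ltnS => Tn dTQ hcard.
have [fs maxfs] := bounded_max (fun=> 0) (m := fun f => \rank (dmx T Q f)) (fun f => rank_leq_row _).
have [g [[g1 g2] g3]] := generic_ex (generic_and (generic_and
   (generic_rank (fmx fs) (@polymx_dmx T Q))
   (generic_all (fun L => generic_subat (disjointD T L))))
   (generic_all (fun L => generic_mix L Q))).
rewrite (eq_dmx _ _ (mxfK fs)) in g1; set f := mxf g in g1 g2 g3.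
have mxf' f2 : (\rank (dmx T Q f2) <= \rank (dmx T Q f))%N := leq_trans (maxfs f2) g1.
case: (boolP (row_free (dmx T Q f))) => [free|nfree].
  exists f; apply/surjP; rewrite /row_full eqn_leq rank_leq_col (eqP free).
  apply: hcard => //; exists (fun=> 0) => h; exists 0; split; first by move=> y x _; rewrite mxE.
  by move=> [[a y] x] /and4P[]; rewrite setDv inE.
have [u uf u0] : exists2 u : 'rV_(#|{: Hs T Q}|), u *m dmx T Q f = 0 & u != 0.
  move: nfree; rewrite -kermx_eq0 => /rowV0Pn [u /sub_kermxP uf u0]; by exists u.
have hphi := toH_isH u; set phi := toH u in hphi.
have phi0 : phi != 0.
  by apply: contraNneq u0 => e; rewrite -(toHK u) -/phi e; apply/eqP/rowP => s; rewrite !mxE.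
have phik z : apos Q T z -> del f phi z = 0.
  move=> az; have := mul_dmx f u (enum_rank (exist _ z az : As Q T)).
  by rewrite uf mxE enum_rankK /= => <-.
have [L [psi [G [LT hpsi phiL phiG]]]] := echelon hphi.
set phi' := phi *m (1%:M + psi) in phiL phiG.
have hphi' : isH T Q phi' := isH_comp hphi hpsi LT.
have [e1 e2] := unip_mulK hpsi (disjointD T L).
have LnT : L != T.
  apply: contra_neq phi0 => e; have -> : phi = phi' *m (1%:M - psi) by rewrite /phi' -mulmxA e2 mulmx1.
  rewrite (_ : phi' = 0) ?mul0mx //; apply/matrixP => y x; rewrite [RHS]mxE.
  case: (boolP (x \in L)) => xL; first exact: phiL.
  by rewrite hphi' // /hpos -e (negbTE xL) andbF.
pose f' := conjf psi f.
have phik' z : apos Q T z -> del f' phi' z = 0.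
  case: z => [[a y] x] az; rewrite /f' /phi' (del_conj dTQ LT hpsi f hphi) /=; last by case/and4P: az.
  rewrite mxE big1 // => k _; have [->|n0] := eqVneq ((1%:M + psi) k x) 0; first by rewrite mulr0.
  by have := phik _ (apos_psi hpsi az n0); rewrite /del /= => ->; rewrite mul0r.
clearbody phi'.
(* [phi'] commutes with [f'] and kills [L], so it kills the component in [T :\: L] of the image of a
   basis vector of [L]. There [G] inverts [phi'], and the component is zero. *)
have subf : subat f L (T :\: L) psi.
  split=> // [[[a y0] x]] az; rewrite -/f' /=.
  have /and4P[/= y0T xL vx vy0] := az.
  have xT := subsetP LT x xL.
  pose c : 'cV[C]_N := \col_k if (k \in T :\: L) && (v k == tgt a) then f' a k x else 0.
  have phic : phi' *m c = 0.
    apply/colP => y; rewrite !mxE.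
    case: (boolP ((y \in Q) && (v y == tgt a))) => [/andP[yQ vy]|n0].
      have az1 : apos Q T (a, y, x) by rewrite /apos /= yQ xT vx vy.
      have := phik' _ az1; rewrite /del /= mxE [X in _ + X]mxE [X in - X]mxE [X in _ - X]big1 ?subr0.
        rewrite mxE => e; rewrite -[RHS]e; apply: eq_bigr => k _; rewrite mxE.
        have [->|n0] := eqVneq (phi' y k) 0; first by rewrite !mul0r.
        have /and3P[_ kT /lt_v vk] := isH_hpos hphi' n0.
        rewrite inE kT -vk vy !andbT; case: ifPn => // /negbNE kL.
        by rewrite phiL // eqxx in n0.
      by move=> k _; rewrite phiL // mulr0.
    rewrite big1 // => k _; rewrite mxE; case: ifP => [/andP[kT vk]|]; last by rewrite mulr0.
    have [->|n1] := eqVneq (phi' y k) 0; first by rewrite !mul0r.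
    have /and3P[yQ _ /lt_v vy] := isH_hpos hphi' n1.
    by rewrite yQ vy vk in n0.
  have : (G *m phi' *m c) y0 0 = 0 by rewrite -mulmxA phic mulmx0 mxE.
  rewrite mxE (bigD1 y0) //= big1 ?addr0.
    by rewrite phiG // eqxx mul1r mxE y0T vy0.
  move=> k /negbTE ky; rewrite [c k 0]mxE; case: ifP => [/andP[kT _]|]; last by rewrite mulr0.
  by rewrite phiG // eq_sym ky mul0r.
have dLT : dominant L (T :\: L) := g2 L psi subf.
have dLQ : [disjoint L & Q] := disjointWl LT dTQ.
have dLQ' : dominant L Q.
  apply: IH => //.
    by apply: leq_trans Tn; apply: proper_card; rewrite properEneq LnT.
  move=> M ML dM; apply: hcard; first exact: subset_trans ML LT.
  exact: (dominant_trans ML LT dLT dM).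
have [r sr] := g3 L dLQ'.
have sr' : surj L Q (mixf L r f').
  apply: surj_local sr => a y x yS xS _ _; rewrite [LHS]mxE [RHS]mxE.
    by rewrite yS xS.
  have colps (A : mat) : (A *m psi) y x = 0.
    rewrite mxE big1 // => k _; by rewrite hpsi ?mulr0 // /hpos (disjointFl dLQ xS) andbF.
  rewrite (disjointFl dLQ yS) /= /f' /conjf mulmxDr mulmx1 mulmxBl mul1mx [RHS]mxE colps addr0.
  by rewrite [RHS]mxE [X in _ + X]mxE (psi_row0 dTQ hpsi) // oppr0 addr0.
(* Some point of the line from [f'] to its modification keeps maximal rank for [T] and is surjective
   for [L]. Only the block inside [L] moves, so [phi'] stays in the kernel. *)
pose D a := mixf L r f' a - f' a.
pose fl s : Ar -> mat := fun a => f' a + s *: D a.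
have hline T1 Q1 : polymx (fun s : unit -> C => dmx T1 Q1 (fl (s tt))).
  move=> i j; apply: (@polyfun_ext _ _ (fun s : unit -> C => dmx T1 Q1 f' i j + s tt * dmx T1 Q1 D i j)).
    by move=> s; rewrite dmxD !mxE.
  apply: polyfun_add; [exact: polyfun_const|].
  by apply: polyfun_mul; [apply: polyfun_var|apply: polyfun_const].
have [s0 [rkT rkL]] := generic_ex (generic_and (generic_rank (fun=> 0) (hline T Q)) (generic_rank (fun=> 1) (hline L Q))).
set s := s0 tt in rkT rkL.
have fl0 : fl 0 =1 f' by move=> a; rewrite /fl scale0r addr0.
have fl1 : fl 1 =1 mixf L r f' by move=> a; rewrite /fl scale1r addrC subrK.
rewrite (eq_dmx _ _ fl0) in rkT; rewrite (eq_dmx _ _ fl1) in rkL.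
have maxs f2 : (\rank (dmx T Q f2) <= \rank (dmx T Q (fl s)))%N.
  apply: leq_trans rkT; apply: leq_trans (mxf' f2) _; exact: (rank_conj dTQ LT hpsi).
have sL : surj L Q (fl s).
  apply/surjP; rewrite /row_full eqn_leq rank_leq_col; apply: leq_trans rkL.
  by rewrite (eqP (proj1 (surjP _ _ _) sr')).
have kers : ofH T Q phi' *m dmx T Q (fl s) = 0.
  apply/rowP => z; rewrite mul_dmx ofHK // mxE.
  have az := valP (enum_val z); move: (val (enum_val z)) az => {z} [[a y] x] az.
  rewrite delD phik' // add0r (_ : del D _ _ = 0) ?mulr0 // /del /=.
  have /and4P[/= yQ xT _ _] := az.
  rewrite mxE [X in _ + X]mxE [X in X + _]mxE [X in _ - X]mxE !big1 ?subr0 // => k _.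
    by rewrite !mxE (disjointFl dLQ yQ) /= subrr mul0r.
  case: (boolP (k \in L)) => kL; first by rewrite phiL // mul0r.
  by rewrite !mxE (negbTE kL) /= subrr mulr0.
exists (fl s) => h.
have [phi1 [hphi1 ephi1]] := sL h.
have hphi1T : isH T Q phi1.
  move=> y x; move=> n0; apply: hphi1; apply: contraNN n0 => /and3P[yQ xL l].
  by rewrite /hpos yQ l (subsetP LT).
pose h2 z := h z - del (fl s) phi1 z.
pose ht a : mat := \matrix_(y, x) if apos Q (T :\: L) (a, y, x) then h2 (a, y, x) else 0.
(* Along this deformation the derivative of the commutator with [phi'] is [ht a *m G *m phi'], that
   is, [ht a] on the columns in [T :\: L]. *)
pose q a : mat := - (ht a *m G).
have /submxP [w hw] : (ofH T Q phi' *m dmx T Q q <= dmx T Q (fl s))%MS.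
  apply: max_rank_deformation kers => t; rewrite -dmxD; exact: maxs.
exists (phi1 + toH w); split.
  by move=> y x n0; rewrite mxE hphi1T // (toH_isH w) // addr0.
move=> [[a y] x] az; have /and4P[/= yQ xT vx vy] := az.
rewrite delDr.
have -> : del (fl s) (toH w) (a, y, x) = h2 (a, y, x); last by rewrite /h2 addrC subrK.
have := mul_dmx (fl s) w (enum_rank (exist _ (a, y, x) az : As Q T)).
rewrite enum_rankK /= => <-; rewrite -hw mul_dmx enum_rankK /= ofHK // /del /=.
have -> : (phi' *m q a - q a *m phi') y x = (ht a *m (G *m phi')) y x - (phi' *m (ht a *m G)) y x.
  by rewrite /q mulmxN mulNmx opprK mulmxA addrC mxE [X in _ + X]mxE.
have -> : (phi' *m (ht a *m G)) y x = 0.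
  rewrite mxE big1 // => k _.
  have [->|n1] := eqVneq (phi' y k) 0; first by rewrite !mul0r.
  have /and3P[_ kT _] := isH_hpos hphi' n1.
  rewrite [(ht a *m G) k x]mxE big1 ?mulr0 // => j _.
  by rewrite mxE /apos /= (disjointFr dTQ kT) mul0r.
rewrite subr0 mxE; case: (boolP (x \in L)) => xL.
  have azL : apos Q L (a, y, x) by rewrite /apos /= yQ xL vx vy.
  rewrite /h2 ephi1 // subrr big1 // => k _.
  by rewrite [(G *m phi') k x]mxE big1 ?mulr0 // => j _; rewrite phiL // mulr0.
have xTL : x \in T :\: L by rewrite inE xL xT.
rewrite (bigD1 x) //= phiG // eqxx mulr1 big1 ?addr0.
  by rewrite mxE /apos /= yQ xTL vx vy.
move=> k /negbTE kx; rewrite mxE; case: ifP => [/and4P[/= _ kT _ _]|]; last by rewrite mul0r.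
by rewrite phiG // kx mulr0.
Qed.

End Positions.


(** * Necessity *)

Section Adjoint.
Variable C : numClosedFieldType.

Lemma adjmxE m n (A : 'M[C]_(m, n)) i j : adjmx A i j = (A j i)^*.
Proof. by rewrite !mxE. Qed.
Lemma adjmxK m n (A : 'M[C]_(m, n)) : adjmx (adjmx A) = A.
Proof. by apply/matrixP => i j; rewrite !adjmxE conjCK. Qed.
Lemma adjmxM m n p (A : 'M[C]_(m, n)) (B : 'M[C]_(n, p)) : adjmx (A *m B) = adjmx B *m adjmx A.
Proof. by rewrite /adjmx map_mxM trmx_mul. Qed.
Lemma adjmxD m n (A B : 'M[C]_(m, n)) : adjmx (A + B) = adjmx A + adjmx B.
Proof. by apply/matrixP => i j; rewrite !(adjmxE, mxE) rmorphD. Qed.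
Lemma adjmxN m n (A : 'M[C]_(m, n)) : adjmx (- A) = - adjmx A.
Proof. by apply/matrixP => i j; rewrite !(adjmxE, mxE) rmorphN. Qed.
Lemma adjmxB m n (A B : 'M[C]_(m, n)) : adjmx (A - B) = adjmx A - adjmx B.
Proof. by rewrite adjmxD adjmxN. Qed.
Lemma adjmxZ m n c (A : 'M[C]_(m, n)) : adjmx (c *: A) = c^* *: adjmx A.
Proof. by apply/matrixP => i j; rewrite !(adjmxE, mxE) rmorphM. Qed.
Lemma adjmx1 n : adjmx (1%:M : 'M[C]_n) = 1%:M.
Proof. by apply/matrixP => i j; rewrite adjmxE !mxE eq_sym; case: eqP => _; rewrite ?rmorph1 ?rmorph0. Qed.
Lemma adjmx0 m n : adjmx (0 : 'M[C]_(m, n)) = 0.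
Proof. by apply/matrixP => i j; rewrite adjmxE !mxE rmorph0. Qed.
Lemma adjmx_sum m n (I : finType) (P : pred I) (F : I -> 'M[C]_(m, n)) :
  adjmx (\sum_(i | P i) F i) = \sum_(i | P i) adjmx (F i).
Proof. by apply: (big_morph (@adjmx C m n)) => [A B|]; rewrite ?adjmxD ?adjmx0. Qed.

Lemma mxtrace_mulE m n (A : 'M[C]_(m, n)) (B : 'M[C]_(n, m)) :
  \tr (A *m B) = \sum_i \sum_j A i j * B j i.
Proof. by apply: eq_bigr => i _; rewrite mxE. Qed.

Lemma mxtrace_adj_ge0 m n (A : 'M[C]_(m, n)) : 0 <= \tr (A *m adjmx A).
Proof.
rewrite mxtrace_mulE; apply: sumr_ge0 => i _; apply: sumr_ge0 => j _.
by rewrite adjmxE mul_conjC_ge0.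
Qed.

Lemma mxtrace_adj_eq0 m n (A : 'M[C]_(m, n)) : \tr (A *m adjmx A) = 0 -> A = 0.
Proof.
rewrite mxtrace_mulE => h; apply/matrixP => i j; rewrite [RHS]mxE.
have hi k : 0 <= \sum_l A k l * adjmx A l k.
  by apply: sumr_ge0 => l _; rewrite adjmxE mul_conjC_ge0.
have : \sum_l A i l * adjmx A l i = 0.
  by apply/eqP; move/eqP: h; rewrite psumr_eq0 // => /allP /(_ i); rewrite mem_index_enum; apply.
move/eqP; rewrite psumr_eq0 => [|l _]; last by rewrite adjmxE mul_conjC_ge0.
by move/allP/(_ j); rewrite mem_index_enum adjmxE mul_conjC_eq0 => /(_ isT) /eqP.
Qed.

Lemma norm_le1D (c T : C) : `|c| ^+ 2 <= T -> `|c| <= 1 + T.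
Proof.
move=> h; have n0 : 0 <= `|c| by []; have nr : `|c| \is Num.real by apply: normr_real.
apply: le_trans (_ : 1 + `|c| ^+ 2 <= _); last by rewrite lerD2l.
have [le1|lt1] := real_leP nr (real1 _).
  by rewrite (le_trans le1) // lerDl exprn_ge0.
by rewrite expr2 (le_trans (ler_peMl n0 (ltW lt1))) // lerDr.
Qed.

Lemma entry_le_tr n (X : 'M[C]_n) y x : `|X y x| ^+ 2 <= \tr (X *m adjmx X).
Proof.
rewrite mxtrace_mulE (bigD1 y) //= (bigD1 x) //= adjmxE -normCK -addrA lerDl.
by rewrite addr_ge0 // ?sumr_ge0 // => i _; rewrite ?sumr_ge0 // => *; rewrite adjmxE -normCK exprn_ge0.
Qed.

Lemma mxtrace_adj n (A : 'M[C]_n) : \tr (adjmx A) = (\tr A)^*.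
Proof. by rewrite /mxtrace rmorph_sum; apply: eq_bigr => i _; rewrite adjmxE. Qed.

Lemma proj_entry_le1 n (P : 'M[C]_n) : adjmx P = P -> P *m P = P ->
  forall y x, `|P y x| <= 1.
Proof.
move=> Pa P2 y x.
have e : P y y = \sum_k `|P y k| ^+ 2.
  have := congr1 (fun A : 'M_n => A y y) P2; rewrite /= mxE => <-; apply: eq_bigr => k _.
  by have := congr1 (fun A : 'M_n => A k y) Pa; rewrite /= adjmxE => <-; rewrite normCK.
have le k : `|P y k| ^+ 2 <= P y y.
  rewrite e (bigD1 k) //= lerDl; apply: sumr_ge0 => i _; exact: exprn_ge0.
have Py0 : 0 <= P y y by apply: le_trans (le y); apply: exprn_ge0.
have Py1 : P y y <= 1.
  have := le y; rewrite ger0_norm // expr2; have [->|n0] := eqVneq (P y y) 0; first by rewrite ler01.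
  by rewrite -[leRHS]mulr1 ler_pM2l // lt_def n0.
by rewrite -(@ler_pXn2r _ 2) ?nnegrE ?normr_ge0 ?ler01 // expr1n (le_trans (le x)).
Qed.

End Adjoint.

Section PolyfunMore.
Variable C : numFieldType.

Lemma poly_small_nonroot (P : {poly C}) (tau : C) : P != 0 -> 0 < tau ->
  exists t, [/\ 0 < t, t <= tau & P.[t] != 0].
Proof.
move=> P0 t0; apply: NNPP => H.
have := @max_poly_roots _ P [seq tau / k.+1%:R | k <- iota 0 (size P)] P0.
rewrite size_map size_iota ltnn => h; suff : false by []; apply: h.
  apply/allP => x /mapP [k _ ->]; rewrite rootE; apply: contraT => n; case: H.
  exists (tau / k.+1%:R); split=> //; first by rewrite divr_gt0 ?ltr0Sn.
  by rewrite ler_pdivrMr ?ltr0Sn // -[leLHS]mulr1 ler_pM2l // ler1n.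
rewrite map_inj_uniq ?iota_uniq // => i j /(mulfI (lt0r_neq0 t0)) /invr_inj /eqP.
by rewrite eqr_nat => /eqP [].
Qed.

(** On the segment from [x] to a witness the polynomial has finitely many roots, which small
    positive parameters can avoid. *)
Lemma generic_near (Z : finType) (O : (Z -> C) -> Prop) (x : Z -> C) (tau : C) : generic O -> 0 < tau ->
  exists y, O y /\ forall z, `|y z - x z| <= tau.
Proof.
move=> [p [hp [x1 px1] hO]] t0.
have [P hP] := polyfun_line x (fun z => x1 z - x z) hp.
have P0 : P != 0.
  apply: contra_neq px1 => P0; have := hP 1; rewrite P0 horner0 => <-.
  by apply: (polyfun_eq1 hp) => z; rewrite mul1r addrC subrK.
pose M := 1 + \sum_z `|x1 z - x z|.
have M0 : 0 < M by rewrite ltr_pwDl ?ltr01 // sumr_ge0.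
have [t [t1 t2 Pt]] := poly_small_nonroot P0 (divr_gt0 t0 M0).
exists (fun z => x z + t * (x1 z - x z)); split; first by apply: hO; rewrite hP.
move=> z; rewrite addrC addKr normrM (gtr0_norm t1).
apply: le_trans (_ : tau / M * M <= _); last by rewrite divfK ?lt0r_neq0.
apply: ler_pM => //; first exact: ltW.
by rewrite /M (bigD1 z) //= addrCA lerDl addr_ge0 // sumr_ge0.
Qed.

Lemma polyfun_continuous (Z : Type) (p : (Z -> C) -> C) (x : Z -> C) (e : C) : polyfun p -> 0 < e ->
  exists tau : C, 0 < tau /\ forall y, (forall z, `|y z - x z| <= tau) -> `|p y - p x| <= e.
Proof.
move=> hp; elim: hp e => [c|z|p1 q1 _ hp _ hq|p1 q1 _ hp _ hq|p1 q1 E _ hp] e e0.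
- by exists 1; split=> // y _; rewrite subrr normr0 ltW.
- by exists e; split=> // y; apply.
- have e2 : 0 < e / 2 by rewrite divr_gt0 ?ltr0n.
  have [t1 [t10 h1]] := hp _ e2; have [t2 [t20 h2]] := hq _ e2.
  (* A positive number below both [t1] and [t2]; the order of [C] is only partial, so this serves as
     their minimum. *)
  exists (t1 * t2 / (t1 + t2)); split; first by rewrite divr_gt0 ?mulr_gt0 ?addr_gt0.
  have l1 : t1 * t2 / (t1 + t2) <= t1.
    by rewrite ler_pdivrMr ?addr_gt0 // ler_pM2l // lerDr ltW.
  have l2 : t1 * t2 / (t1 + t2) <= t2.
    by rewrite ler_pdivrMr ?addr_gt0 // mulrC ler_pM2l // lerDl ltW.
  move=> y hy; rewrite opprD addrACA [e]splitr; apply: le_trans (ler_normD _ _) _.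
  by apply: lerD; [apply: h1|apply: h2] => z; apply: le_trans (hy z) _.
- pose M := 1 + `|p1 x| + `|q1 x|.
  have M0 : 0 < M by rewrite /M -addrA ltr_pwDl ?ltr01 // addr_ge0.
  have M1 : 1 <= M by rewrite /M -addrA lerDl addr_ge0.
  (* Chosen so that [e' <= 1] and [e' * 3 * M <= e], one third for each term of the expanded
     difference of products. *)
  pose e' := e / (e + 3 * M).
  have d0 : 0 < e + 3 * M by rewrite addr_gt0 // mulr_gt0 // ltr0n.
  have e'0 : 0 < e' by rewrite divr_gt0.
  have e'1 : e' <= 1 by rewrite ler_pdivrMr // mul1r lerDl mulr_ge0 ?ler0n // ltW.
  have [t1 [t10 h1]] := hp _ e'0; have [t2 [t20 h2]] := hq _ e'0.
  exists (t1 * t2 / (t1 + t2)); split; first by rewrite divr_gt0 ?mulr_gt0 ?addr_gt0.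
  have l1 : t1 * t2 / (t1 + t2) <= t1.
    by rewrite ler_pdivrMr ?addr_gt0 // ler_pM2l // lerDr ltW.
  have l2 : t1 * t2 / (t1 + t2) <= t2.
    by rewrite ler_pdivrMr ?addr_gt0 // mulrC ler_pM2l // lerDl ltW.
  move=> y hy.
  have a1 : `|p1 y - p1 x| <= e' by apply: h1 => z; apply: le_trans (hy z) _.
  have a2 : `|q1 y - q1 x| <= e' by apply: h2 => z; apply: le_trans (hy z) _.
  have -> : p1 y * q1 y - p1 x * q1 x = (p1 y - p1 x) * (q1 y - q1 x)
     + p1 x * (q1 y - q1 x) + (p1 y - p1 x) * q1 x by ring.
  have -> : e = e' * 3 * M + e' * e by rewrite -mulrA -mulrDr addrC divfK ?lt0r_neq0.
  apply: le_trans (_ : e' * 3 * M <= _); last by rewrite lerDl mulr_ge0 // ltW.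
  have -> : e' * 3 * M = e' * M + M * e' + e' * M by ring.
  apply: le_trans (ler_normD _ _) _; apply: lerD; first (apply: le_trans (ler_normD _ _) _; apply: lerD);
    rewrite !normrM.
  + by apply: ler_pM => //; apply: le_trans a2 (le_trans e'1 M1).
  + by apply: ler_pM => //; rewrite /M -addrA addrCA lerDl addr_ge0.
  + by apply: ler_pM => //; rewrite /M lerDr addr_ge0.
- by have [t [t0 h]] := hp _ e0; exists t; split=> // y /h; rewrite !E.
Qed.

Lemma polyfun_continuous_all (Z : Type) (I : finType) (p : I -> (Z -> C) -> C) (x : Z -> C) (e : C) :
  (forall i, polyfun (p i)) -> 0 < e ->
  exists tau : C, 0 < tau /\ forall y, (forall z, `|y z - x z| <= tau) -> forall i, `|p i y - p i x| <= e.
Proof.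
move=> hp e0; suff [tau [t0 h]] : exists tau : C, 0 < tau /\ forall y, (forall z, `|y z - x z| <= tau) ->
    forall i, i \in enum I -> `|p i y - p i x| <= e.
  by exists tau; split=> // y hy i; apply: h => //; rewrite mem_enum.
elim: (enum I) => [|i r [t2 [t20 h2]]]; first by exists 1; split.
have [t1 [t10 h1]] := polyfun_continuous x (hp i) e0.
exists (t1 * t2 / (t1 + t2)); split; first by rewrite divr_gt0 ?mulr_gt0 ?addr_gt0.
have l1 : t1 * t2 / (t1 + t2) <= t1.
  by rewrite ler_pdivrMr ?addr_gt0 // ler_pM2l // lerDr ltW.
have l2 : t1 * t2 / (t1 + t2) <= t2.
  by rewrite ler_pdivrMr ?addr_gt0 // mulrC ler_pM2l // lerDl ltW.
move=> y hy j; rewrite inE => /orP[/eqP ->|jr].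
  by apply: h1 => z; apply: le_trans (hy z) _.
by apply: h2 => // z; apply: le_trans (hy z) _.
Qed.

Lemma polyfun_term (Z : Type) (idx : Z -> nat) (p : (Z -> C) -> C) : polyfun p ->
  exists t : GRing.term C, GRing.rterm t /\ forall e, GRing.eval e t = p (fun z => e`_(idx z)).
Proof.
elim=> [c|z|p1 q1 _ [t [rt ht]] _ [u [ru hu]]|p1 q1 _ [t [rt ht]] _ [u [ru hu]]|p1 q1 E _ [t [rt ht]]].
- by exists (GRing.Const c).
- by exists (GRing.Var _ (idx z)).
- by exists (GRing.Add t u); rewrite /= rt ru; split=> // e; rewrite ht hu.
- by exists (GRing.Mul t u); rewrite /= rt ru; split=> // e; rewrite ht hu.
- by exists t; split=> // e; rewrite ht.
Qed.

End PolyfunMore.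

(** * Projections of algebraic sets over an algebraically closed field *)

Section ClosedGeneric.
Variable C : numClosedFieldType.
Variable (Z : finType).

Definition zenv (x : Z -> C) : seq C := [seq x (enum_val i) | i <- enum 'I_#|Z|].

Lemma nth_zenv x (i : 'I_#|Z|) : (zenv x)`_i = x (enum_val i).
Proof. by rewrite (nth_map i) ?size_enum_ord // nth_ord_enum. Qed.

Lemma nth_zenv_default x i : (#|Z| <= i)%N -> (zenv x)`_i = 0.
Proof. by move=> h; rewrite nth_default // size_map size_enum_ord. Qed.

Lemma polyfun_eval (t : GRing.term C) : GRing.rterm t -> polyfun (fun x => GRing.eval (zenv x) t).
Proof.
elim: t => //=.
- move=> i _; case: (ltnP i #|Z|) => h.
    apply: (polyfun_ext _ (polyfun_var C (enum_val (Ordinal h)))) => x.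
    by rewrite (nth_zenv x (Ordinal h)).
  by apply: (polyfun_ext _ (polyfun_const Z (0 : C))) => x; rewrite nth_zenv_default.
- by move=> c _; apply: polyfun_const.
- by move=> c _; apply: polyfun_const.
- by move=> t IHt u IHu /andP[rt ru]; apply: polyfun_add; [apply: IHt|apply: IHu].
- by move=> t IHt rt; apply: polyfun_opp; apply: IHt.
- move=> t IHt n rt; apply: (@polyfun_ext _ _ (fun x => GRing.eval (zenv x) t * n%:R)).
    by move=> x; rewrite mulr_natr.
  by apply: polyfun_mul; [apply: IHt|apply: polyfun_const].
- by move=> t IHt u IHu /andP[rt ru]; apply: polyfun_mul; [apply: IHt|apply: IHu].
- move=> t IHt n rt; elim: n => [|n IHn].
    by apply: (polyfun_ext _ (polyfun_const Z (1 : C))) => x; rewrite expr0.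
  apply: (@polyfun_ext _ _ (fun x => GRing.eval (zenv x) t * GRing.eval (zenv x) t ^+ n)).
    by move=> x; rewrite exprS.
  by apply: polyfun_mul; [apply: IHt|].
Qed.

(** A polynomial equation holds identically or fails generically, and Boolean operations preserve
    having a generically constant truth value. *)
Lemma qf_generic (f : GRing.formula C) : GRing.qf_form f && GRing.rformula f ->
  exists b, generic (fun x : Z -> C => GRing.qf_eval (zenv x) f = b).
Proof.
elim: f => //=.
- by move=> b _; exists b; apply: generic_imp (generic_true _ _).
- move=> t u /andP[rt ru].
  have hp := polyfun_sub (polyfun_eval rt) (polyfun_eval ru).
  case: (classic (exists x : Z -> C, GRing.eval (zenv x) t - GRing.eval (zenv x) u != 0)) => [ex|nex].
    exists false, (fun x => GRing.eval (zenv x) t - GRing.eval (zenv x) u); split=> // x.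
    by rewrite subr_eq0 => /negbTE.
  exists true; refine (generic_imp _ (generic_true _ _)) => x _.
  by rewrite -subr_eq0; apply: contraT => n; case: nex; exists x.
- move=> f IHf g IHg; rewrite andbACA => /andP[/IHf [b1 h1] /IHg [b2 h2]].
  by exists (b1 && b2); refine (generic_imp _ (generic_and h1 h2)) => x [-> ->].
- move=> f IHf g IHg; rewrite andbACA => /andP[/IHf [b1 h1] /IHg [b2 h2]].
  by exists (b1 || b2); refine (generic_imp _ (generic_and h1 h2)) => x [-> ->].
- move=> f IHf g IHg; rewrite andbACA => /andP[/IHf [b1 h1] /IHg [b2 h2]].
  by exists (b1 ==> b2); refine (generic_imp _ (generic_and h1 h2)) => x [-> ->].
- by move=> f IHf /IHf [b h]; exists (~~ b); refine (generic_imp _ h) => x ->.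
Qed.

(* A weak form of Chevalley's theorem, by elimination of quantifiers. *)
Lemma projection_generic (S I : finType) (P : I -> (Z + S -> C) -> C) :
  (forall i, polyfun (P i)) ->
  let proj x := exists u : S -> C, forall i, P i (fun y => match y with inl z => x z | inr s => u s end) = 0 in
  generic proj \/ generic (fun x => ~ proj x).
Proof.
move=> hP proj.
pose idx (y : Z + S) : nat := match y with inl z => enum_rank z | inr s => (#|Z| + enum_rank s)%N end.
have [t ht] : exists t : I -> GRing.term C, forall i, GRing.rterm (t i) /\
    forall e, GRing.eval e (t i) = P i (fun z => e`_(idx z)).
  exact: (@fin_all_exists _ (fun=> GRing.term C) (fun i t => GRing.rterm t /\
    forall e, GRing.eval e t = P i (fun z => e`_(idx z))) (fun i => polyfun_term idx (hP i))).
pose body := foldr (fun i f => GRing.And (GRing.Equal (t i) (GRing.Const 0)) f) (GRing.Bool true) (enum I).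
pose vars := [seq idx (inr s) | s <- enum S].
pose F := foldr GRing.Exists body vars.
have rF : GRing.rformula F.
  have rb : GRing.rformula body.
    by rewrite /body; elim: (enum I) => //= i r ->; rewrite (proj1 (ht i)).
  by rewrite /F; elim: (vars).
have hbody e : GRing.holds e body <-> forall i, P i (fun z => e`_(idx z)) = 0.
  have : GRing.holds e body <-> forall i, i \in enum I -> P i (fun z => e`_(idx z)) = 0.
    rewrite /body; elim: (enum I) => //= i r IH; rewrite (proj2 (ht i)); split.
      by move=> [h /IH h'] j; rewrite inE => /orP[/eqP ->|/h'].
    by move=> h; split; [apply: h; rewrite inE eqxx|apply/IH => j jr; apply: h; rewrite inE jr orbT].
  by move=> ->; split=> h i; [apply: h; rewrite mem_enum|].
have hF x : GRing.holds (zenv x) F <-> proj x.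
  split.
    move=> /(GRing.foldExistsP _ _ _) [e' he /hbody h].
    exists (fun s => e'`_(idx (inr s))) => i; rewrite -[RHS](h i); apply: (polyfun_eq1 (hP i)).
    case=> [z|s] //; rewrite -he /idx ?nth_zenv ?enum_rankK //.
    rewrite !inE; apply/mapP => [[s _]] /= e; have := ltn_ord (enum_rank z).
    by rewrite e ltnNge leq_addr.
  move=> [u hu]; apply/(GRing.foldExistsP _ _ _).
  pose e' := zenv x ++ [seq u (enum_val i) | i <- enum 'I_#|S|].
  have sz : size (zenv x) = #|Z| by rewrite size_map size_enum_ord.
  have eZ (z : Z) : e'`_(idx (inl z)) = x z.
    by rewrite nth_cat sz ltn_ord nth_zenv enum_rankK.
  have eS (s : S) : e'`_(idx (inr s)) = u s.
    rewrite nth_cat sz /= ltnNge leq_addr /= addKn (nth_map (enum_rank s)) ?size_enum_ord //.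
    by rewrite nth_ord_enum enum_rankK.
  exists e'.
    move=> j; rewrite !inE => jv; case: (ltnP j #|Z|) => hj; first by rewrite nth_cat sz hj.
    rewrite nth_zenv_default // nth_cat sz ltnNge hj /= nth_default //.
    rewrite size_map size_enum_ord leqNgt; apply: contra jv => hj2; apply/mapP.
    exists (enum_val (Ordinal hj2)); rewrite ?mem_enum //= enum_valK /= subnKC //.
  by apply/hbody => i; rewrite -[RHS](hu i); apply: (polyfun_eq1 (hP i)); case=> [z|s].
have ok := ClosedFieldQE.holds_ex_elim (@solve_monicpoly C).
have wf := @ClosedFieldQE.wf_ex_elim C.
have [b hb] := qf_generic (GRing.quantifier_elim_wf wf rF).
have red x := GRing.quantifier_elim_rformP wf ok (zenv x) rF.
case: b hb => hb; [left|right]; refine (generic_imp _ hb) => x hx.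
  by apply/hF; apply/red.
by move=> /hF /red; rewrite hx.
Qed.

End ClosedGeneric.

Section Necessity.
Variables (C : numClosedFieldType) (Q0 Ar : finType) (src tgt : Ar -> Q0).
Variables (N : nat) (v : 'I_N -> Q0) (lt : rel 'I_N).
Hypothesis lt_v : forall y x, lt y x -> v y = v x.
Notation mat := 'M[C]_N.
Notation Z := (Ar * 'I_N * 'I_N)%type.
Notation subat := (subat src tgt v lt).
Notation dominant := (dominant C src tgt v lt).

(** Being stable on some graph is a projection of an algebraic condition, so either it or its
    negation is generic; the negation is excluded by [dominant_dense]. *)
Lemma dominant_generic_subat (K Q : {set 'I_N}) : [disjoint K & Q] -> dominant K Q ->
  generic (fun g : Z -> C => exists psi, subat (mxf g) K Q psi).
Proof.
move=> dKQ dom.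
pose psiu (u : Hs lt K Q -> C) : mat := psiof (fun y : Hs lt K Q + Z => if y is inl s then u s else 0).
have psiu_eq (w : Z + Hs lt K Q -> C) :
  psiu (fun s => w (inr s)) = psiof (fun y : Hs lt K Q + Z => match y with inl s => w (inr s) | inr z => w (inl z) end).
  by apply/matrixP => i j; rewrite !mxE; case: insub.
pose P (z : As src tgt v Q K) (w : Z + Hs lt K Q -> C) : C :=
  conjf (psiu (fun s => w (inr s))) (mxf (fun z => w (inl z))) (val z).1.1 (val z).1.2 (val z).2.
have hP z : polyfun (P z).
  have h1 : polymx (fun w : Z + Hs lt K Q -> C => psiu (fun s => w (inr s))).
    move=> i j; rewrite /psiu; case E: (insub (i, j) : option (Hs lt K Q)) => [s|].
      by apply: (polyfun_ext _ (polyfun_var C (inr s : Z + Hs lt K Q))) => x; rewrite mxE E.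
    by apply: (polyfun_ext _ (polyfun_const _ (0 : C))) => x; rewrite mxE E.
  have h2 : polymx (fun w : Z + Hs lt K Q -> C => mxf (fun z => w (inl z)) (val z).1.1).
    move=> i j; apply: (polyfun_ext _ (polyfun_var C (inl ((val z).1.1, i, j) : Z + Hs lt K Q))) => x.
    by rewrite mxE.
  suff h : polymx (fun w : Z + Hs lt K Q -> C => (1%:M - psiu (fun s => w (inr s))) *m
     mxf (fun z => w (inl z)) (val z).1.1 *m (1%:M + psiu (fun s => w (inr s)))) by apply: h.
  apply: polymx_mul; [apply: polymx_mul => //|]; apply: polymx_add => //; try exact: polymx_const.
  exact: polymx_opp.
have eqs g : (exists u : Hs lt K Q -> C, forall z, P z (fun y => match y with inl z => g z | inr s => u s end) = 0) <->
    exists psi, subat (mxf g) K Q psi.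
  split=> [[u hu]|[psi [hpsi hz]]].
    exists (psiu u); split; first exact: psiof_isH.
    by move=> z az; exact: (hu (exist _ z az)).
  exists (fun s => psi (val s).1 (val s).2) => z.
  rewrite /P (_ : psiu _ = psi); first by apply: hz; apply: valP.
  by apply/matrixP => i j; rewrite mxE; case: insubP => [s _ /= ->//|n]; rewrite hpsi.
case: (projection_generic hP) => [h|h]; first by refine (generic_imp _ h) => g /eqs.
have [p [hp px hO]] := h.
have [r [psi [hpsi pr]]] := dominant_dense lt_v dKQ dom hp px.
case: (hO _ pr); apply/eqs; exists psi.
have fs := @fam_subat C Q0 Ar src tgt N v lt K Q dKQ r psi hpsi.
by apply: (subat_eq _ fs) => a; rewrite mxfK.
Qed.

(** Dominance is tested on unconstrained matrices; for the moment map the entries that do not belong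
    to the arrow must be removed. *)
Definition mskA (f : Ar -> mat) (a : Ar) : mat :=
  \matrix_(y, x) if (v x == src a) && (v y == tgt a) then f a y x else 0.

Definition mubig (F : Ar -> mat) : mat := \sum_a (F a *m adjmx (F a) - adjmx (F a) *m F a).

(** Each arrow contributes the squared norm of [P *m F a *m (1 - P)], its component from the
    orthogonal complement into the subrepresentation. *)
Lemma mxtrace_subrep_ge0 (F : Ar -> mat) (P : mat) : adjmx P = P -> P *m P = P ->
  (forall a, F a *m P = P *m F a *m P) -> 0 <= \tr (P *m mubig F).
Proof.
move=> Pa P2 FP; rewrite /mubig mulmx_sumr raddf_sum; apply: sumr_ge0 => a _ /=.
have FP' : P *m adjmx (F a) = P *m adjmx (F a) *m P.
  by have := congr1 (@adjmx C N N) (FP a); rewrite !adjmxM Pa mulmxA.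
suff -> : \tr (P *m (F a *m adjmx (F a) - adjmx (F a) *m F a)) =
    \tr ((P *m F a *m (1%:M - P)) *m adjmx (P *m F a *m (1%:M - P))) by apply: mxtrace_adj_ge0.
have P1 : (1%:M - P) *m (1%:M - P) = 1%:M - P.
  by rewrite mulmxBl mul1mx mulmxBr mulmx1 P2 subrr subr0.
rewrite !adjmxM adjmxB adjmx1 Pa !mulmxA -[_ *m (1%:M - P) *m (1%:M - P)]mulmxA P1.
rewrite [RHS]mxtrace_mulC !mulmxA P2 [P *m F a *m (1%:M - P)]mulmxBr mulmx1 -(FP a).
rewrite mulmxBl [P *m (_ - _)]mulmxBr !raddfB /= !mulmxA; congr (_ - _).
by rewrite -[F a *m P *m _]mulmxA [RHS]mxtrace_mulC.
Qed.

Variable a : 'I_N -> C.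
Hypothesis a_real : forall x, a x \is Num.real.
Hypothesis a_mono : forall y x, lt y x -> a y <= a x.

(** Gram-Schmidt applied to the vectors spanning the graph, in increasing order of [a]. Each
    orthonormal vector involves only spanning vectors up to its own index [i], hence only
    coordinates where [a] is at most [a (sn i)]; this bounds its Rayleigh quotient. *)
Lemma subat_trace (f : Ar -> mat) (K : {set 'I_N}) psi : subat f K (~: K) psi ->
  exists P : mat, [/\ adjmx P = P, P *m P = P, 0 <= \tr (P *m mubig (mskA f)) &
    \tr (P *m diag_mx (\row_y a y)) <= \sum_(x in K) a x].
Proof.
move=> [hpsi hz].
have dK : [disjoint K & ~: K] by rewrite -setI_eq0 setICr.
have [e1 e2] := unip_mulK hpsi dK.
pose leA x y := a x <= a y.
have totA : total leA by move=> x y; apply: real_leVge.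
pose s := sort leA (enum K).
have szs : size s = #|K| by rewrite size_sort -cardE.
have ssorted : sorted leA s by apply: sort_sorted.
have smem x : (x \in s) = (x \in K) by rewrite mem_sort mem_enum.
have suniq : uniq s by rewrite sort_uniq enum_uniq.
case: (posnP #|K|) => [K0|Kpos].
  exists 0; rewrite adjmx0 !mul0mx raddf0; split=> //.
  by rewrite big1 // => x xK; move: K0; rewrite (cardD1 x) xK.
have [x0 x0K] : exists x, x \in K by apply/card_gt0P.
pose k := #|K|; pose sn (i : 'I_k) := nth x0 s i.
have snK i : sn i \in K by rewrite -smem mem_nth // szs.
have snmono (i j : 'I_k) : (i <= j)%N -> a (sn i) <= a (sn j).
  have tr : transitive leA by move=> ? ? ?; apply: le_trans.
  move=> ij; apply: (sorted_leq_nth tr (fun x => lexx (a x)) x0 ssorted) => //; rewrite inE szs //.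
(* The rows are conjugated so that, after orthonormalisation to [W], the projection onto the graph
   is [adjmx W *m W]. *)
pose A' : 'M[C]_(k, N) := \matrix_(i, y) ((1%:M + psi) y (sn i))^*.
pose Sel : 'M[C]_(k, N) := \matrix_(i, y) (y == sn i)%:R.
have A'E : A' = Sel *m adjmx (1%:M + psi).
  apply/matrixP => i y; rewrite [LHS]mxE [RHS]mxE (bigD1 (sn i)) //= [Sel _ _]mxE eqxx mul1r adjmxE big1 ?addr0 //.
  by move=> j /negbTE ji; rewrite [Sel _ _]mxE ji mul0r.
have SelSel : Sel *m Sel^T = 1%:M.
  apply/matrixP => i j; rewrite !mxE (bigD1 (sn i)) //= !mxE eqxx mul1r big1 ?addr0.
    by rewrite /sn nth_uniq ?szs.
  by move=> y /negbTE yi; rewrite !mxE yi mul0r.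
have A'inv : A' *m (adjmx (1%:M - psi) *m Sel^T) = 1%:M.
  by rewrite A'E mulmxA -[Sel *m _ *m _]mulmxA -adjmxM e1 adjmx1 mulmx1.
have A'free : row_free A' by apply/row_freeP; exists (adjmx (1%:M - psi) *m Sel^T).
have kN : (k <= N)%N by rewrite -[N in (_ <= N)%N]card_ord; apply: max_card.
pose W := schmidt A'.
have WU : W *m adjmx W = 1%:M.
  by have /unitarymxP := schmidt_unitarymx A' kN; rewrite /adjmx map_trmx.
have WA : (W :=: A')%MS := eqmx_schmidt_free A'free.
have Wsub i : (row i A' <= \sum_(l < k | (l <= i)%N) <<row l W>>)%MS := row_schmidt_sub A' i.
clearbody W.
pose Tm := A' *m adjmx W.
have A'T : A' = Tm *m W.
  have : (A' <= W)%MS by rewrite WA.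
  move=> /submxP [D eD]; suff -> : Tm = D by [].
  by rewrite /Tm eD -mulmxA WU mulmx1.
have Ttrig (i j : 'I_k) : (i < j)%N -> Tm i j = 0.
  move=> ij; have /sub_sumsmxP [u hu] := Wsub i.
  have -> : Tm i j = (row i A' *m adjmx W) 0 j by rewrite -row_mul !mxE.
  rewrite hu mulmx_suml summxE big1 // => l li.
  have /sub_rVP [c ->] : (u l *m <<row l W>> <= row l W)%MS.
    by rewrite (submx_trans (submxMl _ _)) // genmxE.
  rewrite -scalemxAl mxE -row_mul WU !mxE (_ : l == j = false) ?mulr0 //.
  by apply/negbTE/eqP => e; move: li; rewrite e leqNgt ij.
have Tunit i : Tm i i != 0.
  have : \det Tm != 0.
    rewrite -unitfE -unitmxE -row_free_unit /row_free eqn_leq rank_leq_row /=.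
    by rewrite -[X in (X <= _)%N](eqP A'free) A'T mxrankM_maxl.
  rewrite det_trig; last by apply/is_trig_mxP.
  by move/prodf_neq0/(_ i isT).
have Wsupp i y : W i y != 0 -> a y <= a (sn i).
  have [m] := ubnP (nat_of_ord i); elim: m i => // m IH i; rewrite ltnS => im.
  apply: contraNT => nle.
  have A'0 : A' i y = 0.
    rewrite mxE [X in X^*]mxE; have [e|ne] := eqVneq y (sn i).
      by rewrite e lexx in nle.
    rewrite mxE (negbTE ne) add0r; apply/eqP; rewrite conjC_eq0; apply: contraNT nle.
    by move=> /(isH_hpos hpsi) /and3P[_ _ /a_mono].
  have := congr1 (fun M : 'M_(k, N) => M i y) A'T; rewrite A'0 mxE (bigD1 i) //= big1 ?addr0.
    by move/esym/eqP; rewrite mulf_eq0 (negbTE (Tunit i)).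
  move=> j ji; have [ij|ij] := ltnP i j; first by rewrite Ttrig // mul0r.
  have ji' : (j < i)%N by rewrite ltn_neqAle ij andbT.
  have [->|Wj] := eqVneq (W j y) 0; first by rewrite mulr0.
  have := IH j (leq_trans ji' im) Wj; move/le_trans/(_ (snmono _ _ ij)) => h.
  by rewrite h in nle.
pose P := adjmx W *m W.
have Pa : adjmx P = P by rewrite /P adjmxM adjmxK.
have P2 : P *m P = P by rewrite /P mulmxA -[adjmx W *m W *m _]mulmxA WU mulmx1.
exists P; split=> //.
- apply: mxtrace_subrep_ge0 => // b.
  (* Stability of the graph, read on adjoints acting on row vectors. *)
  have stab : (A' *m adjmx (mskA f b) <= A')%MS.
    apply/row_subP => i; rewrite row_mul.
    pose R : 'rV[C]_k := \row_j (if (v (sn i) == src b) && (v (sn j) == tgt b) then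
       (conjf psi f b (sn j) (sn i))^* else 0).
    apply/submxP; exists R; apply/rowP => y.
    pose c : 'cV[C]_N := \col_w (if (w \in K) && ((v (sn i) == src b) && (v w == tgt b)) then conjf psi f b w (sn i) else 0).
    have Fc : mskA f b *m col (sn i) (1%:M + psi) = (1%:M + psi) *m c.
      have -> : c = (1%:M - psi) *m (mskA f b *m col (sn i) (1%:M + psi)).
        have psi_col w : (1%:M + psi) w (sn i) != 0 -> v w = v (sn i).
          rewrite !mxE; have [->//|wn] := eqVneq w (sn i).
          by rewrite add0r => /(isH_v lt_v hpsi).
        apply/colP => w; rewrite mxE.
        have -> : ((1%:M - psi) *m (mskA f b *m col (sn i) (1%:M + psi))) w 0 =
           if (v (sn i) == src b) && (v w == tgt b) then conjf psi f b w (sn i) else 0.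
          rewrite /conjf -mulmxA mxE; case: ifPn => [/andP[/eqP vi /eqP vw]|n].
            rewrite [RHS]mxE; apply: eq_bigr => y1 _.
            have [->|n1] := eqVneq ((1%:M - psi) w y1) 0; first by rewrite !mul0r.
            have vy1 : v y1 = tgt b.
              rewrite -vw; move: n1; rewrite !mxE; have [->//|ne] := eqVneq w y1.
              by rewrite add0r oppr_eq0 => /(isH_v lt_v hpsi).
            congr (_ * _); rewrite [LHS]mxE [RHS]mxE; apply: eq_bigr => y2 _.
            rewrite [col _ _ _ _]mxE; have [->|n2] := eqVneq ((1%:M + psi) y2 (sn i)) 0; first by rewrite !mulr0.
            by rewrite mxE (psi_col _ n2) vi vy1 !eqxx.
          rewrite big1 // => y1 _; have [->|n1] := eqVneq ((1%:M - psi) w y1) 0; first by rewrite !mul0r.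
          rewrite [X in _ * X]mxE big1 ?mulr0 // => y2 _.
          rewrite [col _ _ _ _]mxE; have [->|n2] := eqVneq ((1%:M + psi) y2 (sn i)) 0; first by rewrite !mulr0.
          rewrite mxE (psi_col _ n2) (_ : v y1 = v w) ?(negbTE n) ?mul0r //.
          move: n1; rewrite !mxE; have [->//|ne] := eqVneq w y1.
          by rewrite add0r oppr_eq0 => /(isH_v lt_v hpsi).
        case: (boolP (w \in K)) => //= wK; case: ifP => // /andP[vi vw].
        by rewrite (hz (b, w, sn i)) // /apos /= inE wK snK vi vw.
      by rewrite mulmxA e2 mul1mx.
    have Ac : row i A' = adjmx (col (sn i) (1%:M + psi)) by apply/rowP => w; rewrite adjmxE !mxE.
    have -> : row i A' *m adjmx (mskA f b) = adjmx c *m adjmx (1%:M + psi).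
      by rewrite Ac -adjmxM Fc adjmxM.
    rewrite A'E mulmxA; congr ((_ *m _) _ _); apply/rowP => w; rewrite adjmxE [c w 0]mxE [RHS]mxE.
    case: (boolP (w \in K)) => wK /=; last first.
      rewrite rmorph0 big1 // => j _; rewrite [Sel _ _]mxE (_ : w == sn j = false) ?mulr0 //.
      by apply/negbTE/eqP => e; rewrite e snK in wK.
    have hi : (index w s < k)%N by rewrite /k -szs index_mem smem.
    have sni : sn (Ordinal hi) = w by rewrite /sn /= nth_index // smem.
    rewrite (bigD1 (Ordinal hi)) //= [Sel _ _]mxE sni eqxx mulr1 big1 ?addr0.
      by rewrite [RHS]mxE sni; case: ifP; rewrite ?rmorph0.
    move=> j ji; rewrite [Sel _ _]mxE (_ : w == sn j = false) ?mulr0 //.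
    apply/negbTE/eqP => e; case/eqP: ji; apply/val_inj => /=.
    by rewrite e /sn index_uniq ?szs.
  have /submxP [D eD] : (W *m adjmx (mskA f b) <= W)%MS.
    by rewrite WA; apply: submx_trans stab; rewrite submxMr // WA.
  have eD' : mskA f b *m adjmx W = adjmx W *m adjmx D.
    by have := congr1 (@adjmx C _ _) eD; rewrite !adjmxM adjmxK.
  rewrite /P !mulmxA eD' -!mulmxA; congr (_ *m _).
  by rewrite [mskA f b *m (_ *m _)]mulmxA eD' -!mulmxA [W *m (_ *m _)]mulmxA WU mul1mx.
- rewrite /P -mulmxA mxtrace_mulC mxtrace_mulE.
  have -> : \sum_(x in K) a x = \sum_(i < k) a (sn i).
    rewrite -big_enum -(perm_big _ (permEl (perm_sort leA (enum K)))) /= -/s (big_nth x0) szs.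
    by rewrite big_mkord.
  apply: ler_sum => i _.
  have W1 : \sum_j W i j * adjmx W j i = 1.
    by have := congr1 (fun M : 'M_k => M i i) WU; rewrite !mxE eqxx.
  rewrite -[leRHS]mulr1 -W1 mulr_sumr; apply: ler_sum => j _.
  rewrite mul_mx_diag !mxE [W i j * _]mulrC -mulrA mulrCA.
  have [->|Wj] := eqVneq (W i j) 0; first by rewrite conjC0 !mul0r !mulr0 ?mul0r.
  rewrite [_^* * _]mulrC; apply: ler_wpM2r; first exact: mul_conjC_ge0.
  exact: Wsupp.
Qed.

Theorem dominant_sum_ge0 (f : Ar -> mat) (K : {set 'I_N}) : dominant K (~: K) ->
  mubig (mskA f) = diag_mx (\row_y a y) -> 0 <= \sum_(x in K) a x.
Proof.
move=> dom muf.
have dK : [disjoint K & ~: K] by rewrite -setI_eq0 setICr.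
have gen := dominant_generic_subat dK dom.
set aK := \sum_(x in K) a x.
have aKr : aK \is Num.real by apply: rpred_sum.
rewrite real_leNgt ?real0 //; apply/negP => aK0.
(* The entries of [P] have norm at most one, so an error [e] in each entry of the moment changes the
   trace by at most [N * N * e], which is less than [- aK]. *)
pose e := - aK / (2 * (N * N).+1%:R).
have e0 : 0 < e by rewrite divr_gt0 ?oppr_gt0 // mulr_gt0 ?ltr0n.
(* The moment map is polynomial only when entries and their conjugates are taken as independent
   variables. *)
pose Y := (Z + Z)%type.
pose Fm (w : Y -> C) b : mat := mskA (mxf (fun z => w (inl z))) b.
pose Gm (w : Y -> C) b : mat := (mskA (mxf (fun z => w (inr z))) b)^T.
pose q (p : 'I_N * 'I_N) (w : Y -> C) : C := (\sum_b (Fm w b *m Gm w b - Gm w b *m Fm w b)) p.1 p.2.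
have hq p : polyfun (q p).
  have hF b : polymx (fun w => Fm w b).
    move=> i j; case E: ((v j == src b) && (v i == tgt b)).
      by apply: (polyfun_ext _ (polyfun_var C (inl (b, i, j) : Y))) => w; rewrite !mxE E.
    by apply: (polyfun_ext _ (polyfun_const Y (0 : C))) => w; rewrite mxE E.
  have hG b : polymx (fun w => Gm w b).
    move=> j i; case E: ((v j == src b) && (v i == tgt b)).
      by apply: (polyfun_ext _ (polyfun_var C (inr (b, i, j) : Y))) => w; rewrite !mxE E.
    by apply: (polyfun_ext _ (polyfun_const Y (0 : C))) => w; rewrite !mxE E.
  apply: (@polyfun_ext _ _ (fun w => \sum_b (Fm w b *m Gm w b - Gm w b *m Fm w b) p.1 p.2)).
    by move=> w; rewrite /q summxE.
  apply: polyfun_sum => b _; apply: polymx_add; first exact: polymx_mul.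
  by apply: polymx_opp; apply: polymx_mul.
pose cw (g : Z -> C) (y : Y) : C := match y with inl z => g z | inr z => (g z)^* end.
have qE g y x : q (y, x) (cw g) = mubig (mskA (mxf g)) y x.
  rewrite /q /mubig; congr (fun_of_matrix _ y x); apply: eq_bigr => b _.
  have -> : Gm (cw g) b = adjmx (Fm (cw g) b).
    by apply/matrixP => i j; rewrite adjmxE !mxE; case: ifP; rewrite ?mxE ?rmorph0.
  by [].
have [tau [tau0 ht]] := polyfun_continuous_all (cw (fmx f)) hq e0.
have [g [[psi sub] gn]] := generic_near (fmx f) gen tau0.
have [P [Pa P2 Pmu PA]] := subat_trace sub.
have P1 := proj_entry_le1 Pa P2.
have close y x : `|(mubig (mskA (mxf g)) - diag_mx (\row_y a y)) y x| <= e.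
  have := ht (cw g) _ (y, x); rewrite !qE.
  have -> : mubig (mskA (mxf (fmx f))) = diag_mx (\row_y a y).
    rewrite -muf; apply: eq_bigr => b _; have -> // : mskA (mxf (fmx f)) b = mskA f b.
    by apply/matrixP => i j; rewrite !mxE.
  rewrite [X in _ -> `|X| <= _]mxE [X in _ -> `|_ + X| <= _]mxE; apply=> [[z|z]] //=.
  by rewrite -rmorphB norm_conjC.
have bound : `|\tr (P *m (mubig (mskA (mxf g)) - diag_mx (\row_y a y)))| <= (N * N)%:R * e.
  rewrite mxtrace_mulE; apply: le_trans (ler_norm_sum _ _ _) _.
  have -> : (N * N)%:R * e = \sum_(i < N) \sum_(j < N) e.
    by rewrite sumr_const card_ord sumr_const card_ord -mulrnA mulr_natl.
  apply: ler_sum => i _; apply: le_trans (ler_norm_sum _ _ _) _; apply: ler_sum => j _.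
  by rewrite normrM -[leRHS]mul1r; apply: ler_pM.
move: bound; rewrite mulmxBr raddfB /= => bound.
have trle : \tr (P *m diag_mx (\row_y a y)) < 0 := le_lt_trans PA aK0.
have : - aK <= (N * N)%:R * e.
  apply: le_trans bound; rewrite ger0_norm; last by rewrite subr_ge0 (le_trans (ltW trle)).
  apply: le_trans (_ : - \tr (P *m diag_mx (\row_y a y)) <= _); first by rewrite lerN2.
  by rewrite lerDr.
have rNe : (N * N)%:R * e \is Num.real by apply: rpredM; [apply: realn|apply: gtr0_real].
apply/negP; rewrite -real_ltNge ?realN //.
rewrite /e mulrA ltr_pdivrMr ?mulr_gt0 ?ltr0n // mulrC ltr_pM2l ?oppr_gt0 //.
by rewrite -natrM ltr_nat; lia.
Qed.

End Necessity.


(** * Minima of polynomial functions over real closed fields *)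

Record realpart (C : numClosedFieldType) := RealPart { rpval :> C; rpvalP : rpval \is Num.real }.

(** * The real elements of the field as a real closed field *)

Section RealPart.
Variable C : numClosedFieldType.
Notation R := (realpart C).

HB.instance Definition _ := [isSub for @rpval C].
HB.instance Definition _ := [Choice of R by <:].
HB.instance Definition _ := [SubChoice_isSubIntegralDomain of R by <:].
HB.instance Definition _ := [SubIntegralDomain_isSubField of R by <:].
HB.instance Definition _ : Order.isPOrder ring_display R := Order.CancelPartial.Pcan _ valK.

Lemma realpart_total : total (<=%O : rel (R : porderType _)).
Proof. by move=> x y; apply/real_leVge/valP/valP. Qed.
HB.instance Definition _ := Order.POrder_isTotal.Build _ R realpart_total.

Lemma rpval_zmod_morphism : zmod_morphism (@rpval C). Proof. by []. Qed.
Lemma rpval_monoid_morphism : monoid_morphism (@rpval C). Proof. by []. Qed.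
HB.instance Definition _ := GRing.isZmodMorphism.Build R C (@rpval C) rpval_zmod_morphism.
HB.instance Definition _ := GRing.isMonoidMorphism.Build R C (@rpval C) rpval_monoid_morphism.

Definition realpart_norm (x : R) : R := RealPart (normr_real (val x)).

Lemma realpart_normD x y : realpart_norm (x + y) <= realpart_norm x + realpart_norm y.
Proof. exact: ler_normD. Qed.
Lemma realpart_norm_eq0 x : realpart_norm x = 0 -> x = 0.
Proof. by move=> /(congr1 val)/normr0_eq0 ?; apply/val_inj. Qed.
Lemma realpart_normMn x n : realpart_norm (x *+ n) = realpart_norm x *+ n.
Proof. by apply/val_inj; rewrite /= !rmorphMn/= normrMn. Qed.
Lemma realpart_normN x : realpart_norm (- x) = realpart_norm x.
Proof. by apply/val_inj; apply: normrN. Qed.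

Section Order.
Let z : R := 0.
Lemma realpart_addr_gt0 (x y : R) : z < x -> z < y -> z < x + y.
Proof. exact: addr_gt0. Qed.
Lemma realpart_ger_leVge (x y : R) : z <= x -> z <= y -> (x <= y) || (y <= x).
Proof. exact: ger_leVge. Qed.
Lemma realpart_normM : {morph realpart_norm : x y / x * y}.
Proof. by move=> *; apply/val_inj; apply: normrM. Qed.
Lemma realpart_ler_def (x y : R) : (x <= y) = (realpart_norm (y - x) == y - x).
Proof. exact: ler_def. Qed.
End Order.

HB.instance Definition _ := Num.Zmodule_isNormed.Build _ R
  realpart_normD realpart_norm_eq0 realpart_normMn realpart_normN.
HB.instance Definition _ := Num.isNumRing.Build R
  realpart_addr_gt0 realpart_ger_leVge realpart_normM realpart_ler_def.

(** Induction on the degree by splitting off a root in [C]: a real root lies outside the interval,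
    so its linear factor keeps its sign there; a nonreal root contributes a real quadratic factor
    that is positive everywhere. *)
Lemma realpart_noroot_gt0 (p : {poly R}) (a b : R) : a <= b -> p != 0 ->
  (forall x, a <= x <= b -> ~~ root p x) -> 0 < p.[a] * p.[b].
Proof.
move=> ab; have [n] := ubnP (size p); elim: n p => // n IH p; rewrite ltnS => sp p0 nr.
case: (leqP (size p) 1) => sz.
  have pc := size1_polyC sz; rewrite pc !hornerC -expr2 exprn_even_gt0 //=.
  by apply: contra_neq p0 => e; rewrite pc e.
pose pC := map_poly (@rpval C) p.
have [z rz] : exists z, root pC z by apply/closed_rootP; rewrite size_map_poly; apply/eqP => e; rewrite e in sz.
case: (boolP (z \is Num.real)) => zr.
  pose x : R := RealPart zr.
  have rx : root p x by rewrite -(fmorph_root (@rpval C)).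
  have [q eq] := factor_theorem p x rx.
  have q0 : q != 0 by apply: contra_neq p0 => e; rewrite eq e mul0r.
  have hq : 0 < q.[a] * q.[b].
    apply: IH => //; last by move=> y /nr; rewrite eq rootM negb_or => /andP[].
    by move: sp; rewrite eq size_mul ?polyXsubC_eq0 // size_XsubC addn2.
  rewrite eq !hornerM !hornerXsubC mulrACA mulr_gt0 //.
  have : ~~ (a <= x <= b) by apply: contraL rx; apply: nr.
  rewrite negb_and -!ltNge => /orP[xa|bx].
    by rewrite mulr_gt0 // subr_gt0 // (lt_le_trans xa).
  by rewrite nmulr_rgt0 subr_lt0 // (le_lt_trans ab).
pose re : R := RealPart (Creal_Re z); pose nz : R := RealPart (normr_real z).
pose m : {poly R} := 'X^2 - (re *+ 2) *: 'X + (nz ^+ 2)%:P.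
have zRI : z = 'Re z + 'i * 'Im z := Crect z.
have im0 : 'Im z != 0 by apply: contraNneq zr => /Creal_ImP.
have nzE : `|z| ^+ 2 = 'Re z ^+ 2 + 'Im z ^+ 2 by rewrite normC2_Re_Im.
have mE (y : R) : rpval m.[y] = (rpval y - 'Re z) ^+ 2 + 'Im z ^+ 2.
  have -> : m.[y] = y ^+ 2 - re * y *+ 2 + nz ^+ 2 by rewrite !hornerE; ring.
  rewrite rmorphD rmorphB rmorphMn rmorphM !rmorphXn /= nzE; ring.
have mpos (y : R) : 0 < m.[y].
  change (0 < rpval m.[y]); rewrite mE ltr_wpDl //.
    by rewrite real_exprn_even_ge0 // rpredB ?Creal_Re // rpvalP.
  by rewrite real_exprn_even_gt0 ?Creal_Im.
have szm : size m = 3.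
  rewrite /m -addrA size_polyDl ?size_polyXn // ltnS.
  apply: leq_trans (size_polyD _ _) _; rewrite geq_max size_polyN.
  rewrite (leq_trans (size_scale_leq _ _)) ?size_polyX //= (leq_trans (size_polyC_leq1 _)) //.
have m0 : m != 0 by rewrite -size_poly_eq0 szm.
have rmz : root (map_poly (@rpval C) m) z.
  rewrite rootE /m rmorphD rmorphB /= map_polyZ /= map_polyXn map_polyX map_polyC /= !hornerE.
  apply/eqP; rewrite -[`|z| * `|z|]expr2 nzE; have := sqrCi C.
  move: zRI; move: ('Re z) ('Im z) ('i : C) => r0 i1 i0 -> hi.
  by (have -> : (r0 + i0 * i1) ^+ 2 - (r0 + r0) * (r0 + i0 * i1) + (r0 ^+ 2 + i1 ^+ 2) =
    i1 ^+ 2 * (i0 ^+ 2 + 1) by ring); rewrite hi addNr mulr0.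
have rem0 : p %% m = 0.
  have sr : (size (p %% m)%R < 3)%N by apply: leq_trans (_ : size m <= 3)%N; rewrite ?ltn_modp ?szm.
  have rr : root (map_poly (@rpval C) (p %% m)) z.
    have := rz; rewrite /pC {1}(divp_eq p m) rmorphD rmorphM /= !rootE hornerD hornerM.
    by rewrite (eqP rmz) mulr0 add0r.
  set r := p %% m in sr rr *.
  have rE : (map_poly (@rpval C) r).[z] = rpval r`_0 + rpval r`_1 * z.
    rewrite (@horner_coef_wide _ 2) ?size_map_poly // !big_ord_recl big_ord0 /= !coef_map /=.
    by rewrite expr0 expr1 mulr1 addr0.
  have r1 : r`_1 = 0.
    apply/val_inj => /=; apply/eqP; apply: contraNT zr => r1.
    have -> : z = - rpval r`_0 / rpval r`_1.
      move: rr; rewrite rootE rE addr_eq0 => /eqP ->; rewrite opprK mulrC mulKf //.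
    by rewrite rpredM ?rpredN ?rpredV ?rpvalP.
  have r0 : r`_0 = 0.
    by apply/val_inj => /=; move: rr; rewrite rootE rE r1 /= mul0r addr0 => /eqP.
  apply/polyP => [[|[|k]]]; rewrite ?coef0 //.
  by rewrite nth_default // -ltnS (leq_trans sr).
have pE : p = p %/ m * m by rewrite {1}(divp_eq p m) rem0 addr0.
move: (p %/ m) pE => q pE.
have q0 : q != 0 by apply: contra_neq p0 => e; rewrite pE e mul0r.
rewrite pE !hornerM mulrACA; apply: mulr_gt0; last by apply: mulr_gt0.
apply: IH => //.
  by move: sp; rewrite pE size_mul // szm addn3 /=; apply: ltn_trans.
by move=> y /nr; rewrite pE rootM negb_or => /andP[].
Qed.

Lemma realpart_closed : Num.real_closed_axiom R.
Proof.
move=> p a b ab /andP[pa pb]; apply: NNPP => H.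
have nr x : a <= x <= b -> ~~ root p x by move=> h; apply/negP => r; apply: H; exists x.
have p0 : p != 0 by apply: contraTneq (nr a _) => [->|]; rewrite ?root0 ?lexx.
have := realpart_noroot_gt0 ab p0 nr.
by rewrite ltNge mulr_le0_ge0.
Qed.
HB.instance Definition _ := Num.RealField_isClosed.Build R realpart_closed.

End RealPart.

(** * Suprema and compactness for definable sets *)

Section Definable.
Variable R : rcfType.
Import ordered_qelim.

Lemma term_poly (t : GRing.term R) e i : GRing.rterm t ->
  exists P : {poly R}, forall x, GRing.eval (set_nth 0 e i x) t = P.[x].
Proof.
elim: t => //=.
- move=> n _; have [->|ni] := eqVneq n i.
    by exists 'X => x; rewrite nth_set_nth /= eqxx hornerX.
  by exists (e`_n)%:P => x; rewrite nth_set_nth /= (negbTE ni) hornerC.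
- by move=> c _; exists c%:P => x; rewrite hornerC.
- by move=> c _; exists c%:R%:P => x; rewrite hornerC.
- by move=> t IHt u IHu /andP[/IHt [P hP] /IHu [Q hQ]]; exists (P + Q) => x; rewrite hP hQ hornerD.
- by move=> t IHt /IHt [P hP]; exists (- P) => x; rewrite hP hornerN.
- by move=> t IHt n /IHt [P hP]; exists (P *+ n) => x; rewrite hP hornerMn.
- by move=> t IHt u IHu /andP[/IHt [P hP] /IHu [Q hQ]]; exists (P * Q) => x; rewrite hP hQ hornerM.
- by move=> t IHt n /IHt [P hP]; exists (P ^+ n) => x; rewrite hP horner_exp.
Qed.

Lemma noroot_sign (P : {poly R}) x y : x <= y -> (forall z, x <= z <= y -> ~~ root P z) ->
  (0 < P.[x]) = (0 < P.[y]).
Proof.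
move=> xy nr.
have nx : P.[x] != 0 by have := nr x; rewrite lexx xy rootE => ->.
have ny : P.[y] != 0 by have := nr y; rewrite lexx xy rootE => ->.
apply/idP/idP => h; rewrite lt_def ?nx ?ny /= leNgt; apply/negP => h'.
  have [|z zz] := @poly_ivt _ (- P) x y xy; first by rewrite !hornerN oppr_le0 oppr_ge0 !ltW.
  by rewrite rootE hornerN oppr_eq0 -rootE; apply/negP/nr.
have [|z zz] := @poly_ivt _ P x y xy; first by rewrite !ltW.
by apply/negP/nr.
Qed.

(* O-minimality: a definable subset of the line is a finite union of points and intervals. *)
Lemma qf_tame (f : ord.formula R) e i : ord.qf_form f && ord.rformula f ->
  exists2 P : {poly R}, P != 0 & forall x y, x <= y -> (forall z, x <= z <= y -> ~~ root P z) ->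
    ord.qf_eval (set_nth 0 e i x) f = ord.qf_eval (set_nth 0 e i y) f.
Proof.
have atom t u : GRing.rterm t -> GRing.rterm u -> exists2 P : {poly R}, P != 0 &
    forall x y, x <= y -> (forall z, x <= z <= y -> ~~ root P z) ->
    (GRing.eval (set_nth 0 e i x) t == GRing.eval (set_nth 0 e i x) u) =
    (GRing.eval (set_nth 0 e i y) t == GRing.eval (set_nth 0 e i y) u) /\
    (GRing.eval (set_nth 0 e i x) t < GRing.eval (set_nth 0 e i x) u) =
    (GRing.eval (set_nth 0 e i y) t < GRing.eval (set_nth 0 e i y) u).
  move=> rt ru; have [P hP] := term_poly e i rt; have [Q hQ] := term_poly e i ru.
  have [E|NE] := eqVneq (Q - P) 0.
    exists 1; rewrite ?oner_neq0 // => x y _ _; rewrite !hP !hQ.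
    by move/eqP: E; rewrite subr_eq0 => /eqP ->; rewrite !eqxx !ltxx.
  exists (Q - P) => // x y xy nr; rewrite !hP !hQ.
  have := noroot_sign xy nr; rewrite !hornerD !hornerN !subr_gt0 => ->; split=> //.
  have := nr x; have := nr y; rewrite !rootE !hornerD !hornerN !lexx xy !subr_eq0.
  by rewrite ![Q.[_] == _]eq_sym => /(_ isT) /negbTE -> /(_ isT) /negbTE ->.
have comb (f1 g1 : ord.formula R) (op : bool -> bool -> bool) :
  (exists2 P : {poly R}, P != 0 & forall x y, x <= y -> (forall z, x <= z <= y -> ~~ root P z) ->
    ord.qf_eval (set_nth 0 e i x) f1 = ord.qf_eval (set_nth 0 e i y) f1) ->
  (exists2 P : {poly R}, P != 0 & forall x y, x <= y -> (forall z, x <= z <= y -> ~~ root P z) ->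
    ord.qf_eval (set_nth 0 e i x) g1 = ord.qf_eval (set_nth 0 e i y) g1) ->
  exists2 P : {poly R}, P != 0 & forall x y, x <= y -> (forall z, x <= z <= y -> ~~ root P z) ->
    op (ord.qf_eval (set_nth 0 e i x) f1) (ord.qf_eval (set_nth 0 e i x) g1) =
    op (ord.qf_eval (set_nth 0 e i y) f1) (ord.qf_eval (set_nth 0 e i y) g1).
  move=> [P P0 hP] [Q Q0 hQ]; exists (P * Q); first by rewrite mulf_neq0.
  move=> x y xy nr; rewrite (hP _ _ xy) ?(hQ _ _ xy) // => z zz; have := nr z zz;
    by rewrite rootM negb_or => /andP[].
elim: f => //=.
- by move=> b _; exists 1; rewrite ?oner_neq0.
- by move=> t u /andP[rt ru]; have [P P0 h] := atom t u rt ru; exists P => // x y xy /(h _ _ xy) [].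
- by move=> t u /andP[rt ru]; have [P P0 h] := atom t u rt ru; exists P => // x y xy /(h _ _ xy) [].
- move=> t u /andP[rt ru]; have [P P0 h] := atom t u rt ru; exists P => // x y xy /(h _ _ xy) [h1 h2].
  by rewrite !le_eqVlt h1 h2.
- move=> f IHf g IHg; rewrite andbACA => /andP[/IHf hf /IHg hg]; exact: (comb f g andb).
- move=> f IHf g IHg; rewrite andbACA => /andP[/IHf hf /IHg hg]; exact: (comb f g orb).
- move=> f IHf g IHg; rewrite andbACA => /andP[/IHf hf /IHg hg]; exact: (comb f g implb).
- move=> f IHf /IHf hf; exact: (comb f f (fun b _ => ~~ b)).
Qed.

Lemma poly_roots_seq (P : {poly R}) : P != 0 -> exists rs : seq R, forall x, root P x -> x \in rs.
Proof.
have [n] := ubnP (size P); elim: n P => // n IH P; rewrite ltnS => sp P0.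
case: (classic (exists x, root P x)) => [[x rx]|nr]; last by exists [::] => x rx; case: nr; exists x.
have [q eq] := factor_theorem P x rx.
have q0 : q != 0 by apply: contra_neq P0 => e; rewrite eq e mul0r.
have [|//|rs hrs] := IH q; first by move: sp; rewrite eq size_mul ?polyXsubC_eq0 // size_XsubC addn2.
exists (x :: rs) => y; rewrite eq rootM root_XsubC inE => /orP[/hrs ->|->]; by rewrite ?orbT.
Qed.

Lemma seq_minimal (rs : seq R) (U : R -> Prop) : (exists2 r, r \in rs & U r) ->
  exists2 r, r \in rs /\ U r & forall r', r' \in rs -> U r' -> r <= r'.
Proof.
elim: rs => [[r]//|a rs IH] [r]; rewrite inE.
case: (classic (exists2 r, r \in rs & U r)) => [/IH [m [mr Um] hm] _ _|nex].
  case: (classic (U a /\ a <= m)) => [[Ua am]|na].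
    exists a; first by rewrite inE eqxx.
    by move=> r'; rewrite inE => /orP[/eqP -> //|r'r] Ur'; apply: le_trans am (hm _ r'r Ur').
  exists m; first by rewrite inE mr orbT.
  move=> r'; rewrite inE => /orP[/eqP ->|] Ur'; last exact: hm.
  by rewrite leNgt; apply/negP => lt; apply: na; split=> //; apply: ltW.
move=> /orP[/eqP ->|rr] Ur; last by case: nex; exists r.
exists a; first by rewrite inE eqxx.
by move=> r'; rewrite inE => /orP[/eqP -> //|r'r] Ur'; case: nex; exists r'.
Qed.

(** Membership in [D] does not change between roots of the polynomial from [qf_tame], so the least
    root that bounds [D] is its least upper bound. *)
Lemma definable_sup (f : ord.formula R) e i (D : R -> Prop) : ord.rformula f ->
  (forall s, ord.holds (set_nth 0 e i s) f <-> D s) ->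
  (exists s, D s) -> (exists M, forall s, D s -> s <= M) ->
  exists c, (forall s, D s -> s <= c) /\ forall u, (forall s, D s -> s <= u) -> c <= u.
Proof.
move=> rf hD [s0 Ds0] [M hM].
have wf := @qe_rcf.wf_QE_wproj R; have vl := @qe_rcf.valid_QE_wproj R.
have [P P0 hP] := qf_tame e i (ord.quantifier_elim_wf wf rf).
have red s : D s <-> ord.qf_eval (set_nth 0 e i s) (ord.quantifier_elim (fun i bc => qe_rcf.qfr_to_formula (qe_rcf.wproj i bc)) f).
  by rewrite -hD; split=> [/(ord.quantifier_elim_rformP wf vl _ rf)|/(ord.quantifier_elim_rformP wf vl _ rf)].
have step x y : x <= y -> (forall z, x <= z <= y -> ~~ root P z) -> D x -> D y.
  by move=> xy nr /red h; apply/red; rewrite -(hP _ _ xy).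
have [rs hrs] := poly_roots_seq P0.
(* A member of [D] with no root above it would propagate to [M + 1], against the bound. *)
have top s : D s -> exists2 r, r \in rs & s <= r.
  move=> Ds; apply: NNPP => H; have sM := hM s Ds.
  have : D (M + 1).
    apply: (step s) => //; first by rewrite (le_trans sM) // lerDl.
    by move=> z /andP[sz _]; apply/negP => /hrs zr; apply: H; exists z.
  by move/hM; rewrite gerDl ler10.
have [mx mxr hmx] : exists2 r, r \in rs & forall r', r' \in rs -> r' <= r.
  have [r rr _] := top _ Ds0.
  have [m [mr _] hm] := @seq_minimal [seq - x | x <- rs] (fun=> True) (ex_intro2 _ _ (- r) (map_f _ rr) I).
  exists (- m); first by have /mapP [x xr ->] := mr; rewrite opprK.
  by move=> r' r'r; rewrite lerNr; apply: hm => //; apply: map_f.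
have [c [cr Uc] hc] := @seq_minimal rs (fun r => forall s, D s -> s <= r) (ex_intro2 _ _ mx mxr (fun s Ds =>
   let: ex_intro2 r rr sr := top s Ds in le_trans sr (hmx r rr))).
exists c; split=> // u hu; rewrite leNgt; apply/negP => uc.
have [s [Ds hs]] : exists s, D s /\ forall r, r \in rs -> r < c -> r < s.
  have h r : r \in rs -> r < c -> exists2 s, D s & r < s.
    move=> rr rc; apply: NNPP => H.
    have := hc r rr _; rewrite leNgt rc => /(_ _) /negP; apply; last by [].
    by move=> s Ds; rewrite leNgt; apply/negP => rs'; apply: H; exists s.
  have {}h : forall r, r \in rs -> r < c -> exists2 s, D s & r < s by [].
  elim: (rs) h => [|a l IH] h; first by exists s0.
  have [r rl|s [Ds hs]] := IH; first by apply: h; rewrite inE rl orbT.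
  case: (ltP a c) => ac; last first.
    exists s; split=> // r; rewrite inE => /orP[/eqP ->|]; last exact: hs.
    by rewrite ltNge ac.
  have [s1 Ds1 as1] := h a (mem_head _ _) ac.
  case: (leP s s1) => ss1.
    exists s1; split=> // r; rewrite inE => /orP[/eqP -> //|rl rc].
    exact: lt_le_trans (hs _ rl rc) ss1.
  exists s; split=> // r; rewrite inE => /orP[/eqP -> _|]; last exact: hs.
  exact: lt_trans as1 ss1.
have su := hu _ Ds.
(* No root lies between [s] and this midpoint, which exceeds the supposed bound [u]. *)
have : D ((u + c) / 2).
  apply: step Ds; first by lra.
  move=> z /andP[sz zu]; apply/negP => rz.
  have zc : z < c by move: uc zu; clear; lra.
  by have := le_lt_trans sz (hs z (hrs z rz) zc); rewrite ltxx.
by move/hu; lra.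
Qed.


Definition dpred (P : (nat -> R) -> Prop) :=
  exists2 f : ord.formula R, ord.rformula f & forall e : seq R, ord.holds e f <-> P (nth 0 e).
Definition upd (e : nat -> R) i x j : R := if j == i then x else e j.
Definition cut n (e : nat -> R) j : R := if (j < n)%N then e j else 0.

Lemma dpred_ext P Q : (forall e, P e <-> Q e) -> dpred P -> dpred Q.
Proof. by move=> E [f rf hf]; exists f => // e; rewrite hf E. Qed.
Lemma dpred_and P Q : dpred P -> dpred Q -> dpred (fun e => P e /\ Q e).
Proof. by move=> [f rf hf] [g rg hg]; exists (ord.And f g) => /= [|e]; rewrite ?rf // hf hg. Qed.
Lemma dpred_imp P Q : dpred P -> dpred Q -> dpred (fun e => P e -> Q e).
Proof. by move=> [f rf hf] [g rg hg]; exists (ord.Implies f g) => /= [|e]; rewrite ?rf // hf hg. Qed.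
Lemma dpred_all (I : finType) (P : I -> (nat -> R) -> Prop) :
  (forall i, dpred (P i)) -> dpred (fun e => forall i, P i e).
Proof.
move=> hP; apply: (@dpred_ext (fun e => forall i, i \in enum I -> P i e)).
  by move=> e; split=> h i; [apply: h; rewrite mem_enum|].
elim: (enum I) => [|i r IH]; first by exists (ord.Bool true).
apply: (dpred_ext _ (dpred_and (hP i) IH)) => e; split.
  by move=> [h1 h2] j; rewrite inE => /orP[/eqP ->|/h2].
by move=> h; split=> [|j jr]; apply: h; rewrite inE ?eqxx ?jr ?orbT.
Qed.

Lemma nth_upd (e : seq R) i x : nth 0 (set_nth 0 e i x) = upd (nth 0 e) i x.
Proof. by apply: functional_extensionality => j; rewrite nth_set_nth. Qed.

Lemma dpred_ex i P : dpred P -> dpred (fun e => exists x, P (upd e i x)).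
Proof.
move=> [f rf hf]; exists (ord.Exists i f) => // e /=.
by split=> [[x /hf]|[x]]; rewrite ?nth_upd => h; exists x; rewrite ?hf ?nth_upd.
Qed.
Lemma dpred_forall i P : dpred P -> dpred (fun e => forall x, P (upd e i x)).
Proof.
move=> [f rf hf]; exists (ord.Forall i f) => // e /=.
by split=> h x; have := h x; rewrite hf nth_upd.
Qed.

Lemma dpred_foralln n P : dpred P ->
  dpred (fun e => forall y : nat -> R, P (fun j => if (j < n)%N then y j else e j)).
Proof.
move=> hP; elim: n => [|n IH].
  by apply: dpred_ext hP => e; split=> [h y|/(_ e)].
apply: (dpred_ext _ (dpred_forall n IH)) => e; split=> h.
  move=> y; have := h (y n) y; congr (P _); apply: functional_extensionality => j.
  by rewrite /upd ltnS; case: ltngtP => // ->.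
move=> x y; have := h (fun j => if (j < n)%N then y j else x).
congr (P _); apply: functional_extensionality => j.
by rewrite /upd ltnS; case: ltngtP.
Qed.

Lemma dpred_le (p q : (nat -> R) -> R) : polyfun p -> polyfun q -> dpred (fun e => p e <= q e).
Proof.
move=> hp hq; have [t [rt ht]] := polyfun_term id hp; have [u [ru hu]] := polyfun_term id hq.
by exists (ord.Le t u); rewrite /= ?rt // => e; rewrite ht hu.
Qed.
Lemma dpred_lt (p q : (nat -> R) -> R) : polyfun p -> polyfun q -> dpred (fun e => p e < q e).
Proof.
move=> hp hq; have [t [rt ht]] := polyfun_term id hp; have [u [ru hu]] := polyfun_term id hq.
by exists (ord.Lt t u); rewrite /= ?rt // => e; rewrite ht hu.
Qed.
Lemma dpred_eq (p q : (nat -> R) -> R) : polyfun p -> polyfun q -> dpred (fun e => p e = q e).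
Proof.
move=> hp hq; apply: (dpred_ext _ (dpred_and (dpred_le hp hq) (dpred_le hq hp))) => e.
by split=> [[h1 h2]|->]; [apply/le_anti; rewrite h1 h2|rewrite lexx].
Qed.
Lemma dpred_norm_le (p q : (nat -> R) -> R) : polyfun p -> polyfun q -> dpred (fun e => `|p e| <= q e).
Proof.
move=> hp hq; apply: (dpred_ext _ (dpred_and (dpred_le (polyfun_opp hq) hp) (dpred_le hp hq))) => e.
by rewrite ler_norml; split=> [[-> ->]|/andP[]].
Qed.

Lemma dpred_sup P i : dpred P -> let D s := P (upd (fun=> 0) i s) in
  (exists s, D s) -> (exists M, forall s, D s -> s <= M) ->
  exists c, (forall s, D s -> s <= c) /\ forall u, (forall s, D s -> s <= u) -> c <= u.
Proof.
move=> [f rf hf] D; apply: (@definable_sup f [::] i) => // s; rewrite hf nth_upd.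
have -> // : nth 0 [::] = (fun=> 0 : R) by apply: functional_extensionality => j; rewrite nth_nil.
Qed.

Lemma polyfun_bounded (Z : Type) (p : (Z -> R) -> R) (M : R) : polyfun p ->
  exists B : R, forall y, (forall z, `|y z| <= M) -> `|p y| <= B.
Proof.
elim=> [c|z|p1 q1 _ [B1 h1] _ [B2 h2]|p1 q1 _ [B1 h1] _ [B2 h2]|p1 q1 E _ [B h]].
- by exists `|c|.
- by exists M.
- by exists (B1 + B2) => y hy; rewrite (le_trans (ler_normD _ _)) // lerD ?h1 ?h2.
- by exists (B1 * B2) => y hy; rewrite normrM ler_pM ?h1 ?h2.
- by exists B => y /h; rewrite E.
Qed.

(** Nonempty definable subsets of a box that shrink as [t] decreases to zero. Variable [n] carries
    [t], and [cut] restricts attention to the first [n] variables. *)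
Definition dfamily n (A : R -> (nat -> R) -> Prop) (M : R) :=
  [/\ dpred (fun e => A (e n) (cut n e)),
      forall t t' y, t <= t' -> A t y -> A t' y,
      forall t : R, 0 < t -> exists y, A t (cut n y) &
      forall t y k, (k < n)%N -> A t y -> `|y k| <= M].

(** [c] is the limit inferior of the [k]-th coordinate: the supremum of the numbers that bound it
    from below on some member of the family. Every member then has points whose [k]-th coordinate is
    within [t] of [c]. *)
Lemma dfamily_step n A M k : (k < n)%N -> dfamily n A M ->
  exists c, dfamily n (fun t y => A t y /\ `|y k - c| <= t) M.
Proof.
move=> kn [dA mono nonempty bd].
pose P e := exists t : R, 0 < t /\ forall y, A t (cut n y) -> e n.+1 <= y k.
have dP : dpred P.
  have d1 : dpred (fun e => A (e n) (cut n e) -> e n.+1 <= e k).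
    by apply: dpred_imp => //; apply: dpred_le; apply: polyfun_var.
  have d2 := dpred_and (dpred_lt (polyfun_const nat 0) (polyfun_var R n)) (dpred_foralln n d1).
  apply: (dpred_ext _ (dpred_ex n d2)) => e; rewrite /P.
  have cutE y (e' : nat -> R) : cut n (fun j => if (j < n)%N then y j else e' j) = cut n y.
    by apply: functional_extensionality => j; rewrite /cut; case: ltnP.
  by split=> [[t]|[t]] [t0 h]; exists t; move: t0 h; rewrite /upd ltnn eqxx ltnNge leqnSn /= gtn_eqF // => t0 h;
    split=> // y; have := h y; rewrite cutE kn.
have E s : P (upd (fun=> 0) n.+1 s) <-> exists t, 0 < t /\ forall y, A t (cut n y) -> s <= y k.
  by rewrite /P /upd eqxx.
have cutk y : cut n y k = y k by rewrite /cut kn.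
have [||c [c1 c2]] := @dpred_sup P n.+1 dP.
- exists (- M); apply/E; exists 1; split; first exact: ltr01.
  by move=> y /(bd _ _ _ kn); rewrite cutk ler_norml => /andP[].
- exists M => s /E [t [t0 h]]; have [y Ay] := nonempty t t0; apply: le_trans (h y Ay) _.
  by have := bd _ _ _ kn Ay; rewrite cutk ler_norml => /andP[].
exists c; split.
- apply: dpred_and => //.
  apply: (@dpred_ext (fun e => `|e k - c| <= e n)); first by move=> e; rewrite cutk.
  apply: dpred_norm_le (polyfun_var R n).
  by apply: polyfun_sub; [apply: polyfun_var|apply: polyfun_const].
- by move=> t t' y tt' [h1 h2]; split; [apply: mono h1|apply: le_trans tt'].
- move=> t t0.
  have [s [/E [t1 [t10 h1]] sc]] : exists s, P (upd (fun=> 0) n.+1 s) /\ c - t < s.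
    apply: NNPP => H; have : c <= c - t.
      by apply: c2 => s Ps; rewrite leNgt; apply/negP => lt; apply: H; exists s.
    by move: t0; clear; lra.
  pose t2 := Num.min t t1; have t20 : 0 < t2 by rewrite lt_min t0.
  have [y [Ay yc]] : exists y, A t2 (cut n y) /\ y k < c + t.
    apply: NNPP => H; have : c + t <= c.
      apply: c1; apply/E; exists t2; split=> // y Ay; rewrite leNgt; apply/negP => lt; apply: H.
      by exists y.
    by rewrite gerDl leNgt t0.
  exists y; split; first by apply: mono Ay; rewrite ge_min lexx.
  have := h1 y (mono _ _ _ _ Ay); rewrite ge_min lexx orbT => /(_ isT) sy.
  by rewrite cutk ler_norml; move: sy yc sc; clear; lra.
- by move=> t y j jn [h _]; apply: bd h.
Qed.

Lemma dfamily_limit n A M : dfamily n A M ->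
  exists c : nat -> R, forall t, 0 < t -> exists y, A t (cut n y) /\ forall j, `|cut n y j - cut n c j| <= t.
Proof.
suff H m : (m <= n)%N -> forall A, dfamily n A M -> exists c : nat -> R, forall t, 0 < t ->
    exists y, A t (cut n y) /\ forall j, (j < m)%N -> `|y j - c j| <= t.
  move=> /(H n (leqnn n)) [c hc]; exists c => t t0; have [y [Ay hy]] := hc t t0.
  by exists y; split=> // j; rewrite /cut; case: ifP => [/hy //|_]; rewrite subrr normr0 ltW.
elim: m => [_ A0 [_ _ ne _]|m IH mn A0 /(dfamily_step mn) [c /(IH (ltnW mn)) [c' hc']]].
  by exists (fun=> 0) => t /ne [y hy]; exists y.
exists (fun j => if j == m then c else c' j) => t t0.
have [y [[Ay yc] hy]] := hc' t t0; exists y; split=> // j; rewrite ltnS leq_eqVlt.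
by case: eqP => [-> _|_ /hy //]; move: yc; rewrite /cut mn.
Qed.

(** The infimum [m] comes from [dpred_sup]. The subsets where [g] is at most [m + t] form a
    [dfamily], and continuity carries the constraints and the bound on [g] to its limit point. *)
Lemma real_minimum (Z I : finType) (q : I -> (Z -> R) -> R) (g : (Z -> R) -> R) (M : R) :
  (forall i, polyfun (q i)) -> polyfun g ->
  let S y := (forall i, q i y = 0) /\ forall z, `|y z| <= M in
  (exists y, S y) -> exists2 y, S y & forall y', S y' -> g y <= g y'.
Proof.
move=> hq hg S [y0 Sy0]; pose n := #|Z|.
pose rs (e : nat -> R) (z : Z) : R := e (enum_rank z).
pose ex (y : Z -> R) (j : nat) : R := oapp (fun i : 'I_#|Z| => y (enum_val i)) 0 (insub j).
have rsK y z : rs (ex y) z = y z by rewrite /rs /ex valK /= enum_rankK.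
have rs_cut e : rs (cut n e) = rs e.
  by apply: functional_extensionality => z; rewrite /rs /cut ltn_ord.
have rsex y : rs (ex y) = y by apply: functional_extensionality => z; rewrite rsK.
have prs p : polyfun p -> polyfun (fun e => p (rs e)).
  by move=> hp; apply: (polyfun_comp hp) => z; apply: polyfun_var.
have dS : dpred (fun e => S (rs e)).
  apply: dpred_and; apply: dpred_all => i.
    by apply: dpred_eq; [apply: prs|apply: polyfun_const].
  by apply: dpred_norm_le; [apply: polyfun_var|apply: polyfun_const].
have [B hB] := polyfun_bounded M hg.
have [|||m [m1 m2]] := @dpred_sup (fun e => forall y, S (rs y) -> e n <= g (rs y)) n.
- have d1 := dpred_foralln n (dpred_imp dS (dpred_le (polyfun_var R n) (prs _ hg))).
  have E (y e : nat -> R) : rs (fun j => if (j < n)%N then y j else e j) = rs y.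
    by apply: functional_extensionality => z; rewrite /rs ltn_ord.
  by apply: (dpred_ext _ d1) => e; split=> h y; have := h y; rewrite E ltnn.
- exists (- B); rewrite /upd eqxx => y [_ /hB]; by rewrite ler_norml => /andP[].
- exists (g y0) => s; rewrite /upd eqxx => /(_ (ex y0)); rewrite rsex; exact.
rewrite /upd eqxx in m1 m2.
have mg y : S y -> m <= g y.
  by move=> Sy; apply: m2 => s /(_ (ex y)); rewrite rsex; apply.
have [|c hc] := @dfamily_limit n (fun t e => S (rs e) /\ g (rs e) <= m + t) M.
  split.
  - apply: (@dpred_ext (fun e => S (rs e) /\ g (rs e) <= m + e n)); first by move=> e; rewrite rs_cut.
    apply: dpred_and => //; apply: dpred_le; first exact: prs.
    by apply: polyfun_add; [apply: polyfun_const|apply: polyfun_var].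
  - by move=> t t' y tt' [h1 h2]; split=> //; apply: le_trans h2 _; rewrite lerD2l.
  - move=> t t0; apply: NNPP => H.
    have : m + t <= m; last by rewrite gerDl leNgt t0.
    apply: m1 => y Sy; rewrite leNgt; apply/negP => lt; apply: H; exists y.
    by rewrite rs_cut; split=> //; apply: ltW.
  - move=> t y k kn [[_ h] _]; have := h (enum_val (Ordinal kn)).
    by rewrite /rs enum_valK.
have lim p b : polyfun p -> (forall y t, S y -> 0 < t -> g y <= m + t -> p y <= b + t) -> p (rs c) <= b.
  move=> hp h; rewrite leNgt; apply/negP => lt.
  pose e := (p (rs c) - b) / 3; have e0 : 0 < e by rewrite divr_gt0 ?subr_gt0 ?ltr0n.
  have [tau [tau0 ht]] := polyfun_continuous (rs c) hp e0.
  have [|y [[Sy gy] hy]] := hc (Num.min tau e); first by rewrite lt_min tau0.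
  rewrite rs_cut in Sy gy.
  have := ht (rs y); rewrite distrC ler_norml => /(_ _) /andP[].
    move=> z; apply: le_trans (_ : Num.min tau e <= _); last by rewrite ge_min lexx.
    by have := hy (enum_rank z); rewrite /cut ltn_ord.
  move=> _ h1; have := h _ _ Sy _ gy; rewrite lt_min tau0 e0 => /(_ isT) h2.
  have h3 : Num.min tau e <= e by rewrite ge_min lexx orbT.
  have eE : e * 3 = p (rs c) - b by rewrite divfK // pnatr_eq0.
  by move: h1 h2 h3 eE e0; clear; lra.
exists (rs c).
  split=> [i|z].
    apply/le_anti/andP; split; first by apply: lim => // y t [-> _] t0 _; rewrite add0r ltW.
    rewrite -oppr_le0; apply: (lim _ _ (polyfun_opp (hq i))) => y t [-> _] t0 _.
    by rewrite oppr0 add0r ltW.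
  rewrite ler_norml lerNl; apply/andP; split.
    apply: (lim _ _ (polyfun_opp (polyfun_var R z))) => y t [_ /(_ z)] + t0 _.
    by rewrite ler_norml; move: t0; clear; lra.
  apply: (lim _ _ (polyfun_var R z)) => y t [_ /(_ z)] + t0 _.
  by rewrite ler_norml; move: t0; clear; lra.
by move=> y' Sy'; apply: le_trans (mg _ Sy'); apply: lim.
Qed.

End Definable.

Section ComplexMinimum.
Variables (C : numClosedFieldType) (W : finType).
Notation R := (realpart C).

(** Conjugates are substituted for the second copy of the variables, so polynomials in [W + W]
    variables describe real-polynomial functions of [w]. *)
Definition cc (w : W -> C) (y : W + W) : C := match y with inl z => w z | inr z => (w z)^* end.
Definition ofri (y : W * bool -> R) (z : W) : C := rpval (y (z, true)) + 'i * rpval (y (z, false)).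

Lemma rpval_polyfun (p : (W + W -> C) -> C) : polyfun p ->
  exists P : bool -> (W * bool -> R) -> R, (forall b, polyfun (P b)) /\
    forall y, p (cc (ofri y)) = rpval (P true y) + 'i * rpval (P false y).
Proof.
elim=> [c|[z|z]|p1 q1 _ [P [hP E1]] _ [Q [hQ E2]]|p1 q1 _ [P [hP E1]] _ [Q [hQ E2]]|p1 q1 E _ [P [hP E1]]].
- exists (fun b _ => if b then RealPart (Creal_Re c) else RealPart (Creal_Im c)); split.
    by case; apply: polyfun_const.
  by move=> y /=; rewrite -Crect.
- by exists (fun b y => y (z, b)); split=> // b; apply: polyfun_var.
- exists (fun b y => if b then y (z, b) else - y (z, b)); split.
    by case; [|apply: polyfun_opp]; apply: polyfun_var.
  move=> y /=; rewrite /ofri rmorphD rmorphM /= conjCi !conj_Creal ?rpvalP //.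
  by rewrite mulNr mulrN.
- exists (fun b y => P b y + Q b y); split; first by move=> b; apply: polyfun_add.
  by move=> y; rewrite E1 E2 /= mulrDr addrACA.
- exists (fun b y => if b then P true y * Q true y - P false y * Q false y
                     else P true y * Q false y + P false y * Q true y); split.
    case; [apply: polyfun_sub|apply: polyfun_add]; exact: polyfun_mul.
  move=> y; rewrite E1 E2 /=.
  have hi := sqrCi C; move: (rpval (P true y)) (rpval (P false y)) (rpval (Q true y)) (rpval (Q false y)) => a b c d.
  have -> : (a + 'i * b) * (c + 'i * d) = a * c + 'i ^+ 2 * (b * d) + 'i * (a * d + b * c) by ring.
  by rewrite hi mulN1r.
- by exists P; split=> // y; rewrite -E.
Qed.

Lemma complex_minimum (I : finType) (q : I -> (W + W -> C) -> C) (g : (W + W -> C) -> C) (M : C) :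
  (forall i, polyfun (q i)) -> polyfun g -> (forall w, g (cc w) \is Num.real) -> M \is Num.real ->
  let S w := (forall i, q i (cc w) = 0) /\ forall z, `|'Re (w z)| <= M /\ `|'Im (w z)| <= M in
  (exists w, S w) -> exists2 w, S w & forall w', S w' -> g (cc w) <= g (cc w').
Proof.
move=> hq hg greal Mr S [w0 Sw0].
have [Q hQ] : exists Q : I -> bool -> (W * bool -> R) -> R, forall i, (forall b, polyfun (Q i b)) /\
    forall y, q i (cc (ofri y)) = rpval (Q i true y) + 'i * rpval (Q i false y).
  exact: (@fin_all_exists _ (fun=> bool -> (W * bool -> R) -> R) (fun i Q => (forall b, polyfun (Q b)) /\
    forall y, q i (cc (ofri y)) = rpval (Q true y) + 'i * rpval (Q false y)) (fun i => rpval_polyfun (hq i))).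
have [G [hG GE]] := rpval_polyfun hg.
pose S' y := (forall ib : I * bool, Q ib.1 ib.2 y = 0) /\ forall z, `|y z| <= RealPart Mr.
pose tori (w : W -> C) (zb : W * bool) : R :=
  if zb.2 then RealPart (Creal_Re (w zb.1)) else RealPart (Creal_Im (w zb.1)).
have toriK w : ofri (tori w) = w.
  by apply: functional_extensionality => z; rewrite /ofri /tori /= -Crect.
have ReE y z : 'Re (ofri y z) = rpval (y (z, true)) by rewrite Re_rect ?rpvalP.
have ImE y z : 'Im (ofri y z) = rpval (y (z, false)) by rewrite Im_rect ?rpvalP.
have SE y : S (ofri y) <-> S' y.
  split=> [[h1 h2]|[h1 h2]]; split.
  - move=> [i b] /=; apply/val_inj; change (rpval (Q i b y) = 0).
    have [_ e] := hQ i; have := h1 i; rewrite e => e'.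
    have r := congr1 (fun c : C => 'Re c) e'; have j := congr1 (fun c : C => 'Im c) e'.
    by case: b; [move: r|move: j]; rewrite /= ?Re_rect ?Im_rect ?rpvalP // => ->; rewrite raddf0.
  - by move=> [z [|]]; have [r i] := h2 z; [move: r; rewrite ReE|move: i; rewrite ImE].
  - by move=> i; rewrite (proj2 (hQ i)) (h1 (i, true)) (h1 (i, false)) /= mulr0 addr0.
  - by move=> z; rewrite ReE ImE; split; [apply: (h2 (z, true))|apply: (h2 (z, false))].
have [||y Sy hy] := @real_minimum _ _ _ (fun ib : I * bool => Q ib.1 ib.2) (G true) (RealPart Mr) _ (hG true).
- by move=> [i b]; apply: (proj1 (hQ i)).
- by exists (tori w0); apply/SE; rewrite toriK.
have gE y' : g (cc (ofri y')) = rpval (G true y').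
  by have := Creal_ReP _ (greal (ofri y')); rewrite GE Re_rect ?rpvalP.
exists (ofri y); first exact/SE.
by move=> w' Sw'; rewrite -(toriK w') !gE; apply: hy; apply/SE; rewrite toriK.
Qed.

End ComplexMinimum.


(** * Variation of the distance between a moment and an orbit *)

Ltac mxgen := repeat match goal with |- context [@mulmx ?R ?m ?n ?p ?X ?Y] => let Z := fresh in set Z := (@mulmx R m n p X Y); clearbody Z end.
Ltac mxexp := rewrite ?(mulmxDl, mulmxDr, mulNmx, mulmxN, mulmxA, mulmx1, mul1mx, mulmx0, mul0mx) -?scalemxAl -?scalemxAr ?(mulmxDl, mulmxDr, mulNmx, mulmxN, mulmxA, mulmx1, mul1mx).
Ltac mxring := repeat progress mxexp; mxgen; apply/matrixP => ? ?; rewrite !mxE; ring.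
Ltac mxfield := repeat progress mxexp; mxgen; apply/matrixP => ? ?; rewrite !mxE; field.

Section Bounded.
Variables (C : numClosedFieldType) (N : nat).
Notation mat := 'M[C]_N.

(** A uniform bound for [0 < t <= 1], in the role of a Landau symbol. *)
Definition bnd (X : C -> mat) := exists M, forall t, 0 < t <= 1 -> forall y x, `|X t y x| <= M.

Lemma bnd_const A : bnd (fun=> A).
Proof.
exists (\sum_y \sum_x `|A y x|) => t _ y x.
rewrite (bigD1 y) //= (bigD1 x) //= -addrA lerDl addr_ge0 // ?sumr_ge0 // => i _.
by apply: sumr_ge0.
Qed.
Lemma bnd_add X Y : bnd X -> bnd Y -> bnd (fun t => X t + Y t).
Proof.
move=> [M h] [M' h']; exists (M + M') => t t01 y x; rewrite mxE.
by rewrite (le_trans (ler_normD _ _)) // lerD ?h ?h'.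
Qed.
Lemma bnd_opp X : bnd X -> bnd (fun t => - X t).
Proof. by move=> [M h]; exists M => t t01 y x; rewrite mxE normrN h. Qed.
Lemma bnd_mul X Y : bnd X -> bnd Y -> bnd (fun t => X t *m Y t).
Proof.
move=> [M h] [M' h']; exists (\sum_(i < N) (M * M')) => t t01 y x; rewrite mxE.
rewrite (le_trans (ler_norm_sum _ _ _)) //; apply: ler_sum => i _.
by rewrite normrM ler_pM ?h ?h'.
Qed.
Lemma bnd_t X : bnd X -> bnd (fun t => t *: X t).
Proof.
move=> [M h]; exists M => t t01 y x; rewrite mxE normrM -[leRHS]mul1r.
by have /andP[t0 t1] := t01; rewrite ler_pM ?h // gtr0_norm.
Qed.
Lemma bnd_scale c X : bnd X -> bnd (fun t => c *: X t).
Proof. by move=> [M h]; exists (`|c| * M) => t t01 y x; rewrite mxE normrM ler_wpM2l ?h. Qed.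
Lemma bnd_tr X : bnd X -> exists M, forall t, 0 < t <= 1 -> `|\tr (X t)| <= M.
Proof.
move=> [M h]; exists (\sum_(i < N) M) => t t01.
by rewrite (le_trans (ler_norm_sum _ _ _)) //; apply: ler_sum => i _; apply: h.
Qed.

Lemma bnd_tr_adj X M : (forall t, 0 < t <= 1 -> \tr (X t *m adjmx (X t)) <= M) -> bnd X.
Proof.
move=> h; exists (1 + M) => t t01 y x; have := h t t01; rewrite mxtrace_mulE => hM.
by apply: norm_le1D; apply: le_trans (entry_le_tr _ _ _) _; rewrite mxtrace_mulE.
Qed.

(** Stands for letting [t] tend to zero: at [t = - c / (- c + M + 1)] a negative [c] would outweigh
    the remainder. *)
Lemma small_lin (c : C) (r : C -> C) M : c \is Num.real ->
  (forall t, 0 < t <= 1 -> `|r t| <= M) -> (forall t, 0 < t <= 1 -> 0 <= c + t * r t) -> 0 <= c.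
Proof.
move=> cr hM h; rewrite real_leNgt ?real0 //; apply/negP => c0.
have M0 : 0 <= M by apply: le_trans (hM 1 _); rewrite ?ltr01 ?lexx.
have d0 : 0 < - c + M + 1 by rewrite ltr_wpDl ?ltr01 // addr_ge0 // oppr_ge0 ltW.
pose t := - c / (- c + M + 1).
have t0 : 0 < t by rewrite divr_gt0 ?oppr_gt0.
have t1 : t <= 1 by rewrite ler_pdivrMr // mul1r -addrA lerDl addr_ge0.
have t01 : 0 < t <= 1 by rewrite t0.
have : - c <= t * M.
  have hc : - c <= t * r t by rewrite -subr_ge0 opprK addrC h.
  apply: le_trans hc _; apply: le_trans (_ : `|t * r t| <= _).
    by rewrite real_ler_norm // -[t * r t](addKr c) rpredD ?rpredN // ger0_real // h.
  by rewrite normrM (gtr0_norm t0) ler_pM2l // hM.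
apply/negP; rewrite -real_ltNge ?realN //; last by apply: rpredM; [apply: gtr0_real|apply: ger0_real].
rewrite /t mulrAC ltr_pdivrMr // ltr_pM2l ?oppr_gt0 //.
by rewrite -subr_gt0 (_ : _ - M = 1 - c) ?subr_gt0 ?(lt_trans c0 ltr01) //; ring.
Qed.

End Bounded.

(** * Unitary curves from the Cayley transform *)

Section Unitary.
Variables (C : numClosedFieldType) (Q0 : finType) (N : nat) (v : 'I_N -> Q0).
Notation mat := 'M[C]_N.

Definition graded (X : mat) := forall y x, v y != v x -> X y x = 0.
Definition unitary (u : mat) := u *m adjmx u = 1%:M.
Definition gproj (i : Q0) : mat := diag_mx (\row_x (v x == i)%:R).

Lemma unitary_adj u : unitary u -> unitary (adjmx u).
Proof. by move=> /mulmx1C; rewrite /unitary adjmxK. Qed.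
Lemma unitaryM u w : unitary u -> unitary w -> unitary (u *m w).
Proof.
move=> hu hw; rewrite /unitary adjmxM mulmxA -[u *m w *m _]mulmxA.
by rewrite (hw : w *m adjmx w = _) mulmx1.
Qed.
Lemma unitary1 : unitary 1%:M. Proof. by rewrite /unitary adjmx1 mulmx1. Qed.

Lemma gradedP X : graded X <-> forall i, gproj i *m X = X *m gproj i.
Proof.
split=> [h i|h y x vyx].
  apply/matrixP => y x; rewrite /gproj mul_diag_mx mul_mx_diag !mxE.
  have [e|n] := eqVneq (v y) (v x); first by rewrite e mulrC.
  by rewrite h // mulr0 mul0r.
have := congr1 (fun A : mat => A y x) (h (v y)); rewrite /gproj mul_diag_mx mul_mx_diag !mxE eqxx mul1r.
by rewrite eq_sym (negbTE vyx) mulr0.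
Qed.
Lemma gradedM X Y : graded X -> graded Y -> graded (X *m Y).
Proof. by move=> /gradedP h /gradedP h'; apply/gradedP => i; rewrite mulmxA h -mulmxA h' mulmxA. Qed.
Lemma gradedD X Y : graded X -> graded Y -> graded (X + Y).
Proof. by move=> h h' y x n; rewrite mxE h ?h' ?addr0. Qed.
Lemma gradedN X : graded X -> graded (- X).
Proof. by move=> h y x n; rewrite mxE h ?oppr0. Qed.
Lemma gradedZ c X : graded X -> graded (c *: X).
Proof. by move=> h y x n; rewrite mxE h ?mulr0. Qed.
Lemma graded_adj X : graded X -> graded (adjmx X).
Proof. by move=> h y x n; rewrite adjmxE h 1?eq_sym // conjC0. Qed.
Lemma graded1 : graded 1%:M.
Proof. by move=> y x n; rewrite mxE; case: (y =P x) n => [->|//]; rewrite eqxx. Qed.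
Lemma graded_inv X : X \in unitmx -> graded X -> graded (invmx X).
Proof.
move=> uX /gradedP h; apply/gradedP => i.
by apply: (can_inj (mulKmx uX)); rewrite !mulmxA -h mulmxV // mul1mx -mulmxA mulmxV // mulmx1.
Qed.

Lemma adj_real (t : C) (X : mat) : t \is Num.real -> adjmx (t *: X) = t *: adjmx X.
Proof. by move=> tr; rewrite adjmxZ conj_Creal. Qed.

(** Its first-order term in [s] is [2 s X], whence the halved generator in [cayley_expansion]. *)
Definition cayley (X : mat) (s : C) : mat := invmx (1%:M - s *: X) *m (1%:M + s *: X).

Lemma cayleyP (X B : mat) (s : C) : adjmx X = - X -> graded X -> s \is Num.real ->
  let u := cayley X s in
  [/\ unitary u, graded u &
    (1%:M - s *: X) *m (u *m B *m adjmx u) *m (1%:M + s *: X) =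
    (1%:M + s *: X) *m B *m (1%:M - s *: X)].
Proof.
move=> skX gX sr; pose A := 1%:M - s *: X; pose A' := 1%:M + s *: X.
have aA : adjmx A = A' by rewrite /A adjmxB adjmx1 adj_real // skX scalerN opprK.
have aA' : adjmx A' = A by rewrite -aA adjmxK.
have AA' : A *m A' = A' *m A by rewrite /A /A'; mxring.
(* A row vector fixed by [s *: X] has squared norm equal to its own negative, because [X] is
   skew-adjoint. *)
have uA : A \in unitmx.
  rewrite -row_free_unit -kermx_eq0; apply/eqP/row_matrixP => i; rewrite row0.
  set w := row i _; have wA : w *m A = 0 by apply/sub_kermxP; apply: row_sub.
  have e1 : w = w *m (s *: X) by apply/eqP; rewrite -subr_eq0 -{1}[w]mulmx1 -mulmxBr wA.
  have e2 : \tr (w *m adjmx w) = \tr (w *m (s *: X) *m adjmx w) by rewrite -e1.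
  have e3 : \tr (w *m adjmx w) = - \tr (w *m (s *: X) *m adjmx w).
    rewrite -mulmxA -raddfN /= -mulmxN -mulNmx -scalerN -skX -adj_real // -adjmxM -e1.
    by [].
  have : \tr (w *m adjmx w) = 0.
    have : \tr (w *m adjmx w) + \tr (w *m adjmx w) = 0 by rewrite {1}e2 {1}e3 addrN.
    by rewrite -mulr2n => /eqP; rewrite mulrn_eq0 /= => /eqP.
  exact: mxtrace_adj_eq0.
have uA' : A' \in unitmx by rewrite -aA /adjmx unitmx_tr map_unitmx.
have adjV : adjmx (invmx A) = invmx A' by rewrite -aA /adjmx map_invmx trmx_inv.
rewrite /= /cayley -/A -/A' /unitary adjmxM aA' adjV; split.
- have -> : invmx A *m A' *m (A *m invmx A') = invmx A *m (A' *m A) *m invmx A' by rewrite !mulmxA.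
  by rewrite -AA' !mulmxA mulVmx // mul1mx mulmxV.
- have gs : graded (s *: X) by apply: gradedZ.
  apply: gradedM; last by apply: gradedD graded1 gs.
  by apply: graded_inv => //; apply: gradedD graded1 (gradedN gs).
- by rewrite !mulmxA mulmxV // mul1mx -!mulmxA mulVmx // mulmx1.
Qed.

Lemma unitary_norm u B : unitary u -> \tr (u *m B *m adjmx u *m adjmx (u *m B *m adjmx u)) = \tr (B *m adjmx B).
Proof.
move=> hu; have hu' := unitary_adj hu; rewrite /unitary adjmxK in hu'.
rewrite !adjmxM adjmxK !mulmxA -[_ *m adjmx u *m u]mulmxA hu' mulmx1.
by rewrite mxtrace_mulC !mulmxA hu' mul1mx.
Qed.

(** Solving for [B'] gives [B' = B + t X1], and substituting this into [X1], then the result into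
    [X2], produces the expansion; the unknown [B'] survives only in the cubic remainder. *)
Lemma cayley_relation (Y B B' : mat) t :
  (1%:M - t *: Y) *m B' *m (1%:M + t *: Y) = (1%:M + t *: Y) *m B *m (1%:M - t *: Y) ->
  let X1 := Y *m B - B *m Y + (Y *m B' - B' *m Y) + t *: (Y *m B' *m Y - Y *m B *m Y) in
  let X2 := Y *m X1 - X1 *m Y + t *: (Y *m X1 *m Y) in
  B' = B + (t *+ 2) *: (Y *m B - B *m Y)
       + (t ^+ 2 *+ 2) *: (Y *m (Y *m B - B *m Y) - (Y *m B - B *m Y) *m Y)
       + t ^+ 3 *: (Y *m X2 - X2 *m Y + Y *m X1 *m Y).
Proof.
move=> rel X1 X2.
have e1 : B' = B + t *: X1.
  move/(congr1 (fun Z => Z - ((1%:M - t *: Y) *m B' *m (1%:M + t *: Y)) + B')): rel.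
  by rewrite subrr add0r => ->; rewrite /X1; mxring.
have e2 : X1 = 2 *: (Y *m B - B *m Y) + t *: X2.
  rewrite {1}/X1 /X2; move: e1; clear; move: X1 => X1 ->; mxring.
have e3 : X2 = 2 *: (Y *m (Y *m B - B *m Y) - (Y *m B - B *m Y) *m Y) + t *: (Y *m X2 - X2 *m Y + Y *m X1 *m Y).
  rewrite {1}/X2 {1 2}e2; move: X1 X2 {e1 e2} => X1 X2; mxring.
rewrite {1}e1 {1}e2 {1}e3; move: X1 X2 {e1 e2 e3} => X1 X2; mxring.
Qed.

(* Second-order expansion of the orbit of [B] along the Cayley curve generated by [X / 2],
   read off from the defining relation of the Cayley transform, so that no inverse has to be estimated. *)
Lemma cayley_expansion (X B : mat) : adjmx X = - X -> graded X ->
  exists (u R : C -> mat), bnd R /\ forall t, 0 < t <= 1 ->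
    [/\ unitary (u t), graded (u t) &
     u t *m B *m adjmx (u t) = B + t *: (X *m B - B *m X)
       + (t ^+ 2 / 2) *: (X *m (X *m B - B *m X) - (X *m B - B *m X) *m X) + t ^+ 3 *: R t].
Proof.
move=> skX gX; pose Y := (2^-1 : C) *: X.
have r2 : (2^-1 : C) \is Num.real by rewrite rpredV realn.
have skY : adjmx Y = - Y by rewrite adj_real // skX scalerN.
have gY : graded Y by apply: gradedZ.
pose u := cayley Y; pose B' t := u t *m B *m adjmx (u t).
have ub t : 0 < t <= 1 -> unitary (u t).
  by move=> /andP[t0 _]; have [] := cayleyP B skY gY (gtr0_real t0).
have bB' : bnd B'.
  apply: (@bnd_tr_adj _ _ _ (\tr (B *m adjmx B))) => t /ub hu.
  by rewrite unitary_norm.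
pose X1 t := Y *m B - B *m Y + (Y *m B' t - B' t *m Y) + t *: (Y *m B' t *m Y - Y *m B *m Y).
pose X2 t := Y *m X1 t - X1 t *m Y + t *: (Y *m X1 t *m Y).
have bX1 : bnd X1.
  by repeat first [exact: bB'|exact: bnd_const|apply: bnd_add|apply: bnd_opp|apply: bnd_t|apply: bnd_mul].
have bX2 : bnd X2.
  by repeat first [exact: bX1|exact: bnd_const|apply: bnd_add|apply: bnd_opp|apply: bnd_t|apply: bnd_mul].
exists u, (fun t => Y *m X2 t - X2 t *m Y + Y *m X1 t *m Y); split.
  by repeat first [exact: bX2|exact: bX1|exact: bnd_const|apply: bnd_add|apply: bnd_opp|apply: bnd_t|apply: bnd_mul].
move=> t t01; have /andP[t0 _] := t01.
have [h1 h2 h3] := cayleyP B skY gY (gtr0_real t0); split=> //.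
rewrite (cayley_relation h3) -/(B' t) -/(X1 t) -/(X2 t); congr (_ + _ + _ + _).
  by rewrite /Y -scalemxAl -scalemxAr -scalerBr scalerA; congr (_ *: _); field.
by rewrite /Y; clear; mxfield.
Qed.

End Unitary.

Section Moment.
Variables (C : numClosedFieldType) (Q0 Ar : finType) (src tgt : Ar -> Q0) (N : nat) (v : 'I_N -> Q0).
Notation mat := 'M[C]_N.
Implicit Types F H : Ar -> mat.

Definition isrep F := forall b y x, ~~ ((v x == src b) && (v y == tgt b)) -> F b y x = 0.
Definition dmu F H := \sum_b (H b *m adjmx (F b) + F b *m adjmx (H b) - adjmx (H b) *m F b - adjmx (F b) *m H b).
Definition nrm2 F : C := \sum_b \tr (F b *m adjmx (F b)).
Definition cnj (u : mat) F b := u *m F b *m adjmx u.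
Definition comm (X Y : mat) := X *m Y - Y *m X.

Lemma isrep_mskA F : isrep F -> mskA src tgt v F =1 F.
Proof. by move=> h b; apply/matrixP => y x; rewrite mxE; case: ifPn => // /h. Qed.
Lemma isrepD F H t : isrep F -> isrep H -> isrep (fun b => F b + t *: H b).
Proof. by move=> h h' b y x n; rewrite !mxE h // h' // mulr0 addr0. Qed.
Lemma isrepZ F c : isrep F -> isrep (fun b => c *: F b).
Proof. by move=> h b y x n; rewrite !mxE h // mulr0. Qed.
Lemma isrep_mul X Y F : graded v X -> graded v Y -> isrep F -> isrep (fun b => X *m F b *m Y).
Proof.
move=> gX gY hF b y x n; rewrite mxE big1 // => z _.
have [vz|/gY ->] := eqVneq (v z) (v x); last by rewrite mulr0.
rewrite mxE big1 ?mul0r // => w _.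
have [vw|/gX ->] := eqVneq (v y) (v w); last by rewrite mul0r.
by rewrite hF ?mulr0 // vz -vw.
Qed.
Lemma isrep_cnj u F : graded v u -> isrep F -> isrep (cnj u F).
Proof. by move=> gu; apply: isrep_mul => //; apply: graded_adj. Qed.

Lemma graded_sum (I : finType) (X : I -> mat) : (forall i, graded v (X i)) -> graded v (\sum_i X i).
Proof. by move=> h y x n; rewrite summxE big1 // => i _; apply: h. Qed.
Lemma isrep_mul_adj F H b : isrep F -> isrep H -> graded v (F b *m adjmx (H b)).
Proof.
move=> hF hH y x n; rewrite mxE big1 // => z _; rewrite adjmxE.
have [/andP[/eqP vz /eqP vy]|/hF ->] := boolP ((v z == src b) && (v y == tgt b)); last by rewrite mul0r.
by rewrite hH ?conjC0 ?mulr0 // -vy negb_and [v x == _]eq_sym n orbT.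
Qed.
Lemma isrep_adj_mul F H b : isrep F -> isrep H -> graded v (adjmx (F b) *m H b).
Proof.
move=> hF hH y x n; rewrite mxE big1 // => z _; rewrite adjmxE.
have [/andP[/eqP vy /eqP vz]|/hF ->] := boolP ((v y == src b) && (v z == tgt b)); last by rewrite conjC0 mul0r.
by rewrite hH ?mulr0 // -vy negb_and [v x == _]eq_sym n.
Qed.
Lemma graded_mubig F : isrep F -> graded v (mubig F).
Proof.
move=> hF; apply: graded_sum => b; apply: gradedD; first exact: isrep_mul_adj.
by apply: gradedN; apply: isrep_adj_mul.
Qed.

Lemma mubig_herm F : adjmx (mubig F) = mubig F.
Proof. by rewrite /mubig adjmx_sum; apply: eq_bigr => b _; rewrite adjmxB !adjmxM !adjmxK. Qed.
Lemma dmu_herm F H : adjmx (dmu F H) = dmu F H.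
Proof.
rewrite /dmu adjmx_sum; apply: eq_bigr => b _; rewrite !(adjmxB, adjmxD) !adjmxM !adjmxK; mxring.
Qed.
Lemma mubig_line F H t : t \is Num.real ->
  mubig (fun b => F b + t *: H b) = mubig F + t *: dmu F H + t ^+ 2 *: mubig H.
Proof.
move=> tr; rewrite /mubig /dmu !scaler_sumr -!big_split; apply: eq_bigr => b _ /=.
by rewrite adjmxD adj_real //; mxring.
Qed.
Lemma unitaryK (u : mat) : unitary u -> adjmx u *m u = 1%:M.
Proof. by move=> /mulmx1C. Qed.
Lemma mubig_cnj u F : unitary u -> mubig (cnj u F) = u *m mubig F *m adjmx u.
Proof.
move=> /unitaryK hu; rewrite /mubig mulmx_sumr mulmx_suml; apply: eq_bigr => b _.
rewrite /cnj !adjmxM !adjmxK mulmxBr mulmxBl !mulmxA; congr (_ - _).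
  by rewrite -[u *m F b *m adjmx u *m u]mulmxA hu mulmx1.
by rewrite -[u *m _ *m adjmx u *m u]mulmxA hu mulmx1.
Qed.
Lemma nrm2_cnj u F : unitary u -> nrm2 (cnj u F) = nrm2 F.
Proof. by move=> hu; apply: eq_bigr => b _; apply: unitary_norm. Qed.
Lemma nrm2_ge0 F : 0 <= nrm2 F.
Proof. by apply: sumr_ge0 => b _; apply: mxtrace_adj_ge0. Qed.
Lemma nrm2_eq0 F : nrm2 F = 0 -> forall b, F b = 0.
Proof.
move=> /eqP; rewrite psumr_eq0 => [/allP h b|b _]; last exact: mxtrace_adj_ge0.
by apply: mxtrace_adj_eq0; apply/eqP; apply: h; rewrite mem_index_enum.
Qed.
Lemma nrm2_line F H t : t \is Num.real -> nrm2 (fun b => F b + t *: H b) =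
  nrm2 F + t * (\sum_b \tr (H b *m adjmx (F b) + F b *m adjmx (H b))) + t ^+ 2 * nrm2 H.
Proof.
move=> tr; rewrite /nrm2 !mulr_sumr -!big_split; apply: eq_bigr => b _ /=.
rewrite -!mxtraceZ -!mxtraceD; congr (\tr _); rewrite adjmxD adj_real //; mxring.
Qed.

Lemma tr_herm_real (X Y : mat) : adjmx X = X -> adjmx Y = Y -> \tr (X *m Y) \is Num.real.
Proof. by move=> hX hY; apply/CrealP; rewrite -mxtrace_adj adjmxM hX hY mxtrace_mulC. Qed.
Lemma comm_herm X B : adjmx X = - X -> adjmx B = B -> adjmx (comm X B) = comm X B.
Proof. by move=> hX hB; rewrite /comm adjmxB !adjmxM hX hB; mxring. Qed.
Lemma comm_skew X B : adjmx X = X -> adjmx B = B -> adjmx (comm X B) = - comm X B.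
Proof. by move=> hX hB; rewrite /comm adjmxB !adjmxM hX hB; mxring. Qed.

Variable B : mat.
Hypothesis hB : adjmx B = B.

Definition Phi (eps : C) F (u : mat) := \tr ((mubig F - u *m B *m adjmx u) *m (mubig F - u *m B *m adjmx u)) + eps * nrm2 F.
(** A minimum of [Phi] normalised to the unitary [1]; [is_min_of] reaches this form by
    conjugation. *)
Definition is_min eps F := isrep F /\ forall F' u', isrep F' -> unitary u' -> graded v u' -> Phi eps F 1%:M <= Phi eps F' u'.

Lemma Phi_cnj eps w F u : unitary w -> Phi eps (cnj w F) (w *m u) = Phi eps F u.
Proof.
move=> hw; rewrite /Phi nrm2_cnj // mubig_cnj // adjmxM; congr (_ + _).
have -> : w *m mubig F *m adjmx w - w *m u *m B *m (adjmx u *m adjmx w)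
   = w *m (mubig F - u *m B *m adjmx u) *m adjmx w by mxring.
move: (mubig F - _) => X; rewrite !mulmxA -[w *m X *m adjmx w *m w]mulmxA (unitaryK hw) mulmx1.
by rewrite mxtrace_mulC !mulmxA (unitaryK hw) mul1mx.
Qed.

Lemma is_min_of eps F u : isrep F -> unitary u -> graded v u ->
  (forall F' u', isrep F' -> unitary u' -> graded v u' -> Phi eps F u <= Phi eps F' u') ->
  is_min eps (cnj (adjmx u) F).
Proof.
move=> rF hu gu h; split; first by apply: isrep_cnj => //; apply: graded_adj.
move=> F' u' rF' hu' gu'; have hua := unitary_adj hu.
by rewrite -(unitaryK hu) Phi_cnj // h.
Qed.

Section Variation.
Variables (eps : C) (F H : Ar -> mat) (X : mat).
Hypotheses (eps0 : 0 <= eps) (minF : is_min eps F) (rH : isrep H) (skX : adjmx X = - X) (gX : graded v X).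
Let b := mubig F - B.
Let hb : adjmx b = b. Proof. by rewrite /b adjmxB mubig_herm hB. Qed.
Let D := dmu F H - comm X B.
Let E := mubig H - 2^-1 *: comm X (comm X B).

Lemma curve : exists R : C -> mat, bnd R /\ forall t, 0 < t <= 1 ->
  \tr (b *m b) + eps * nrm2 F <=
  \tr ((b + t *: D + t ^+ 2 *: (E + t *: R t)) *m (b + t *: D + t ^+ 2 *: (E + t *: R t)))
    + eps * nrm2 (fun c => F c + t *: H c).
Proof.
have [u [R [bR hR]]] := cayley_expansion B skX gX.
exists (fun t => - R t); split; first exact: bnd_opp.
move=> t t01; have [uu gu e] := hR t t01; have /andP[t0 _] := t01.
have tr : t \is Num.real := gtr0_real t0.
case: minF => rF /(_ (fun c => F c + t *: H c) (u t) (isrepD _ rF rH) uu gu).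
rewrite /Phi adjmx1 mul1mx mulmx1 e mubig_line //.
suff -> : mubig F + t *: dmu F H + t ^+ 2 *: mubig H -
 (B + t *: (X *m B - B *m X) + (t ^+ 2 / 2) *: (X *m (X *m B - B *m X) - (X *m B - B *m X) *m X) +
  t ^+ 3 *: R t) = b + t *: D + t ^+ 2 *: (E + t *: - R t) by [].
rewrite /b /D /E /comm; move: (mubig F) (dmu F H) (mubig H) (R t) => m1 m2 m3 m4; clear; mxring.
Qed.

Lemma trD : \tr (b *m D) \is Num.real.
Proof. by apply: tr_herm_real => //; rewrite /D adjmxB dmu_herm comm_herm. Qed.

Lemma first_variation :
  0 <= 2 * \tr (b *m D) + eps * \sum_c \tr (H c *m adjmx (F c) + F c *m adjmx (H c)).
Proof.
have [R [bR hR]] := curve.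
pose S t := E + t *: R t.
have bS : bnd S by apply: bnd_add (bnd_const E) (bnd_t bR).
pose T t := D *m D + 2 *: (b *m S t) + t *: (2 *: (D *m S t) + t *: (S t *m S t)) .
have bT : bnd T.
  by repeat first [exact: bS|exact: bnd_const|apply: bnd_add|apply: bnd_t|apply: bnd_scale|apply: bnd_mul].
have [M hM] := bnd_tr bT.
apply: (@small_lin _ _ (fun t => \tr (T t) + eps * nrm2 H) (M + eps * nrm2 H)).
- apply: rpredD; first by rewrite rpredM ?realn // trD.
  apply: rpredM; first exact: ger0_real.
  apply: rpred_sum => c _; apply/CrealP; rewrite -mxtrace_adj adjmxD !adjmxM !adjmxK.
  by rewrite addrC.
- move=> t t01; apply: le_trans (ler_normD _ _) _; apply: lerD; first exact: hM.
  by rewrite ger0_norm // mulr_ge0 // nrm2_ge0.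
move=> t t01; have /andP[t0 _] := t01; have := hR t t01; rewrite nrm2_line ?gtr0_real //.
rewrite -subr_ge0 => h; rewrite -(pmulr_rge0 _ t0); congr (0 <= _): h.
rewrite -/(S t) /T.
have -> : (b + t *: D + t ^+ 2 *: S t) *m (b + t *: D + t ^+ 2 *: S t) = b *m b + t *: (b *m D) + t *: (D *m b)
   + t ^+ 2 *: (b *m S t) + t ^+ 2 *: (S t *m b) + t ^+ 2 *: (D *m D) + t ^+ 3 *: (D *m S t)
   + t ^+ 3 *: (S t *m D) + t ^+ 4 *: (S t *m S t).
  by move: (S t) => Z; move: b D => b' D'; clear; mxring.
rewrite !mxtraceD !mxtraceZ !mxtraceD !mxtraceZ [\tr (D *m b)]mxtrace_mulC [\tr (S t *m b)]mxtrace_mulC.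
rewrite [\tr (S t *m D)]mxtrace_mulC; ring.
Qed.

(** When [H] and [X] are matched so that [D = 0], the leading term of the increase of [Phi] is
    [2 t^2 tr (b E)]. *)
Lemma second_variation : eps = 0 -> dmu F H = comm X B -> 0 <= \tr (b *m E).
Proof.
move=> e0 D0; have [R [bR hR]] := curve.
pose S t := E + t *: R t.
have bS : bnd S by apply: bnd_add (bnd_const E) (bnd_t bR).
pose T t := 2 *: (b *m R t) + t *: (S t *m S t) .
have bT : bnd T.
  by repeat first [exact: bS|exact: bR|exact: bnd_const|apply: bnd_add|apply: bnd_t|apply: bnd_scale|apply: bnd_mul].
have [M hM] := bnd_tr bT.
suff : 0 <= 2 * \tr (b *m E) by rewrite pmulr_rge0 ?ltr0n.
apply: (@small_lin _ _ (fun t => \tr (T t)) M) => //.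
  rewrite rpredM ?realn // tr_herm_real // /E adjmxB mubig_herm adj_real ?rpredV ?realn //.
  by rewrite [adjmx (comm _ _)]comm_herm // comm_herm.
move=> t t01; have /andP[t0 _] := t01; have := hR t t01; rewrite e0 !mul0r !addr0.
have -> : D = 0 by rewrite /D D0 subrr.
rewrite -subr_ge0 => h; rewrite -(pmulr_rge0 _ (exprn_gt0 2 t0)); congr (0 <= _): h.
rewrite /T scaler0 addr0 -/(S t).
have -> : (b + t ^+ 2 *: S t) *m (b + t ^+ 2 *: S t) = b *m b
   + t ^+ 2 *: (b *m S t) + t ^+ 2 *: (S t *m b) + t ^+ 4 *: (S t *m S t).
  by move: (S t) => Z; move: b => b'; clear; mxring.
rewrite !mxtraceD !mxtraceZ [\tr (S t *m b)]mxtrace_mulC.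
have -> : \tr (b *m S t) = \tr (b *m E) + t * \tr (b *m R t).
  by rewrite /S mulmxDr mxtraceD -scalemxAr mxtraceZ.
ring.
Qed.

End Variation.
End Moment.


(** * Existence of a global minimum *)

Section Diagonal.
Variable C : numClosedFieldType.

Lemma norm_Re_le (c : C) : `|'Re c| <= `|c|.
Proof.
rewrite -(@ler_pXn2r _ 2) ?nnegrE ?normr_ge0 // real_normK ?Creal_Re // normC2_Re_Im.
by rewrite lerDl real_exprn_even_ge0 ?Creal_Im.
Qed.
Lemma norm_Im_le (c : C) : `|'Im c| <= `|c|.
Proof.
rewrite -(@ler_pXn2r _ 2) ?nnegrE ?normr_ge0 // real_normK ?Creal_Im // normC2_Re_Im.
by rewrite lerDr real_exprn_even_ge0 ?Creal_Re.
Qed.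

Lemma diag_adj n (r : 'rV[C]_n) : adjmx (diag_mx r) = diag_mx (map_mx Num.conj r).
Proof.
apply/matrixP => y x; rewrite adjmxE !mxE eq_sym; case: eqP => [->|_]; rewrite ?mulr1n //.
by rewrite !mulr0n rmorph0.
Qed.

(** [A + i B] is normal, and the real and imaginary parts of its eigenvalues are the eigenvalues of
    [A] and [B]. *)
Lemma commuting_diag n (A B : 'M[C]_n) : adjmx A = A -> adjmx B = B -> A *m B = B *m A ->
  exists (P : 'M[C]_n) (a b : 'I_n -> C), [/\ unitary P, forall i, a i \is Num.real, forall i, b i \is Num.real,
    P *m A *m adjmx P = diag_mx (\row_i a i) & P *m B *m adjmx P = diag_mx (\row_i b i)].
Proof.
move=> hA hB AB; pose M := A + 'i *: B.
have aM : adjmx M = A - 'i *: B by rewrite /M adjmxD adjmxZ hA hB conjCi scaleNr.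
have nM : M \is normalmx.
  apply/normalmxP; have -> : (M ^t*)%sesqui = adjmx M by rewrite /adjmx map_trmx.
  rewrite aM /M.
  rewrite !(mulmxDl, mulmxDr) !(mulmxN, mulNmx) -!scalemxAl -!scalemxAr AB.
  by mxring.
have /orthomx_spectralP := nM; set P := spectralmx M; set sp := spectral_diag M => eM.
have uP : unitary P.
  by have /unitarymxP := spectral_unitarymx M; rewrite -/P /unitary /adjmx map_trmx.
have iP : P \in unitmx := proj1 (mulmx1_unit uP).
have e1 : P *m M *m adjmx P = diag_mx sp.
  have -> : adjmx P = invmx P.
    by apply: (can_inj (mulKmx iP)); rewrite mulmxV.
  by rewrite {1}eM !mulmxA mulmxV // mul1mx -mulmxA mulmxV // mulmx1.
have e2 : P *m adjmx M *m adjmx P = diag_mx (map_mx Num.conj sp).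
  by rewrite -diag_adj -e1 !adjmxM adjmxK !mulmxA.
exists P, (fun i => 'Re (sp 0 i)), (fun i => 'Im (sp 0 i)); split=> //.
- have -> : A = 2^-1 *: (M + adjmx M) by rewrite aM /M; clear; apply/matrixP => y x; rewrite !mxE; field.
  rewrite -scalemxAr -scalemxAl mulmxDr mulmxDl e1 e2; apply/matrixP => y x; rewrite !mxE.
  by case: eqP => [->|_]; rewrite ?mulr1n ?mulr0n ?addr0 ?mulr0 // ReE mulrC.
- have -> : B = (2^-1 * - 'i) *: (M - adjmx M).
    rewrite aM /M; apply/matrixP => y x; rewrite !mxE.
    have := sqrCi C; move: ('i : C) => i0 hi.
    have -> : 2^-1 * - i0 * (A y x + i0 * B y x - (A y x - i0 * B y x)) = - i0 ^+ 2 * B y x by field.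
    by rewrite hi opprK mul1r.
  rewrite -scalemxAr -scalemxAl mulmxBr mulmxBl e1 e2; apply/matrixP => y x; rewrite !mxE.
  case: eqP => [->|_]; rewrite ?mulr1n ?mulr0n ?subr0 ?mulr0 // ImE.
  by field.
Qed.

End Diagonal.

Section Minimum.
Variables (C : numClosedFieldType) (Q0 Ar : finType) (src tgt : Ar -> Q0) (N : nat) (v : 'I_N -> Q0).
Notation mat := 'M[C]_N.
Implicit Types F H : Ar -> mat.

Lemma tr_diag_mubig (p : 'I_N -> C) F :
  \tr (diag_mx (\row_y p y) *m mubig F) = \sum_b \sum_y \sum_x (p y - p x) * `|F b y x| ^+ 2.
Proof.
rewrite /mubig mulmx_sumr raddf_sum; apply: eq_bigr => b _ /=; rewrite mulmxBr raddfB /= !mulmxA.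
rewrite !mxtrace_mulE; under [RHS]eq_bigr do (under eq_bigr do rewrite mulrBl; rewrite sumrB).
rewrite sumrB; congr (_ - _).
  by apply: eq_bigr => y _; apply: eq_bigr => x _; rewrite mul_diag_mx !mxE normCK mulrA.
rewrite exchange_big; apply: eq_bigr => y _; apply: eq_bigr => x _.
by rewrite mul_diag_mx !mxE normCK [_ * _^*]mulrC mulrA.
Qed.

Lemma nrm2E F : nrm2 F = \sum_b \sum_y \sum_x `|F b y x| ^+ 2.
Proof.
apply: eq_bigr => b _; rewrite mxtrace_mulE; apply: eq_bigr => y _; apply: eq_bigr => x _.
by rewrite adjmxE normCK.
Qed.

Lemma entry_le_nrm2 F b y x : `|F b y x| ^+ 2 <= nrm2 F.
Proof.
apply: le_trans (entry_le_tr _ _ _) _; rewrite /nrm2 (bigD1 b) //= lerDl.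
by apply: sumr_ge0 => c _; apply: mxtrace_adj_ge0.
Qed.

(* If [F] lowers the eigenvalues of [beta] by [kappa], its entries are seen by the traces of
   [mubig F] against the spectral projections of [beta]. *)
Lemma nrm2_bound F (beta : mat) kappa : adjmx beta = beta -> 0 < kappa ->
  (forall b, comm beta (F b) = - kappa *: F b) ->
  nrm2 F <= (1 + \tr (mubig F *m mubig F)) *+ N *+ N.
Proof.
move=> hb k0 hF.
have [P [d [_ [uP dr _ eP _]]]] := commuting_diag hb hb erefl.
have uPK := unitaryK uP.
rewrite -(nrm2_cnj F uP); pose G := cnj P F.
have -> : \tr (mubig F *m mubig F) = \tr (mubig G *m mubig G).
  rewrite /G mubig_cnj // !mulmxA -[_ *m adjmx P *m P]mulmxA uPK mulmx1.
  by rewrite [RHS]mxtrace_mulC !mulmxA uPK mul1mx.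
have hG b y x : G b y x != 0 -> d y = d x - kappa.
  have := congr1 (fun X => P *m X *m adjmx P) (hF b); rewrite /= /comm mulmxBr mulmxBl.
  have -> : P *m (beta *m F b) *m adjmx P = diag_mx (\row_i d i) *m G b.
    by rewrite -eP /G /cnj !mulmxA -[_ *m adjmx P *m P]mulmxA uPK mulmx1.
  have -> : P *m (F b *m beta) *m adjmx P = G b *m diag_mx (\row_i d i).
    by rewrite -eP /G /cnj !mulmxA -[_ *m adjmx P *m P]mulmxA uPK mulmx1.
  rewrite -scalemxAr -scalemxAl -/(cnj P F b) -/(G b); move: (G b) => g /matrixP /(_ y x).
  rewrite mul_diag_mx mul_mx_diag !mxE => e n0; apply/eqP; rewrite -subr_eq0 -(mulIr_eq0 _ (mulIf n0)).
  by rewrite (_ : _ * _ = d y * g y x - g y x * d x - - kappa * g y x); [rewrite e subrr|ring].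
(* On a nonzero entry [d y < d x], so the threshold [d z] with [z = y] separates the two indices,
   and no threshold contributes negatively. *)
have main : nrm2 G <= \sum_z \tr (diag_mx (\row_y (d y <= d z)%R%:R) *m mubig G).
  under eq_bigr do rewrite tr_diag_mubig.
  rewrite [leRHS]exchange_big nrm2E; apply: ler_sum => b _; rewrite [leRHS]exchange_big; apply: ler_sum => y _.
  rewrite [leRHS]exchange_big; apply: ler_sum => x _ /=; rewrite -mulr_suml.
  have [->|n0] := eqVneq (G b y x) 0; first by rewrite normr0 expr0n mulr0.
  rewrite -[leLHS]mul1r; apply: ler_wpM2r; first exact: exprn_ge0.
  have dxy : d y < d x by rewrite (hG _ _ _ n0) ltrBlDr ltrDl.
  rewrite (bigD1 y) //= lexx (_ : d x <= d y = false) ?subr0; last first.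
    by apply/negbTE; rewrite -real_ltNge.
  rewrite lerDl; apply: sumr_ge0 => z _; rewrite subr_ge0 ler_nat.
  by case: (boolP (d x <= d z)) => // /(le_trans (ltW dxy)) ->.
apply: le_trans main _.
have -> : (1 + \tr (mubig G *m mubig G)) *+ N *+ N = \sum_(z < N) \sum_(y < N) (1 + \tr (mubig G *m mubig G)).
  by rewrite !sumr_const card_ord.
have mr y : mubig G y y \is Num.real.
  by apply/CrealP; have := adjmxE (mubig G) y y; rewrite mubig_herm => <-.
apply: ler_sum => z _; rewrite /mxtrace; apply: ler_sum => y _; rewrite mul_diag_mx !mxE.
apply: le_trans (_ : `|mubig G y y| <= _).
  by case: (d y <= d z); rewrite ?mul1r ?mul0r // real_ler_norm.
by apply: norm_le1D; have := entry_le_tr (mubig G) y y; rewrite mubig_herm.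
Qed.

Lemma tr_dmu (beta : mat) F H : adjmx beta = beta -> \tr (beta *m dmu F H) =
  \sum_b \tr (H b *m adjmx (comm beta (F b)) + comm beta (F b) *m adjmx (H b)).
Proof.
move=> hb; rewrite /dmu mulmx_sumr raddf_sum; apply: eq_bigr => b _ /=.
rewrite /comm adjmxB !adjmxM hb !(mulmxDr, mulmxDl, mulmxN, mulNmx) !(mxtraceD, raddfN) /= !mulmxA.
rewrite [\tr (beta *m H b *m _)]mxtrace_mulC [\tr (beta *m adjmx (F b) *m H b)]mxtrace_mulC.
rewrite [\tr (beta *m adjmx (H b) *m F b)]mxtrace_mulC !mulmxA.
rewrite [\tr (H b *m adjmx (F b) *m beta)]mxtrace_mulC !mulmxA [\tr (_ *m H b)]mxtrace_mulC !mulmxA.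
rewrite [\tr (F b *m beta *m _)]mxtrace_mulC mulmxA.
rewrite ?[\tr (H b *m adjmx (F b) *m beta)]mxtrace_mulC ?mulmxA; ring.
Qed.

(** [K] is, up to normalisation, the gradient of [Phi] in [F]; the first variation along [- K] reads
    [0 <= - 2 |K|^2]. *)
Lemma is_min_comm (B : mat) eps F : adjmx B = B -> graded v B -> 0 <= eps -> is_min src tgt v B eps F ->
  forall b, comm (mubig F - B) (F b) = - (eps / 2) *: F b.
Proof.
move=> hB gB e0 minF b; set beta := mubig F - B.
have hb : adjmx beta = beta by rewrite /beta adjmxB mubig_herm hB.
have rF := proj1 minF.
have gb : graded v beta by apply: gradedD; [apply: graded_mubig rF|apply: gradedN].
pose K c := 2 *: comm beta (F c) + eps *: F c.
have er : eps \is Num.real := ger0_real e0.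
have rK : isrep src tgt v K.
  have r1 : isrep src tgt v (fun c => beta *m F c *m 1%:M) by apply: isrep_mul rF => //; apply: graded1.
  have r2 : isrep src tgt v (fun c => 1%:M *m F c *m beta) by apply: isrep_mul rF => //; apply: graded1.
  move=> c y x n; have := r1 c y x n; have := r2 c y x n; rewrite mulmx1 mul1mx => e2 e1.
  move: e1 e2; rewrite /K /comm; move: (beta *m F c) (F c *m beta) => X1 X2 e1 e2.
  rewrite !mxE e1 e2 rF //; ring.
have := first_variation hB e0 minF (isrepZ (-1) rK) (X := 0) _ _.
rewrite adjmx0 oppr0 => /(_ erefl) h.
have {h} := h (fun y x _ => mxE _ _ _ _).
rewrite /comm mul0mx mulmx0 subrr subr0 -/beta tr_dmu // mulr_sumr mulr_sumr -big_split /=.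
have -> : \sum_c (2 * \tr (-1 *: K c *m adjmx (comm beta (F c)) + comm beta (F c) *m adjmx (-1 *: K c)) +
      eps * \tr (-1 *: K c *m adjmx (F c) + F c *m adjmx (-1 *: K c))) = - (nrm2 K *+ 2).
  rewrite /nrm2 -sumrMnl -sumrN; apply: eq_bigr => c _.
  rewrite -!mxtraceZ -mxtraceD.
  have -> : 2 *: (-1 *: K c *m adjmx (comm beta (F c)) + comm beta (F c) *m adjmx (-1 *: K c)) +
      eps *: (-1 *: K c *m adjmx (F c) + F c *m adjmx (-1 *: K c)) = - (K c *m adjmx (K c)) - K c *m adjmx (K c).
    have aK : adjmx (-1 *: K c) = - adjmx (K c) by rewrite adj_real ?scaleN1r // realN real1.
    have aK' : adjmx (K c) = 2 *: adjmx (comm beta (F c)) + eps *: adjmx (F c).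
      by rewrite /K adjmxD !adj_real ?realn.
    rewrite aK aK' /K; move: (comm beta (F c)) => G.
    by mxring.
  by rewrite raddfB /= raddfN /=; ring.
rewrite oppr_ge0 pmulrn_lle0 // => h.
have /nrm2_eq0 /(_ b) K0 : nrm2 K = 0 by apply/le_anti; rewrite h nrm2_ge0.
rewrite -/(comm beta (F b)); have -> : comm beta (F b) = 2^-1 *: (K b - eps *: F b).
  by rewrite /K addrK scalerA mulVf ?pnatr_eq0 // scale1r.
by rewrite K0 sub0r scalerN scalerA scaleNr mulrC.
Qed.

Variable B : mat.
Hypothesis hB : adjmx B = B.
Hypothesis gB : graded v B.

Definition inbox (M : C) F (u : mat) :=
  (forall b y x, `|'Re (F b y x)| <= M /\ `|'Im (F b y x)| <= M) /\
  (forall y x, `|'Re (u y x)| <= M /\ `|'Im (u y x)| <= M).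

Lemma Phi_real eps F u : eps \is Num.real -> Phi B eps F u \is Num.real.
Proof.
move=> er; apply: rpredD.
  by apply: tr_herm_real; rewrite adjmxB mubig_herm !adjmxM adjmxK hB mulmxA.
by apply: rpredM => //; apply: ger0_real; apply: nrm2_ge0.
Qed.

(** Being a representation, unitary and graded are polynomial conditions on entries and their
    conjugates, so [complex_minimum] applies. *)
Lemma box_min eps M : eps \is Num.real -> 1 <= M -> exists F u,
  [/\ isrep src tgt v F, unitary u, graded v u, inbox M F u & forall F' u',
    isrep src tgt v F' -> unitary u' -> graded v u' -> inbox M F' u' -> Phi B eps F u <= Phi B eps F' u'].
Proof.
move=> er M1; pose Z := (Ar * 'I_N * 'I_N)%type; pose P := ('I_N * 'I_N)%type; pose W := (Z + P)%type.
pose Fm (w : W + W -> C) b : mat := \matrix_(y, x) w (inl (inl (b, y, x))).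
pose Gm (w : W + W -> C) b : mat := \matrix_(y, x) w (inr (inl (b, x, y))).
pose Um (w : W + W -> C) : mat := \matrix_(y, x) w (inl (inr (y, x))).
pose Vm (w : W + W -> C) : mat := \matrix_(y, x) w (inr (inr (x, y))).
have pF b : polymx (fun w => Fm w b).
  by move=> y x; apply: (polyfun_ext _ (polyfun_var C (inl (inl (b, y, x)) : W + W))) => w; rewrite mxE.
have pG b : polymx (fun w => Gm w b).
  by move=> y x; apply: (polyfun_ext _ (polyfun_var C (inr (inl (b, x, y)) : W + W))) => w; rewrite mxE.
have pU : polymx Um.
  by move=> y x; apply: (polyfun_ext _ (polyfun_var C (inl (inr (y, x)) : W + W))) => w; rewrite mxE.
have pV : polymx Vm.
  by move=> y x; apply: (polyfun_ext _ (polyfun_var C (inr (inr (x, y)) : W + W))) => w; rewrite mxE.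
pose bet (w : W + W -> C) : mat := \sum_b (Fm w b *m Gm w b - Gm w b *m Fm w b) - Um w *m B *m Vm w.
have pb : polymx bet.
  apply: polymx_add; last first.
    by apply: polymx_opp; apply: polymx_mul => //; apply: polymx_mul => //; apply: polymx_const.
  move=> y x; apply: (@polyfun_ext _ _ (fun w => \sum_b (Fm w b *m Gm w b - Gm w b *m Fm w b) y x)).
    by move=> w; rewrite summxE.
  apply: polyfun_sum => b _; apply: polymx_add; first exact: polymx_mul.
  by apply: polymx_opp; apply: polymx_mul.
have ptr (X : (W + W -> C) -> mat) : polymx X -> polyfun (fun w => \tr (X w)).
  by move=> pX; apply: polyfun_sum => i _; apply: pX.
pose g (w : W + W -> C) := \tr (bet w *m bet w) + eps * \sum_b \tr (Fm w b *m Gm w b).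
have pg : polyfun g.
  apply: polyfun_add; first by apply: ptr; apply: polymx_mul.
  apply: polyfun_mul; first exact: polyfun_const.
  by apply: polyfun_sum => b _; apply: ptr; apply: polymx_mul.
pose q (i : Z + P + P) (w : W + W -> C) : C := match i with
  | inl (inl z) => if (v z.2 == src z.1.1) && (v z.1.2 == tgt z.1.1) then 0 else w (inl (inl z))
  | inl (inr p) => if v p.1 == v p.2 then 0 else w (inl (inr p))
  | inr p => (Um w *m Vm w - 1%:M) p.1 p.2 end.
have pq i : polyfun (q i).
  case: i => [[z|p]|p] /=.
  - case E: ((v z.2 == src z.1.1) && (v z.1.2 == tgt z.1.1)).
      by apply: (polyfun_ext _ (polyfun_const (W + W)%type (0 : C))) => w; rewrite /= E.
    by apply: (polyfun_ext _ (polyfun_var C (inl (inl z) : W + W))) => w; rewrite /= E.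
  - case E: (v p.1 == v p.2).
      by apply: (polyfun_ext _ (polyfun_const (W + W)%type (0 : C))) => w; rewrite /= E.
    by apply: (polyfun_ext _ (polyfun_var C (inl (inr p) : W + W))) => w; rewrite /= E.
  - by apply: polymx_add; [apply: polymx_mul|apply: polymx_opp; apply: polymx_const].
pose wF (w : W -> C) b : mat := \matrix_(y, x) w (inl (b, y, x)).
pose wU (w : W -> C) : mat := \matrix_(y, x) w (inr (y, x)).
have eF w b : Fm (cc w) b = wF w b by apply/matrixP => y x; rewrite !mxE.
have eG w b : Gm (cc w) b = adjmx (wF w b) by apply/matrixP => y x; rewrite adjmxE !mxE.
have eU w : Um (cc w) = wU w by apply/matrixP => y x; rewrite !mxE.
have eV w : Vm (cc w) = adjmx (wU w) by apply/matrixP => y x; rewrite adjmxE !mxE.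
have gE w : g (cc w) = Phi B eps (wF w) (wU w).
  rewrite /g /Phi /nrm2 /bet /mubig eU eV; congr (\tr (_ *m _) + eps * _); try congr (_ - _);
    by apply: eq_bigr => b _; rewrite eF eG.
pose S w := (forall i, q i (cc w) = 0) /\ forall z, `|'Re (w z)| <= M /\ `|'Im (w z)| <= M.
have SP w : S w <-> [/\ isrep src tgt v (wF w), unitary (wU w), graded v (wU w) & inbox M (wF w) (wU w)].
  split=> [[h1 h2]|[rF uU gU [bF bU]]]; split.
  - by move=> b y x n; have := h1 (inl (inl (b, y, x))); rewrite /= (negbTE n) mxE.
  - apply/matrixP => y x; have := h1 (inr (y, x)); rewrite /= eU eV mxE [X in _ + X]mxE => /eqP.
    by rewrite subr_eq0 => /eqP.
  - by move=> y x n; have := h1 (inl (inr (y, x))); rewrite /= (negbTE n) mxE.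
  - by split=> *; rewrite mxE; apply: h2.
  - case=> [[[[b y] x]|[y x]]|[y x]] /=.
    + by case: ifPn => // /rF; rewrite mxE.
    + by case: ifPn => // /gU; rewrite mxE.
    + by rewrite eU eV (uU : _ *m _ = _) subrr mxE.
  - by case=> [[[b y] x]|[y x]]; [have := bF b y x|have := bU y x]; rewrite mxE.
have Mr : M \is Num.real by rewrite -(subrK 1 M) rpredD ?real1 // ger0_real // subr_ge0.
have M0 : 0 <= M := le_trans ler01 M1.
pose tow F (u : mat) (z : W) : C := match z with inl z => F z.1.1 z.1.2 z.2 | inr p => u p.1 p.2 end.
have towF F u : wF (tow F u) =1 F by move=> b; apply/matrixP => y x; rewrite !mxE.
have towU F u : wU (tow F u) = u by apply/matrixP => y x; rewrite !mxE.
have Stow F u : isrep src tgt v F -> unitary u -> graded v u -> inbox M F u -> S (tow F u).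
  move=> rF uu gu [b1 b2]; apply/SP; rewrite towU; split=> //.
    by move=> b y x n; rewrite towF rF.
  by split=> // b y x; rewrite towF.
have [||w Sw hw] := @complex_minimum C W _ q g M pq pg _ Mr.
- by move=> w; rewrite gE; apply: Phi_real.
- exists (tow (fun=> 0) 1%:M); apply: Stow.
  + by move=> b y x _; rewrite mxE.
  + exact: unitary1.
  + exact: graded1.
  + split=> [b y x|y x]; first by rewrite mxE !raddf0 !normr0.
    have n1 : `|(1%:M : mat) y x| <= M by rewrite mxE normr_nat; case: (y == x).
    by split; [apply: le_trans (norm_Re_le _) n1|apply: le_trans (norm_Im_le _) n1].
have /SP [h1 h2 h3 h4] := Sw; exists (wF w), (wU w); split=> // F' u' rF' uu' gu' b'.
have := hw _ (Stow _ _ rF' uu' gu' b'); rewrite !gE towU.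
by rewrite [Phi B eps (wF _) u']/Phi /mubig /nrm2; under eq_bigr do rewrite towF;
   under [X in _ + eps * X]eq_bigr do rewrite towF.
Qed.

Lemma unitary_entry_le1 (u : mat) y x : unitary u -> `|u y x| <= 1.
Proof.
move=> hu; rewrite -(@ler_pXn2r _ 2) ?nnegrE ?normr_ge0 ?ler01 // expr1n.
have := congr1 (fun X : mat => X y y) hu; rewrite /= mxE [RHS]mxE eqxx => e.
rewrite -[leRHS]/(true%:R) -e (bigD1 x) //= adjmxE -normCK lerDl; apply: sumr_ge0 => z _.
by rewrite adjmxE -normCK exprn_ge0.
Qed.

Lemma inbox_of M F u : unitary u -> 1 <= M -> 1 + nrm2 F <= M -> inbox M F u.
Proof.
move=> hu M1 MF.
have box c : `|c| <= M -> `|'Re c| <= M /\ `|'Im c| <= M.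
  by move=> h; split; apply: le_trans h; [apply: norm_Re_le|apply: norm_Im_le].
split=> *; apply: box; last by apply: le_trans M1; apply: unitary_entry_le1.
by apply: le_trans MF; apply: norm_le1D; apply: entry_le_nrm2.
Qed.

Lemma isrep0 : isrep src tgt v (fun=> 0 : mat).
Proof. by move=> b y x _; rewrite mxE. Qed.
Lemma Phi00 eps : Phi B eps (fun _ : Ar => 0) 1%:M = \tr (B *m B).
Proof.
rewrite /Phi /nrm2 /mubig adjmx1 mul1mx mulmx1 adjmx0 mulmx0 subrr.
by rewrite !big1 ?mxtrace0 // mulr0 addr0 sub0r mulNmx mulmxN opprK.
Qed.
Lemma tr_sq_ge0 (X : mat) : adjmx X = X -> 0 <= \tr (X *m X).
Proof. by move=> hX; rewrite -{2}hX mxtrace_adj_ge0. Qed.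

Lemma beta_herm F u : adjmx (mubig F - u *m B *m adjmx u) = mubig F - u *m B *m adjmx u.
Proof. by rewrite adjmxB mubig_herm !adjmxM adjmxK hB mulmxA. Qed.

(** The penalty confines competitors of value at most [T] to a box of size [1 + T / eps]. At the
    minimum [|beta|^2 <= T], so [|mubig F|^2 <= 4 T] by the parallelogram law, and [nrm2_bound]
    gives a bound free of [eps]. *)
Lemma perturbed_min eps : 0 < eps -> exists2 F, is_min src tgt v B eps F &
  nrm2 F <= (1 + (\tr (B *m B) *+ 4)) *+ N *+ N.
Proof.
move=> e0; have er := gtr0_real e0; set T := \tr (B *m B).
have T0 : 0 <= T by apply: tr_sq_ge0.
pose M := 1 + T / eps.
have M1 : 1 <= M by rewrite lerDl divr_ge0 // ltW.
have [F [u [rF uu gu bF hF]]] := box_min er M1.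
have le0 : Phi B eps F u <= T.
  rewrite /T -(Phi00 eps); apply: hF; [exact: isrep0|exact: unitary1|exact: graded1|].
  apply: inbox_of => //; first exact: unitary1.
  by rewrite /nrm2 big1 ?addr0 // => b _; rewrite mul0mx mxtrace0.
have minF : is_min src tgt v B eps (cnj (adjmx u) F).
  apply: is_min_of => // F' u' rF' uu' gu'.
  have [le1|lt1] := real_leP (Phi_real F' u' er) (ger0_real T0); last by apply: le_trans le0 (ltW lt1).
  apply: hF => //; apply: inbox_of => //; rewrite lerD2l ler_pdivlMr // mulrC.
  by apply: le_trans le1; rewrite lerDr; apply: tr_sq_ge0; apply: beta_herm.
exists (cnj (adjmx u) F) => //; move: minF; move: (cnj _ F) => G minG.
have hb : adjmx (mubig G - B) = mubig G - B by rewrite adjmxB mubig_herm hB.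
have := nrm2_bound hb (divr_gt0 e0 (ltr0n C 2 : 0 < 2)) (is_min_comm hB gB (ltW e0) minG).
move/le_trans; apply; rewrite !lerMn2r lerD2l; apply/orP; right; apply/orP; right.
have bT : \tr ((mubig G - B) *m (mubig G - B)) <= T.
  have := proj2 minG _ _ isrep0 (unitary1 C N) (@graded1 C Q0 N v); rewrite Phi00 -/T /Phi adjmx1 mul1mx mulmx1.
  by apply: le_trans; rewrite lerDl mulr_ge0 ?nrm2_ge0 // ltW.
move: hb bT; have -> : mubig G = (mubig G - B) + B by rewrite subrK.
rewrite addrK; move: (mubig G - B) => b hb bT.
have := tr_sq_ge0 (_ : adjmx (b - B) = b - B); rewrite adjmxB hb hB => /(_ erefl) h1.
have -> : \tr ((b + B) *m (b + B)) = \tr (b *m b) *+ 2 + T *+ 2 - \tr ((b - B) *m (b - B)).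
  rewrite /T !(mulmxDl, mulmxDr, mulmxN, mulNmx) !(mxtraceD, raddfN) /=; ring.
rewrite lerBlDr; apply: le_trans (_ : T *+ 4 <= _); last by rewrite lerDl.
by rewrite -[4%N]/(2 + 2)%N mulrnDr lerD2r lerMn2r bT orbT.
Qed.

(** The box of size [M] contains the minimisers of all perturbed problems, so its minimum is at most
    [Phi + t |F'|^2] at every competitor [F'], for all small [t]. *)
Theorem global_min : exists F, is_min src tgt v B 0 F.
Proof.
set T := \tr (B *m B); pose R0 := (1 + (T *+ 4)) *+ N *+ N; pose M := 1 + R0.
have R00 : 0 <= R0 by rewrite !mulrn_wge0 // addr_ge0 ?ler01 // mulrn_wge0 // tr_sq_ge0.
have M1 : 1 <= M by rewrite lerDl.
have [F [u [rF uu gu bF hF]]] := box_min (real0 C) M1.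
exists (cnj (adjmx u) F); apply: is_min_of => // F' u' rF' uu' gu'.
rewrite -subr_ge0; apply: (@small_lin _ _ (fun=> nrm2 F') (nrm2 F')).
- by rewrite rpredB ?Phi_real ?real0.
- by move=> t _; rewrite ger0_norm ?nrm2_ge0.
move=> t /andP[t0 _]; have [G minG nG] := perturbed_min t0.
have h1 : Phi B 0 F u <= Phi B 0 G 1%:M.
  apply: hF; [exact: (proj1 minG)|exact: unitary1|exact: graded1|].
  by apply: inbox_of => //; [exact: unitary1|rewrite lerD2l].
have h2 : Phi B 0 G 1%:M <= Phi B t G 1%:M.
  by rewrite lerD2l mul0r mulr_ge0 ?nrm2_ge0 // ltW.
have h3 : Phi B t G 1%:M <= Phi B t F' u' := proj2 minG _ _ rF' uu' gu'.
have := le_trans h1 (le_trans h2 h3); rewrite -subr_ge0; congr (0 <= _).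
by rewrite /Phi mul0r addr0; ring.
Qed.

End Minimum.


(** * The minimum is a zero *)

Section SecondOrder.
Variables (C : numClosedFieldType) (Q0 Ar : finType) (src tgt : Ar -> Q0) (N : nat) (v : 'I_N -> Q0).
Notation mat := 'M[C]_N.
Notation Z := (Ar * 'I_N * 'I_N)%type.

Lemma not_surj (lt : rel 'I_N) (T Q : {set 'I_N}) (f : Ar -> mat) : ~ surj src tgt v lt T Q f ->
  exists h : Z -> C, [/\ forall z, ~~ apos src tgt v Q T z -> h z = 0, exists z, h z != 0 &
    forall phi, isH lt T Q phi -> \sum_z h z * del f phi z = 0].
Proof.
rewrite surjP -cokermx_eq0 => /negP/matrix0Pn [i [j nz]].
pose c : 'cV[C]_#|{: As src tgt v Q T}| := col j (cokermx (dmx src tgt v lt T Q f)).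
have dc : dmx src tgt v lt T Q f *m c = 0 by rewrite /c colE mulmxA mulmx_coker mul0mx.
pose h (z : Z) : C := oapp (fun s : As src tgt v Q T => c (enum_rank s) 0) 0 (insub z).
have hE s : h (val s) = c (enum_rank s) 0 by rewrite /h valK.
exists h; split.
- by move=> z nz'; rewrite /h insubF //; apply: negbTE.
- by exists (val (enum_val i)); rewrite hE enum_valK mxE.
move=> phi hphi; rewrite (bigID (apos src tgt v Q T)) /= [X in _ + X]big1 ?addr0; last first.
  by move=> z nz'; rewrite /h insubF ?mul0r //; apply: negbTE.
rewrite -sum_As; have := congr1 (fun M : 'M_(1, 1) => M 0 0) (mulmxA (ofH lt T Q phi) (dmx src tgt v lt T Q f) c).
rewrite dc mulmx0 mxE mxE => e; rewrite [RHS]e; apply: eq_bigr => k _.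
by rewrite mul_dmx ofHK // hE enum_valK mulrC.
Qed.

Variables (a b : 'I_N -> C).
Hypotheses (ar : forall x, a x \is Num.real) (br : forall x, b x \is Num.real).

(** With ties of [a] broken by [b], two indices at one vertex with [b y < b x] and not [lexlt y x]
    must satisfy [a x < a y]; this permits the division by [a x - a y] in [level_surj]. *)
Definition lexlt : rel 'I_N := fun y x => (v y == v x) &&
  ((a y < a x) || (a y == a x) && ((b y < b x) || (b y == b x) && (y < x)%N)).

Lemma lexlt_v y x : lexlt y x -> v y = v x. Proof. by case/andP => /eqP. Qed.
Lemma lexlt_irr : irreflexive lexlt.
Proof. by move=> x; rewrite /lexlt !eqxx !ltxx ltnn. Qed.
Lemma lexlt_trans : transitive lexlt.
Proof.
move=> y x z /andP[/eqP e1 h1] /andP[/eqP e2 h2]; rewrite /lexlt e1 e2 eqxx /=; move: h1 h2.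
case/orP=> [l1|/andP[/eqP -> h1]]; case/orP=> [l2|/andP[/eqP <- h2]].
- by rewrite (lt_trans l1 l2).
- by rewrite l1.
- by rewrite l2.
rewrite eqxx; apply/orP; right; move: h1 h2.
case/orP=> [l1|/andP[/eqP -> h1]]; case/orP=> [l2|/andP[/eqP <- h2]].
- by rewrite (lt_trans l1 l2).
- by rewrite l1.
- by rewrite l2.
by rewrite eqxx (ltn_trans h1 h2) orbT.
Qed.
Lemma lexlt_total x y : v x = v y -> x != y -> lexlt x y || lexlt y x.
Proof.
move=> e n; rewrite /lexlt e eqxx /= [a y == _]eq_sym [b y == _]eq_sym.
have [/=|/=|ea] := real_ltgtP (ar x) (ar y) => //.
have [/=|/=|eb] := real_ltgtP (br x) (br y) => //.
by case: ltngtP => // /val_inj ee; rewrite ee eqxx in n.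
Qed.
Lemma lexlt_mono y x : lexlt y x -> a y <= a x.
Proof. by case/andP => _ /orP[/ltW //|/andP[/eqP ->]]. Qed.

Variable F : Ar -> mat.
Let A := diag_mx (\row_y a y).
Hypothesis minF : is_min src tgt v A 0 F.
Hypothesis betaE : mubig F - A = diag_mx (\row_y b y).

Lemma diag_real_herm (p : 'I_N -> C) : (forall x, p x \is Num.real) ->
  adjmx (diag_mx (\row_y p y)) = diag_mx (\row_y p y).
Proof.
by move=> pr; rewrite diag_adj; congr diag_mx; apply/rowP => y; rewrite !mxE conj_Creal.
Qed.
Lemma diag_graded (p : 'I_N -> C) : graded v (diag_mx (\row_y p y)).
Proof. by move=> y x n; rewrite !mxE; case: (y =P x) n => [->|_ _]; rewrite ?eqxx ?mulr0n. Qed.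

Let hA : adjmx A = A. Proof. exact: diag_real_herm. Qed.

Lemma comm_diag (p : 'I_N -> C) (X : mat) y x : comm (diag_mx (\row_y p y)) X y x = (p y - p x) * X y x.
Proof. by rewrite /comm mul_diag_mx mul_mx_diag !mxE; ring. Qed.

Lemma tr_comm (D X Y : mat) : \tr (D *m comm X Y) = \tr (comm D X *m Y).
Proof.
rewrite /comm mulmxBr mulmxBl !raddfB /= !mulmxA; congr (_ - _).
by rewrite mxtrace_mulC mulmxA.
Qed.

(** At a minimum without penalty [beta] commutes with every arrow. *)
Lemma level_F c y x : F c y x != 0 -> b y = b x.
Proof.
move=> n0; have := is_min_comm hA (diag_graded a) (lexx 0) minF c.
rewrite betaE mul0r oppr0 scale0r => /matrixP /(_ y x); rewrite comm_diag mxE => /eqP.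
by rewrite mulf_eq0 (negbTE n0) orbF subr_eq0 => /eqP.
Qed.

(* Otherwise some [H], orthogonal to the image of the differential, maps [K] to its complement; moving
   [F] along [H] and cancelling the first-order change of the moment map by a rotation of [A]
   decreases [Phi] at second order. *)
Lemma level_surj lam : lam \is Num.real ->
  surj src tgt v lexlt [set x | lam <= b x] (~: [set x | lam <= b x]) F.
Proof.
move=> lr; set K := [set x | _]; apply: NNPP => /not_surj [h [h0 [z0 hz0] hdel]].
(* Conjugated so that pairing with [h] is the trace against [adjmx (H c)]. *)
pose H c : mat := \matrix_(y, x) (h (c, y, x))^*.
have HE c y x : H c y x != 0 -> [/\ b y < lam, lam <= b x, v x = src c & v y = tgt c].
  rewrite mxE conjC_eq0 => n0.
  have : apos src tgt v (~: K) K (c, y, x) by apply: contraNT n0 => /h0 ->.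
  rewrite /apos !inE /= => /and4P[yK xK /eqP -> /eqP ->].
  by split=> //; rewrite real_ltNge.
have rH : isrep src tgt v H.
  by move=> c y x; apply: contraNeq => /HE [_ _ -> ->]; rewrite !eqxx.
have rF := proj1 minF.
(* The part of [dmu F H] from [K] to its complement; the rest of [dmu F H] is its adjoint. *)
pose Nm : mat := \sum_c (H c *m adjmx (F c) - adjmx (F c) *m H c).
have NmE y x : Nm y x != 0 -> [/\ b y < lam, lam <= b x & v y = v x].
  suff : Nm y x != 0 -> [&& b y < lam, lam <= b x & v y == v x] by move=> h1 /h1 /and3P[? ? /eqP].
  apply: contraNT => nn; rewrite summxE big1 // => c _.
  have t1 : (H c *m adjmx (F c)) y x = 0.
    rewrite mxE big1 // => z _; rewrite adjmxE.
    have [->|nH] := eqVneq (H c y z) 0; first by rewrite mul0r.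
    have [->|nF] := eqVneq (F c x z) 0; first by rewrite conjC0 mulr0.
    have [e1 e2 _ e3] := HE _ _ _ nH; case/negP: nn; rewrite e1 (level_F nF) e2 e3.
    have /andP[_ /eqP ->] : (v z == src c) && (v x == tgt c) by apply: contraNT nF => /rF ->.
    by rewrite eqxx.
  have t2 : (adjmx (F c) *m H c) y x = 0.
    rewrite mxE big1 // => z _; rewrite adjmxE.
    have [->|nH] := eqVneq (H c z x) 0; first by rewrite mulr0.
    have [->|nF] := eqVneq (F c z y) 0; first by rewrite conjC0 mul0r.
    have [e1 e2 e3 _] := HE _ _ _ nH; case/negP: nn; rewrite e2 -(level_F nF) e1 e3.
    have /andP[/eqP -> _] : (v y == src c) && (v z == tgt c) by apply: contraNT nF => /rF ->.
    by rewrite eqxx.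
  by rewrite mxE [X in _ + X]mxE t1 t2 subrr.
have NmH y x : lexlt y x -> Nm y x = 0.
  move=> lt; apply/eqP; apply: contraT => n0; have [e1 e2 _] := NmE _ _ n0.
  have hphi : isH lexlt K (~: K) (delta_mx y x : mat).
    move=> y' x'; rewrite mxE; case: (y' =P y) => [->|//]; case: (x' =P x) => [->|//].
    by rewrite /hpos !inE e2 lt -real_ltNge // e1.
  have := hdel _ hphi; suff -> : \sum_z h z * del F (delta_mx y x) z = (Nm y x)^*.
    by move/eqP; rewrite conjC_eq0 (negbTE n0).
  transitivity (\sum_c \tr (delta_mx y x *m (F c *m adjmx (H c) - adjmx (H c) *m F c))).
    rewrite (eq_bigr (fun z => h (z.1.1, z.1.2, z.2) * del F (delta_mx y x) (z.1.1, z.1.2, z.2)));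
      last by move=> [[c y'] x'].
    rewrite -(pair_bigA _ (fun p x' => h (p.1, p.2, x') * del F (delta_mx y x) (p.1, p.2, x'))) /=.
    rewrite -(pair_bigA _ (fun c y' => \sum_x' h (c, y', x') * del F (delta_mx y x) (c, y', x'))) /=.
    apply: eq_bigr => c _.
    have -> : \tr (delta_mx y x *m (F c *m adjmx (H c) - adjmx (H c) *m F c)) =
              \tr ((delta_mx y x *m F c - F c *m delta_mx y x) *m adjmx (H c)).
      rewrite mulmxBr mulmxBl !raddfB /= !mulmxA; congr (_ - _).
      by rewrite [RHS]mxtrace_mulC mulmxA [RHS]mxtrace_mulC mulmxA.
    rewrite mxtrace_mulE; apply: eq_bigr => y' _; apply: eq_bigr => x' _.
    have -> : adjmx (H c) x' y' = h (c, y', x') by rewrite adjmxE mxE conjCK.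
    by rewrite mulrC.
  rewrite -raddf_sum -mulmx_sumr.
  have -> : \sum_c (F c *m adjmx (H c) - adjmx (H c) *m F c) = adjmx Nm.
    by rewrite adjmx_sum; apply: eq_bigr => c _; rewrite adjmxB !adjmxM !adjmxK.
  rewrite /= mxtrace_mulE (bigD1 y) //= (bigD1 x) //= !mxE !eqxx mul1r.
  rewrite big1 ?addr0 => [|i /negbTE ni]; last by rewrite mxE ni andbF mul0r.
  rewrite big1 ?addr0 // => i /negbTE ni; rewrite big1 // => j _.
  by rewrite mxE ni mul0r.
have Nlt y x : Nm y x != 0 -> a x < a y /\ b y < b x.
  move=> n0; have [e1 e2 e3] := NmE _ _ n0; have bb := lt_le_trans e1 e2; split=> //.
  have : ~~ lexlt y x by apply: contraNN n0 => /NmH ->.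
  rewrite /lexlt e3 eqxx bb /=.
  by have [||] := real_ltgtP (ar y) (ar x).
(* Solves [comm Xi A = Nm] entry by entry. *)
pose Xi : mat := \matrix_(y, x) (Nm y x / (a x - a y)).
pose X : mat := Xi - adjmx Xi.
have skX : adjmx X = - X by rewrite /X adjmxB adjmxK opprB.
have XiE y x : Xi y x != 0 -> [/\ a x < a y, b y < b x & v y = v x].
  rewrite mxE => n0; have n1 : Nm y x != 0 by apply: contraNneq n0 => ->; rewrite mul0r.
  by have [e1 e2] := Nlt _ _ n1; have [_ _ e3] := NmE _ _ n1.
have gX : graded v X.
  move=> y x n; rewrite mxE [X in _ + X]mxE adjmxE.
  have [->|/XiE [_ _ e]] := eqVneq (Xi y x) 0; last by rewrite e eqxx in n.
  have [->|/XiE [_ _ e]] := eqVneq (Xi x y) 0; last by rewrite e eqxx in n.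
  by rewrite conjC0 subrr.
have XiA : comm Xi A = Nm.
  apply/matrixP => y x; rewrite /comm mul_mx_diag mul_diag_mx !mxE.
  have [->|n0] := eqVneq (Nm y x) 0; first by rewrite !mul0r mulr0 subrr.
  have [e _] := Nlt _ _ n0; have d0 : a x - a y != 0 by rewrite subr_eq0 lt_eqF.
  by field.
have XA : comm X A = dmu F H.
  have -> : comm X A = comm Xi A + adjmx (comm Xi A).
    rewrite /comm /X adjmxB !adjmxM hA; clear; mxring.
  rewrite XiA /Nm adjmx_sum -big_split; apply: eq_bigr => c _ /=.
  rewrite adjmxB !adjmxM !adjmxK; clear; mxring.
(* The term [t1] is negative because [H] strictly lowers [b]; [t2] is nonnegative because [X] joins
   only indices on which [a] and [b] are ordered oppositely. *)
have := second_variation hA minF rH skX gX erefl (esym XA).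
rewrite betaE mulmxBr raddfB /= tr_diag_mubig -scalemxAr mxtraceZ.
set t1 := \sum_c _; set t2 := \tr _ => le0.
have t10 : t1 < 0.
  have [[[c0 y0] x0] e0] : {z | z = z0} by exists z0.
  have n0 : H c0 y0 x0 != 0 by rewrite mxE conjC_eq0 e0.
  have neg c y x : (b y - b x) * `|H c y x| ^+ 2 <= 0.
    have [->|/HE [e1 e2 _ _]] := eqVneq (H c y x) 0; first by rewrite normr0 expr0n mulr0.
    by rewrite mulr_le0_ge0 ?exprn_ge0 // subr_le0 ltW // (lt_le_trans e1).
  rewrite /t1 (bigD1 c0) //= (bigD1 y0) //= (bigD1 x0) //=.
  have [e1 e2 _ _] := HE _ _ _ n0.
  have n1 : (b y0 - b x0) * `|H c0 y0 x0| ^+ 2 < 0.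
    by rewrite pmulr_llt0 ?exprn_gt0 ?normr_gt0 // subr_lt0 (lt_le_trans e1).
  apply: le_lt_trans n1; rewrite -!addrA gerDl.
  rewrite -[leRHS]addr0; apply: lerD; first by apply: sumr_le0.
  rewrite -[leRHS]addr0; apply: lerD; apply: sumr_le0 => i _; apply: sumr_le0 => j _ //.
  by apply: sumr_le0.
have t20 : 0 <= t2.
  have -> : t2 = \tr (comm (diag_mx (\row_y b y)) X *m comm X A).
    exact: tr_comm.
  rewrite mxtrace_mulE; apply: sumr_ge0 => y _; apply: sumr_ge0 => x _; rewrite comm_diag.
  have -> : comm X A x y = (a y - a x) * X x y by rewrite /comm mul_mx_diag mul_diag_mx !mxE; ring.
  have -> : X x y = - (X y x)^*.
    by have := congr1 (fun M : mat => M x y) skX; rewrite adjmxE [RHS]mxE => ->; rewrite opprK.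
  have -> : (b y - b x) * X y x * ((a y - a x) * - (X y x)^*) = (b x - b y) * (a y - a x) * (X y x * (X y x)^*) by ring.
  have [->|n0] := eqVneq (X y x) 0; first by rewrite mul0r mulr0.
  rewrite mulr_ge0 ?mul_conjC_ge0 //.
  have [e|] := eqVneq (Xi y x) 0; last by case/XiE => e1 e2 _; rewrite mulr_ge0 // subr_ge0 ltW.
  have : Xi x y != 0 by apply: contraNneq n0 => e'; rewrite mxE [X in _ + X]mxE adjmxE e e' conjC0 subrr.
  by case/XiE => e1 e2 _; rewrite mulr_le0 // subr_le0 ltW.
move: le0; rewrite subr_ge0 => /le_lt_trans /(_ t10); rewrite pmulr_rlt0 ?invr_gt0 ?ltr0n //.
by move/lt_le_trans/(_ t20); rewrite ltxx.
Qed.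

(** Subtracting the least positive weight [m] from all positive weights peels off one level set and
    leaves fewer positive weights. *)
Lemma layer_cake (w : 'I_N -> C) : (forall x, 0 <= w x) ->
  (forall lam, 0 < lam -> 0 <= \sum_(x | lam <= w x) a x) -> 0 <= \sum_x w x * a x.
Proof.
have [n] := ubnP #|[set x | 0 < w x]|; elim: n w => // n IH w; rewrite ltnS => sz w0 hw.
case: (pickP [pred x | 0 < w x]) => [x0 /= x00|none]; last first.
  rewrite big1 // => x _; have := none x; rewrite /= lt_def w0 andbT => /negbFE /eqP ->.
  by rewrite mul0r.
have wr x : w x \is Num.real by apply: ger0_real.
have [x1 x10 hmin] : exists2 x1, 0 < w x1 & forall y, 0 < w y -> w x1 <= w y.
  case: (@arg_minnP _ x0 (fun x => 0 < w x) (fun x => #|[set y | 0 < w y < w x]|)) => // x1 x10 hx.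
  exists x1 => // y y0; rewrite real_leNgt //; apply/negP => lt.
  have := hx y y0; rewrite leqNgt => /negP; apply; apply: proper_card; apply/properP; split.
    by apply/subsetP => z; rewrite !inE => /andP[-> /lt_trans]; apply.
  by exists y; rewrite !inE ?y0 // ltxx andbF.
pose m := w x1; pose w' x := if 0 < w x then w x - m else 0.
have ge_m x : (m <= w x) = (0 < w x).
  by apply/idP/idP => [/(lt_le_trans x10)//|/hmin].
have -> : \sum_x w x * a x = m * \sum_(x | m <= w x) a x + \sum_x w' x * a x.
  rewrite mulr_sumr [X in X + _]big_mkcond -big_split; apply: eq_bigr => x _ /=; rewrite ge_m /w'.
  case: ifPn => [_|]; first by rewrite mulrBl addrC subrK.
  by rewrite lt_def w0 andbT negbK => /eqP ->; rewrite !mul0r addr0.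
rewrite addr_ge0 ?mulr_ge0 ?hw ?(ltW x10) //; apply: IH.
- apply: leq_trans sz; apply: proper_card; apply/properP; split.
    by apply/subsetP => x; rewrite !inE /w'; case: ifP; rewrite ?ltxx.
  by exists x1; rewrite !inE ?x10 // /w' x10 subrr ltxx.
- by move=> x; rewrite /w'; case: ifP => // /hmin; rewrite subr_ge0.
move=> lam lam0; have := hw (lam + m) (addr_gt0 lam0 x10); congr (0 <= _).
apply: eq_bigl => x; rewrite /w'; case: ifPn => [_|nw]; first by rewrite lerBrDr.
have -> : (lam <= 0) = false by apply/negbTE; rewrite -real_ltNge ?real0 ?gtr0_real.
apply/negbTE; apply: contraNN nw; apply: lt_le_trans; exact: addr_gt0.
Qed.

Lemma min_beta0 : (forall lam, lam \is Num.real -> 0 <= \sum_(x in [set x | lam <= b x]) a x) ->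
  \sum_x a x = 0 -> forall x, b x = 0.
Proof.
move=> hK sa.
(* Arrows preserve the levels of [b]; as [mubig F] is [A] plus [beta], this says that
   [tr (beta A) = - tr (beta^2)]. *)
have e1 : \tr (diag_mx (\row_y b y) *m mubig F) = 0.
  rewrite tr_diag_mubig big1 // => c _; rewrite big1 // => y _; rewrite big1 // => x _.
  have [->|/level_F ->] := eqVneq (F c y x) 0; first by rewrite normr0 expr0n mulr0.
  by rewrite subrr mul0r.
have e2 : \sum_x b x * a x + \sum_x b x ^+ 2 = 0.
  have trd (p q : 'I_N -> C) : \tr (diag_mx (\row_y p y) *m diag_mx (\row_y q y)) = \sum_x p x * q x.
    by rewrite /mxtrace; apply: eq_bigr => x _; rewrite mul_diag_mx !mxE eqxx mulr1n.
  rewrite -[RHS]e1 -(subrK A (mubig F)) betaE mulmxDr mxtraceD /A !trd [RHS]addrC; congr (_ + _).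
have ge : 0 <= \sum_x b x * a x.
  (* The shift makes the weights nonnegative and is harmless because [a] sums to zero. *)
  pose s := \sum_x `|b x|.
  have -> : \sum_x b x * a x = \sum_x (b x + s) * a x.
    by under [RHS]eq_bigr do rewrite mulrDl; rewrite big_split /= -mulr_sumr sa mulr0 addr0.
  have sr : s \is Num.real by apply: rpred_sum => x _; apply: normr_real.
  apply: layer_cake => [x|lam lam0].
    have h : - b x <= `|b x| by rewrite -normrN real_ler_norm ?realN.
    by rewrite /s (bigD1 x) //= addrA addr_ge0 ?sumr_ge0 // addrC -lerBlDr sub0r.
  have := hK (lam - s) (rpredB (gtr0_real lam0) sr); congr (0 <= _); apply: eq_bigl => x.
  by rewrite inE lerBlDr.
have sq0 : \sum_x b x ^+ 2 = 0.
  apply/le_anti; rewrite sumr_ge0 ?andbT => [|x _]; last by rewrite real_exprn_even_ge0.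
  by move/eqP: e2; rewrite addrC addr_eq0 => /eqP ->; rewrite oppr_le0.
move=> x; move/eqP: sq0; rewrite psumr_eq0 => [/allP /(_ x)|z _]; last by rewrite real_exprn_even_ge0.
by rewrite mem_index_enum sqrf_eq0 => /(_ isT) /eqP.
Qed.

End SecondOrder.


(** * Block decomposition over the vertices *)

Section Blocks.
Variables (C : numClosedFieldType) (Q0 Ar : finType) (src tgt : Ar -> Q0) (N : nat) (v : 'I_N -> Q0).
Variables (d : Q0 -> nat) (idx : forall i, 'I_(d i) -> 'I_N).
Hypothesis idx_v : forall i k, v (@idx i k) = i.
Hypothesis idx_inj : forall i, injective (@idx i).
Hypothesis idx_surj : forall i x, v x = i -> exists k, x = @idx i k.
Notation mat := 'M[C]_N.

(** Coordinate projection onto the space at vertex [i]; its transpose is the inclusion. *)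
Definition blk i : 'M[C]_(d i, N) := \matrix_(k, x) (x == idx k)%:R.

Lemma blk_adj i : adjmx (blk i) = (blk i)^T.
Proof. by apply/matrixP => x k; rewrite adjmxE !mxE conjC_nat. Qed.
Lemma blk_mulE i n (X : 'M[C]_(N, n)) k y : (blk i *m X) k y = X (idx k) y.
Proof.
rewrite mxE (bigD1 (idx k)) //= mxE eqxx mul1r big1 ?addr0 // => x /negbTE n0.
by rewrite mxE n0 mul0r.
Qed.
Lemma mul_blkTE i n (X : 'M[C]_(n, N)) y k : (X *m (blk i)^T) y k = X y (idx k).
Proof.
rewrite mxE (bigD1 (idx k)) //= !mxE eqxx mulr1 big1 ?addr0 // => x /negbTE n0.
by rewrite !mxE n0 mulr0.
Qed.
Lemma blkK i : blk i *m (blk i)^T = 1%:M.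
Proof. by apply/matrixP => k l; rewrite mul_blkTE !mxE eq_sym (inj_eq (@idx_inj i)). Qed.
Lemma blk0 i j : i != j -> blk i *m (blk j)^T = 0.
Proof.
move=> ij; apply/matrixP => k l; rewrite mul_blkTE !mxE; case: eqP => // e.
by move: ij; rewrite -(idx_v k) -e idx_v eqxx.
Qed.
Lemma blkTK i : (blk i)^T *m blk i = gproj C v i.
Proof.
apply/matrixP => y x; rewrite /gproj !mxE.
have [e|n] := eqVneq (v y) i; last first.
  rewrite big1 ?mul0rn // => k _; rewrite !mxE (_ : y == idx k = false) ?mul0r //.
  by apply/negbTE; apply: contraNneq n => ->; rewrite idx_v.
have [k ek] := idx_surj e; rewrite (bigD1 k) //= !mxE ek eqxx mul1r big1 ?addr0.
  by rewrite eq_sym; case: eqP.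
move=> l lk; rewrite !mxE (inj_eq (@idx_inj i)) eq_sym (negbTE lk) mul0r //.
Qed.

Lemma sum_blk : \sum_i (blk i)^T *m blk i = 1%:M :> mat.
Proof.
apply/matrixP => y x; rewrite summxE (bigD1 (v y)) //= blkTK /gproj !mxE eqxx big1 ?addr0 //.
by move=> i; rewrite eq_sym blkTK /gproj !mxE => /negbTE ->; rewrite mul0rn.
Qed.

Definition glue (X : forall i, 'M[C]_(d i)) : mat := \sum_i (blk i)^T *m X i *m blk i.
Definition cutb (X : mat) i : 'M[C]_(d i) := blk i *m X *m (blk i)^T.

Lemma blk_glue X i : blk i *m glue X = X i *m blk i.
Proof.
rewrite /glue mulmx_sumr (bigD1 i) //= !mulmxA blkK mul1mx big1 ?addr0 // => j ji.
by rewrite !mulmxA blk0 ?mul0mx // eq_sym.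
Qed.
Lemma glue_blkT X i : glue X *m (blk i)^T = (blk i)^T *m X i.
Proof.
rewrite /glue mulmx_suml (bigD1 i) //= -mulmxA blkK mulmx1 big1 ?addr0 // => j ji.
by rewrite -mulmxA blk0 ?mulmx0.
Qed.
Lemma cutb_glue X i : cutb (glue X) i = X i.
Proof. by rewrite /cutb blk_glue -mulmxA blkK mulmx1. Qed.
Lemma glueM X Y : glue X *m glue Y = glue (fun i => X i *m Y i).
Proof.
rewrite [in LHS]/glue mulmx_suml; apply: eq_bigr => i _.
by rewrite -mulmxA blk_glue !mulmxA.
Qed.
Lemma glue_adj X : adjmx (glue X) = glue (fun i => adjmx (X i)).
Proof.
rewrite /glue adjmx_sum; apply: eq_bigr => i _; rewrite !adjmxM blk_adj mulmxA; congr (_ *m _ *m _).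
by rewrite -blk_adj adjmxK.
Qed.
Lemma eq_glue X Y : (forall i, X i = Y i) -> glue X = glue Y.
Proof. by move=> e; apply: eq_bigr => i _; rewrite e. Qed.
Lemma glue1 : glue (fun i => 1%:M) = 1%:M.
Proof. by rewrite -sum_blk; apply: eq_bigr => i _; rewrite mulmx1. Qed.
Lemma glue_graded X : graded v (glue X).
Proof. by apply/gradedP => i; rewrite -blkTK mulmxA glue_blkT -mulmxA blk_glue mulmxA. Qed.
Lemma glue_cutb X : graded v X -> glue (cutb X) = X.
Proof.
move=> /gradedP gX; rewrite -[RHS]mul1mx -sum_blk mulmx_suml; apply: eq_bigr => i _.
by rewrite /cutb !mulmxA blkTK -!mulmxA blkTK -gX mulmxA -blkTK !mulmxA -[_ *m blk i *m (blk i)^T]mulmxA blkK mulmx1.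
Qed.
Lemma cutbM X Y i : graded v X -> graded v Y -> cutb (X *m Y) i = cutb X i *m cutb Y i.
Proof. by move=> gX gY; rewrite -{1}(glue_cutb gX) -{1}(glue_cutb gY) glueM cutb_glue. Qed.
Lemma cutb_adj X i : cutb (adjmx X) i = adjmx (cutb X i).
Proof. by rewrite /cutb !adjmxM -blk_adj adjmxK mulmxA. Qed.

Lemma glue_diag (p : forall i, 'I_(d i) -> C) :
  exists q : 'I_N -> C, (forall i k, q (idx k) = p i k) /\
    glue (fun i => diag_mx (\row_k p i k)) = diag_mx (\row_x q x).
Proof.
pose q x := \sum_i \sum_k (x == @idx i k)%:R * p i k.
have qE i k : q (idx k) = p i k.
  rewrite /q (bigD1 i) //= (bigD1 k) //= eqxx mul1r big1 ?addr0 => [|l lk]; last first.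
    by rewrite (inj_eq (@idx_inj i)) eq_sym (negbTE lk) mul0r.
  rewrite big1 ?addr0 // => j ji; rewrite big1 // => l _; rewrite (_ : _ == _ = false) ?mul0r //.
  apply/negbTE; apply: contraNneq ji => e; apply/eqP.
  by have := idx_v l; rewrite -e idx_v => ->.
exists q; split=> //; apply/matrixP => y x.
have [k ek] := idx_surj (erefl (v y)); rewrite {1}ek -blk_mulE blk_glue mul_diag_mx !mxE -qE -ek.
by rewrite eq_sym; case: eqP; rewrite ?mulr1 ?mulr0.
Qed.

Lemma graded_commuting_diag (A B : mat) : adjmx A = A -> adjmx B = B -> A *m B = B *m A ->
  graded v A -> graded v B ->
  exists (P : mat) (a b : 'I_N -> C), [/\ unitary P /\ graded v P, forall x, a x \is Num.real,
    forall x, b x \is Num.real,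
    P *m A *m adjmx P = diag_mx (\row_x a x) & P *m B *m adjmx P = diag_mx (\row_x b x)].
Proof.
move=> hA hB AB gA gB.
have ex i : exists w : 'M[C]_(d i) * ('I_(d i) -> C) * ('I_(d i) -> C), [/\ unitary w.1.1, 
    forall k, w.1.2 k \is Num.real, forall k, w.2 k \is Num.real,
    w.1.1 *m cutb A i *m adjmx w.1.1 = diag_mx (\row_k w.1.2 k) &
    w.1.1 *m cutb B i *m adjmx w.1.1 = diag_mx (\row_k w.2 k)].
  have [||| P [a [b h]]] := @commuting_diag C _ (cutb A i) (cutb B i).
  - by rewrite -cutb_adj hA.
  - by rewrite -cutb_adj hB.
  - by rewrite -!cutbM // AB.
  - by exists (P, a, b).
have [w hw] := fin_all_exists ex.
have [a [aE aD]] := glue_diag (fun i => (w i).1.2).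
have [b [bE bD]] := glue_diag (fun i => (w i).2).
exists (glue (fun i => (w i).1.1)), a, b; split.
- split; last exact: glue_graded.
  rewrite /unitary glue_adj glueM -glue1; apply: eq_glue => i.
  by have [] := hw i.
- by move=> x; have [k ->] := idx_surj (erefl (v x)); rewrite aE; have [] := hw (v x).
- by move=> x; have [k ->] := idx_surj (erefl (v x)); rewrite bE; have [] := hw (v x).
- rewrite -{1}(glue_cutb gA) glue_adj !glueM -aD; apply: eq_glue => i.
  by have [] := hw i.
- rewrite -{1}(glue_cutb gB) glue_adj !glueM -bD; apply: eq_glue => i.
  by have [] := hw i.
Qed.

Definition order_on (lt : rel 'I_N) := [/\ forall y x, lt y x -> v y = v x, transitive lt, irreflexive lt &
  forall x y, v x = v y -> x != y -> lt x y || lt y x].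

Lemma tr_comm_swap (D X Y : mat) : \tr (D *m comm X Y) = - \tr (X *m comm D Y).
Proof.
have e1 : \tr (D *m X *m Y) = \tr (X *m Y *m D) by rewrite -mulmxA mxtrace_mulC.
have e2 : \tr (D *m Y *m X) = \tr (X *m D *m Y) by rewrite mxtrace_mulC mulmxA.
by rewrite /comm !mulmxBr !raddfB /= !mulmxA e1 e2; ring.
Qed.

(** [hdom] ranges over all diagonalisations and orders because the one to which it is applied
    depends on the minimiser, through the eigenvalues of [beta]. *)
Theorem moment_of_dominant (B : mat) : adjmx B = B -> graded v B -> \tr B = 0 ->
  (forall (P : mat) (a : 'I_N -> C) lt K, unitary P -> graded v P -> P *m B *m adjmx P = diag_mx (\row_x a x) ->
    order_on lt -> (forall y x, lt y x -> a y <= a x) -> dominant C src tgt v lt K (~: K) ->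
    0 <= \sum_(x in K) a x) ->
  exists F, isrep src tgt v F /\ mubig F = B.
Proof.
move=> hB gB trB hdom.
have [F minF] := global_min src tgt hB gB; have rF := proj1 minF.
set beta := mubig F - B.
have hb : adjmx beta = beta by rewrite /beta adjmxB mubig_herm hB.
have gb : graded v beta by apply: gradedD; [apply: graded_mubig rF|apply: gradedN].
(* Rotating [B] alone, with generator [X = comm beta B], gives the first variation [- 2 |X|^2]. *)
have bB : comm beta B = 0.
  have skX : adjmx (comm beta B) = - comm beta B by apply: comm_skew.
  have gX : graded v (comm beta B) by apply: gradedD; [|apply: gradedN]; apply: gradedM.
  have r0 : isrep src tgt v (fun=> 0 : mat) := @isrep0 C Q0 Ar src tgt N v.
  have := first_variation hB (lexx 0) minF r0 skX gX; rewrite mul0r addr0 -/beta.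
  have -> : dmu F (fun=> 0 : mat) = 0.
    by rewrite /dmu big1 // => c _; rewrite adjmx0 !mul0mx !mulmx0 !subr0 addr0.
  rewrite sub0r mulmxN raddfN /= tr_comm_swap opprK pmulr_rge0 ?ltr0n // -{1}[comm beta B]opprK -skX.
  rewrite mulNmx raddfN /= oppr_ge0 => h.
  have h2 : \tr (adjmx (comm beta B) *m comm beta B) = \tr (comm beta B *m adjmx (comm beta B)) by rewrite mxtrace_mulC.
  by apply: mxtrace_adj_eq0; apply/le_anti; rewrite mxtrace_adj_ge0 andbT -h2.
have Bb : B *m beta = beta *m B by move/eqP: bB; rewrite subr_eq0 => /eqP ->.
have [P [a [b [[uP gP] ar br eA eb]]]] := graded_commuting_diag hB hb Bb gB gb.
have minG : is_min src tgt v (diag_mx (\row_x a x)) 0 (cnj P F).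
  split; first exact: isrep_cnj.
  have PhiE G u : Phi (diag_mx (\row_x a x)) 0 G u = Phi B 0 G (u *m P).
    by rewrite /Phi -eA adjmxM !mulmxA.
  move=> F' u' rF' uu' gu'; rewrite !PhiE mul1mx.
  have -> : Phi B 0 (cnj P F) P = Phi B 0 F 1%:M by rewrite -[RHS](Phi_cnj _ _ _ _ uP) mulmx1.
  by apply: (proj2 minF) => //; [apply: unitaryM|apply: gradedM].
have betaE : mubig (cnj P F) - diag_mx (\row_x a x) = diag_mx (\row_x b x).
  by rewrite mubig_cnj // -eA -eb /beta mulmxBr mulmxBl.
have b0 x : b x = 0.
  apply: (min_beta0 ar br minG betaE) => [lam lr|].
    apply: (hdom P a (lexlt v a b)) => //.
    - split; [exact: lexlt_v|exact: lexlt_trans|exact: lexlt_irr|exact: lexlt_total].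
    - exact: lexlt_mono.
    - by exists (cnj P F); apply: level_surj.
  have -> : \sum_x a x = \tr (P *m B *m adjmx P).
    by rewrite eA /mxtrace; apply: eq_bigr => y _; rewrite !mxE eqxx.
  by rewrite mxtrace_mulC mulmxA (unitaryK uP) mul1mx.
exists F; split=> //; apply/eqP; rewrite -subr_eq0 -/beta; apply/eqP.
have -> : beta = adjmx P *m (P *m beta *m adjmx P) *m P.
  by rewrite !mulmxA (unitaryK uP) mul1mx -mulmxA (unitaryK uP) mulmx1.
rewrite eb (_ : diag_mx _ = 0) ?mulmx0 ?mul0mx //.
by apply/matrixP => y x; rewrite !mxE b0 mul0rn.
Qed.

Lemma cutb_conform i j (X : 'M[C]_(d j)) : j = i -> cutb ((blk j)^T *m X *m blk j) i = conform_mx 0 X.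
Proof.
move=> e; case: _ / e; rewrite conform_mx_id /cutb !mulmxA blkK mul1mx.
by rewrite -mulmxA blkK mulmx1.
Qed.
Lemma cutb_other i j (X : 'M[C]_(d j)) : j != i -> cutb ((blk j)^T *m X *m blk j) i = 0.
Proof. by move=> n; rewrite /cutb !mulmxA blk0 ?mul0mx // eq_sym. Qed.

Definition big_rep (f : forall b : Ar, 'M[C]_(d (tgt b), d (src b))) b : mat :=
  (blk (tgt b))^T *m f b *m blk (src b).

Lemma big_rep_isrep f : isrep src tgt v (big_rep f).
Proof.
move=> b y x; rewrite negb_and => n; rewrite /big_rep mxE big1 // => k _.
have [e|nx] := eqVneq (v x) (src b); last first.
  rewrite [blk _ _ _]mxE (_ : x == idx k = false) ?mulr0 //.
  by apply/negbTE; apply: contraNneq nx => ->; rewrite idx_v.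
rewrite [X in X * _]mxE big1 ?mul0r // => l _; rewrite mxE [blk _ _ _]mxE (_ : y == idx l = false) ?mul0r //.
by apply/negbTE; apply: contraNneq (_ : v y != tgt b) => [->|]; rewrite ?idx_v //; move: n; rewrite e eqxx.
Qed.

Lemma mu_cutb f i : cutb (mubig (big_rep f)) i = mu f i.
Proof.
have cutb_sum (X : Ar -> mat) : cutb (\sum_b X b) i = \sum_b cutb (X b) i.
  by rewrite /cutb mulmx_sumr mulmx_suml.
have cutbB X Y : cutb (X - Y) i = cutb X i - cutb Y i by rewrite /cutb mulmxBr mulmxBl.
have adj_rep b : adjmx (big_rep f b) = (blk (src b))^T *m adjmx (f b) *m blk (tgt b).
  by rewrite /big_rep !adjmxM blk_adj -[in LHS](blk_adj (tgt b)) adjmxK mulmxA.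
rewrite /mubig cutb_sum; under eq_bigr do rewrite cutbB.
rewrite sumrB /mu; congr (_ - _); rewrite [RHS]big_mkcond; apply: eq_bigr => b _; rewrite adj_rep.
  have -> : big_rep f b *m ((blk (src b))^T *m adjmx (f b) *m blk (tgt b)) =
     (blk (tgt b))^T *m (f b *m adjmx (f b)) *m blk (tgt b).
    by rewrite /big_rep !mulmxA -[_ *m blk (src b) *m (blk (src b))^T]mulmxA blkK mulmx1.
  by case: eqP => [e|/eqP n]; [apply: cutb_conform|apply: cutb_other].
have -> : (blk (src b))^T *m adjmx (f b) *m blk (tgt b) *m big_rep f b =
   (blk (src b))^T *m (adjmx (f b) *m f b) *m blk (src b).
  by rewrite /big_rep !mulmxA -[_ *m blk (tgt b) *m (blk (tgt b))^T]mulmxA blkK mulmx1.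
by case: eqP => [e|/eqP n]; [apply: cutb_conform|apply: cutb_other].
Qed.

Lemma rep_of_big F : isrep src tgt v F ->
  exists f, forall b, big_rep f b = F b.
Proof.
move=> rF; exists (fun b => blk (tgt b) *m F b *m (blk (src b))^T) => b.
rewrite /big_rep !mulmxA blkTK -!mulmxA blkTK mulmxA; apply/matrixP => y x.
rewrite /gproj mul_mx_diag mul_diag_mx !mxE.
case: (boolP ((v x == src b) && (v y == tgt b))) => [/andP[-> ->]|n]; first by rewrite mul1r mulr1.
by rewrite rF // mulr0 mul0r.
Qed.

Lemma mu_imageP (B : forall i, 'M[C]_(d i)) :
  (exists f, forall i, @mu C Q0 Ar src tgt d f i = B i) <->
  exists F, isrep src tgt v F /\ mubig F = glue B.
Proof.
split=> [[f hf]|[F [rF hF]]].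
  exists (big_rep f); split; first exact: big_rep_isrep.
  rewrite -[LHS]glue_cutb; last by apply: graded_mubig; apply: big_rep_isrep.
  by apply: eq_glue => i; rewrite mu_cutb.
have [f hf] := rep_of_big rF; exists f => i; rewrite -mu_cutb -[RHS]cutb_glue -hF.
by rewrite (_ : mubig (big_rep f) = mubig F) //; apply: eq_bigr => b _; rewrite hf.
Qed.

End Blocks.


(** * The recursion for dominant positions *)

Lemma enum_val_ltn n (A : {set 'I_n}) (i j : 'I_#|A|) : (enum_val i < enum_val j)%N = (i < j)%N.
Proof.
have srt : sorted (fun x y : 'I_n => (x < y)%N) (enum A).
  have -> : enum A = filter (mem A) (enum 'I_n) by rewrite enumT.
  apply: sorted_filter; first by move=> ? ? ?; apply: ltn_trans.
  by have := iota_ltn_sorted 0 n; rewrite -val_enum_ord sorted_map.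
have mono (k l : 'I_#|A|) : (k < l)%N -> (enum_val k < enum_val l)%N.
  move=> kl; have x0 : 'I_n := enum_val k; rewrite !(enum_val_nth x0).
  apply: (sorted_ltn_nth _ _ srt) => //; rewrite ?inE -?cardE //.
  by move=> ? ? ?; apply: ltn_trans.
apply/idP/idP => [h|]; last exact: mono.
rewrite ltnNge leq_eqVlt; apply/negP => /orP[/eqP/val_inj e|/mono h']; first by rewrite e ltnn in h.
by have := ltn_trans h h'; rewrite ltnn.
Qed.

Section Translate.
Variables (C : numFieldType) (Q0 Ar : finType) (src tgt : Ar -> Q0) (N : nat) (v : 'I_N -> Q0) (lt : rel 'I_N).
Hypothesis lo : order_on v lt.
Notation set := {set 'I_N}.

(** [pos i] lists the elements of [E] at vertex [i] increasingly, which identifies tuples [K] with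
    subsets of [E]. Passing from [E] to [img pos K] renumbers by [enum_val], exactly as the
    recursion for [Shat] does. *)
Definition enumer (E : set) e (pos : forall i : Q0, 'I_(e i) -> 'I_N) :=
  [/\ forall i k, v (pos i k) = i, forall i k l, lt (pos i k) (pos i l) = (k < l)%N,
      forall i k, pos i k \in E & forall i x, x \in E -> v x = i -> exists k, x = pos i k].
Definition img e (pos : forall i : Q0, 'I_(e i) -> 'I_N) (K : forall i, {set 'I_(e i)}) : set :=
  \bigcup_i [set pos i k | k in K i].

Lemma card_ord_ltn n (k : 'I_n) : #|[set l : 'I_n | (l < k)%N]| = k.
Proof.
rewrite cardsE -sum1_card (eq_bigl (fun l : 'I_n => (l < k)%N)) //.
by rewrite (big_ord_narrow (ltnW (ltn_ord k))) sum1_card card_ord.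
Qed.

Section Enumer.
Variables (E : set) (e : Q0 -> nat) (pos : forall i : Q0, 'I_(e i) -> 'I_N).
Hypothesis eE : enumer E pos.

Lemma pos_inj i : injective (@pos i).
Proof.
case: eE => _ h _ _ k l kl; have [_ _ irr _] := lo.
have n1 : ~~ (k < l)%N by rewrite -h kl irr.
have n2 : ~~ (l < k)%N by rewrite -h kl irr.
by apply/val_inj; move: n1 n2 => /=; lia.
Qed.

Implicit Types K : forall i, {set 'I_(e i)}.

Lemma imgP (K : forall i, {set 'I_(e i)}) x : reflect (exists i, exists2 k, k \in K i & x = @pos i k) (x \in img pos K).
Proof.
apply: (iffP bigcupP) => [[i _ /imsetP [k kK ->]]|[i [k kK ->]]]; first by exists i; exists k.
by exists i => //; apply: imset_f.
Qed.

Lemma pos_img K i k : (@pos i k \in img pos K) = (k \in K i).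
Proof.
case: eE => hv _ _ _; apply/imgP/idP => [[j [l lK]]|kK]; last by exists i; exists k.
move=> epos; have eij : i = j by rewrite -(hv i k) epos hv.
by case: _ / eij l lK epos => l lK /pos_inj ->.
Qed.

Lemma img_sub K : img pos K \subset E.
Proof. by case: eE => _ _ h _; apply/subsetP => x /imgP [i [k _ ->]]. Qed.

Lemma big_img (R : Type) (idx : R) (op : Monoid.com_law idx) K (G : 'I_N -> R) :
  \big[op/idx]_(x in img pos K) G x = \big[op/idx]_i \big[op/idx]_(k in K i) G (@pos i k).
Proof.
case: eE => hv _ _ _; rewrite (partition_big v predT) //=; apply: eq_bigr => i _.
rewrite -(big_imset G (h := @pos i)) /=; last by move=> k l _ _; apply: pos_inj.
apply: eq_bigl => x; apply/andP/imsetP => [[/imgP [j [k kK ->]]]|[k kK ->]].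
  by rewrite hv => /eqP ej; case: _ / ej; exists k.
by rewrite pos_img kK hv eqxx.
Qed.

Lemma card_lt_pos i k : #|[set y in E | lt y (@pos i k)]| = k.
Proof.
case: eE => hv hlt hE hs; rewrite -[RHS]card_ord_ltn -(card_imset _ (@pos_inj i)); congr #|pred_of_set _|.
apply/setP => y; rewrite inE; apply/andP/imsetP => [[yE yx]|[l]].
  have [lt_v _ _ _] := lo; have [l el] := hs i y yE (etrans (lt_v _ _ yx) (hv i k)).
  by exists l => //; rewrite inE -hlt -el.
by rewrite inE => lk ->; rewrite hE hlt.
Qed.

Lemma card_img_v K i : #|[set x in img pos K | v x == i]| = #|K i|.
Proof.
case: eE => hv _ _ _; rewrite -[RHS](card_imset _ (@pos_inj i)); congr #|pred_of_set _|.
apply/setP => x; rewrite inE; apply/andP/imsetP => [[/imgP [j [k kK ->]]]|[k kK ->]].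
  by rewrite hv => /eqP ej; case: _ / ej; exists k.
by rewrite pos_img kK hv eqxx.
Qed.

Lemma img_setT : img pos (fun i => setT) = E.
Proof.
case: eE => hv _ hE hs; apply/eqP; rewrite eqEsubset img_sub /=; apply/subsetP => x xE.
by have [k ->] := hs (v x) x xE erefl; rewrite pos_img inE.
Qed.

Lemma enumer_sub (K : forall i, {set 'I_(e i)}) :
  @enumer (img pos K) (weight K) (fun i (j : 'I_#|K i|) => @pos i (enum_val j)).
Proof.
case: eE => hv hlt hE hs; split=> //.
- by move=> i k l; rewrite hlt enum_val_ltn.
- by move=> i k; rewrite pos_img enum_valP.
move=> i x /imgP [j [k kK ->]]; rewrite hv => ej; case: _ / ej.
by exists (enum_rank_in kK k); rewrite enum_rankK_in.
Qed.

End Enumer.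

Lemma card_Hs (L Q : set) : #|{: Hs lt L Q}| = (\sum_(x in L) #|[set y in Q | lt y x]|)%N.
Proof.
rewrite card_sig -sum1_card (eq_bigr (fun x => \sum_(y in Q | lt y x) 1)%N) => [|x _]; last first.
  by rewrite -sum1_card; apply: eq_bigl => y; rewrite inE.
rewrite pair_big_dep /= (reindex (fun p : 'I_N * 'I_N => (p.2, p.1))) /=; last first.
  by exists (fun p : 'I_N * 'I_N => (p.2, p.1)) => [[y x] _|[y x] _].
by apply: eq_bigl => [[x y]] /=; rewrite inE /hpos /= andbCA.
Qed.

Lemma card_As (L Q : set) : #|{: As src tgt v Q L}| =
  (\sum_b #|[set x in L | v x == src b]| * #|[set y in Q | v y == tgt b]|)%N.
Proof.
rewrite card_sig -sum1_card.
rewrite (eq_bigr (fun b => \sum_(y | (y \in Q) && (v y == tgt b)) \sum_(x | (x \in L) && (v x == src b)) 1)%N).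
  rewrite pair_big_dep /= pair_big_dep /=; apply: eq_bigl => [[[b y] x]] /=; rewrite inE /apos /=.
  by case: (y \in Q); case: (x \in L); case: (v x == _); case: (v y == _).
move=> b _; rewrite -!sum1_card big_distrlr /= exchange_big /=.
by apply: eq_big => [y|y _]; rewrite ?inE //; apply: eq_big => [x|x _]; rewrite ?inE.
Qed.

Section Numbers.
Variables (E : set) (e : Q0 -> nat) (pos : forall i : Q0, 'I_(e i) -> 'I_N).
Hypothesis eE : enumer E pos.
Variables (K : forall i, {set 'I_(e i)}) (L : forall i, {set 'I_(#|K i|)}).
Let posK i (j : 'I_#|K i|) := pos (enum_val j).
Let eK : @enumer (img pos K) (weight K) posK := enumer_sub eE K.

(** For the [j]-th element [k] of [K], the number [k - j] counts the elements of [E] below it that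
    are not in [K]. Summed over [L], this is the dimension of the source of the differential. *)
Lemma ht_card : ht L = #|{: Hs lt (img posK L) (E :\: img pos K)}|%:Z.
Proof.
rewrite card_Hs (big_img eK) /ht (big_morph Posz PoszD (erefl : Posz 0 = 0)).
apply: eq_bigr => i _; rewrite (big_morph Posz PoszD (erefl : Posz 0 = 0)); apply: eq_bigr => j _.
have -> : [set y in E :\: img pos K | lt y (posK j)] =
   [set y in E | lt y (posK j)] :\: [set y in img pos K | lt y (posK j)].
  by apply/setP => y; rewrite !inE; case: (y \in img pos K); case: (y \in E); case: (lt y _).
have sub : [set y in img pos K | lt y (posK j)] \subset [set y in E | lt y (posK j)].
  by apply/subsetP => y; rewrite !inE => /andP[/(subsetP (img_sub eE K)) -> ->].
rewrite cardsDS // (card_lt_pos eE) (card_lt_pos eK) subzn //.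
by have := subset_leq_card sub; rewrite (card_lt_pos eE) (card_lt_pos eK).
Qed.

Lemma rhs_card : shat_rhs src tgt L = #|{: As src tgt v (E :\: img pos K) (img posK L)}|%:Z.
Proof.
rewrite card_As /shat_rhs (big_morph Posz PoszD (erefl : Posz 0 = 0)); apply: eq_bigr => b _.
rewrite PoszM (card_img_v eK); congr (_ * _).
have -> : [set y in E :\: img pos K | v y == tgt b] = [set y in E | v y == tgt b] :\: [set y in img pos K | v y == tgt b].
  by apply/setP => y; rewrite !inE; case: (y \in img pos K); case: (y \in E); case: (v y == _).
have sub : [set y in img pos K | v y == tgt b] \subset [set y in E | v y == tgt b].
  by apply/subsetP => y; rewrite !inE => /andP[/(subsetP (img_sub eE K)) -> ->].
have cE : #|[set y in E | v y == tgt b]| = e (tgt b).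
  by rewrite -(img_setT eE) (card_img_v eE) cardsT card_ord.
rewrite cardsDS // cE (card_img_v eE) subzn //.
by have := subset_leq_card sub; rewrite cE (card_img_v eE).
Qed.

End Numbers.

(** Through [ht_card] and [rhs_card] the defining inequalities become the counts in [dominant_card]
    and [dominant_of_card]. *)
Theorem Shat_dominant n : forall E (e : Q0 -> nat) (pos : forall i, 'I_(e i) -> 'I_N), enumer E pos ->
  (\sum_i e i < n)%N -> forall K, @Shat_fuel Q0 Ar src tgt n e K <-> dominant C src tgt v lt (img pos K) (E :\: img pos K).
Proof.
have [lt_v lt_tr lt_ir lt_to] := lo.
elim: n => // n IH E e pos eE en K; rewrite ltnS in en.
set K' := img pos K; have sK : K' \subset E := img_sub eE K.
have num (L : forall i, {set 'I_#|K i|}) : let L' := img (fun i (j : 'I_#|K i|) => pos i (enum_val j)) L in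
    (shat_rhs src tgt L <= ht L) = (#|{: As src tgt v (E :\: K') L'}| <= #|{: Hs lt L' (E :\: K')}|)%N.
  by rewrite /= (ht_card eE) (rhs_card eE).
have eK := enumer_sub eE K.
(* When [K] is everything the total dimension does not drop and the induction hypothesis is out of
   reach, but then the target of the differential is zero. *)
case: (eqVneq K' E) => [KE|KnE].
  have card0 (L : set) : #|{: As src tgt v (E :\: K') L}| = 0%N.
    by rewrite KE setDv card_As big1 // => b _; rewrite [X in (_ * X)%N]eq_card0 ?muln0 // => y; rewrite !inE.
  split=> [_|_ L _]; last by rewrite num card0.
  by apply: (dominant_of_card lt_v lt_tr lt_ir lt_to) => [|L _ _]; rewrite ?card0 // disjointD.
have szE : #|E| = (\sum_i e i)%N.
  rewrite -(img_setT eE) -sum1_card (big_img eE); apply: eq_bigr => i _.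
  by rewrite sum1_card cardsT card_ord.
have szK : #|K'| = (\sum_i weight K i)%N.
  by rewrite -sum1_card (big_img eE); apply: eq_bigr => i _; rewrite sum1_card.
have lt_n : (\sum_i weight K i < n)%N.
  apply: leq_trans en; rewrite -szE -szK; apply: proper_card.
  by rewrite properEneq KnE.
have IHK := IH _ _ _ eK lt_n.
split=> [h|dom L /IHK domL]; last first.
  rewrite num; apply: (dominant_card lt_v lt_tr (disjointD E K')) dom domL.
  exact: (img_sub eK).
apply: (dominant_of_card lt_v lt_tr lt_ir lt_to (disjointD E K')) => L' sL domL.
pose L i : {set 'I_#|K i|} := [set j | pos i (enum_val j) \in L'].
have eL : img (fun i (j : 'I_#|K i|) => pos i (enum_val j)) L = L'.
  apply/setP => x; apply/imgP/idP => [[i [j jL ->]]|xL]; first by rewrite inE in jL.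
  have [_ _ _ hs] := eK; have [j ej] := hs (v x) x (subsetP sL x xL) erefl.
  by exists (v x), j => //; rewrite inE -ej.
have := h L; rewrite num eL; apply; apply/IHK; by rewrite eL.
Qed.

End Translate.


Lemma char_poly_conj (R : comNzRingType) n (P Q B : 'M[R]_n) : P *m Q = 1%:M ->
  char_poly (P *m B *m Q) = char_poly B.
Proof.
move=> PQ; have pPQ : map_mx polyC P *m map_mx polyC Q = 1%:M by rewrite -map_mxM PQ map_mx1.
have -> : char_poly (P *m B *m Q) = \det (map_mx polyC P *m char_poly_mx B *m map_mx polyC Q).
  rewrite /char_poly /char_poly_mx mulmxBr mulmxBl !map_mxM; congr (\det (_ - _)).
  by rewrite mul_mx_scalar -scalemxAl pPQ scale_scalar_mx mulr1.
by rewrite !det_mulmx mulrAC -det_mulmx pPQ det1 mul1r.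
Qed.

(** * The given eigenvalue lists and ordered eigenbases *)

Section Eigen.
Variables (C : numClosedFieldType) (Q0 : finType) (N : nat) (v : 'I_N -> Q0).
Variables (d : Q0 -> nat) (idx : forall i, 'I_(d i) -> 'I_N).
Hypothesis idx_v : forall i k, v (@idx i k) = i.
Hypothesis idx_inj : forall i, injective (@idx i).
Hypothesis idx_surj : forall i x, v x = i -> exists k, x = @idx i k.
Variables (B : forall i, 'M[C]_(d i)) (a : forall i, 'I_(d i) -> C).
Hypothesis aB : forall i, char_poly (B i) = \prod_(k < d i) ('X - (a k)%:P).
Hypothesis a_sorted : forall i (k l : 'I_(d i)), (k <= l)%N -> a k <= a l.

(** Sorting the basis at each vertex by [lt] puts the values of [a'] in nondecreasing order. They
    form the same multiset as the values of [a i], since both split the characteristic polynomial of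
    [B i], and sorted lists with the same content agree. *)
Lemma eigen_enumer (lt : rel 'I_N) (P : 'M[C]_N) (a' : 'I_N -> C) : order_on v lt ->
  (forall y x, lt y x -> a' y <= a' x) -> unitary P -> graded v P ->
  P *m glue idx B *m adjmx P = diag_mx (\row_x a' x) ->
  exists pos : forall i, 'I_(d i) -> 'I_N, enumer v lt setT pos /\ forall i k, a' (pos i k) = @a i k.
Proof.
move=> [lt_v lt_tr lt_ir lt_to] mono uP gP eP.
pose le x y := (x == y) || lt x y.
have le_tr : transitive le.
  move=> y x z /orP[/eqP -> //|xy] /orP[/eqP <-|yz]; rewrite /le ?xy ?orbT //.
  by rewrite (lt_tr _ _ _ xy yz) orbT.
pose V i := [set x | v x == i].
have le_tot i : {in V i &, total le}.
  move=> x y; rewrite !inE => /eqP vx /eqP vy; rewrite /le.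
  have [->//|n] := eqVneq x y; have := lt_to x y; rewrite vx vy => /(_ erefl n).
  by case/orP => ->; rewrite ?orbT.
pose s i := sort le (enum (V i)).
have s_sorted i : sorted le (s i).
  by apply: (sort_sorted_in (le_tot i)); apply/allP => x; rewrite mem_enum.
have s_uniq i : uniq (s i) by rewrite sort_uniq enum_uniq.
have s_mem i x : (x \in s i) = (v x == i) by rewrite mem_sort mem_enum inE.
pose r i := [seq @idx i k | k <- enum 'I_(d i)].
have r_uniq i : uniq (r i) by rewrite (map_inj_uniq (@idx_inj i)) enum_uniq.
have sr i : perm_eq (s i) (r i).
  apply: uniq_perm => // x; rewrite s_mem; apply/eqP/mapP => [/idx_surj [k ->]|[k _ ->]] //.
  by exists k => //; rewrite mem_enum.
have s_size i : size (s i) = d i by rewrite (perm_size (sr i)) size_map size_enum_ord.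
pose pos i (k : 'I_(d i)) := nth (idx k) (s i) k.
have posE i k x0 : @pos i k = nth x0 (s i) k by apply: set_nth_default; rewrite s_size.
have pos_s i k : @pos i k \in s i by rewrite mem_nth // s_size.
have pos_v i k : v (@pos i k) = i by apply/eqP; rewrite -s_mem.
have lt_pos i (k l : 'I_(d i)) : (k < l)%N -> lt (pos i k) (pos i l).
  move=> kl; have h : le (pos i k) (pos i l).
    by rewrite (posE i l (idx k)); apply: (sorted_ltn_nth le_tr (idx k) (s_sorted i)) => //; rewrite inE s_size.
  case/orP: h => // /eqP; rewrite (posE i l (idx k)) => /eqP; rewrite nth_uniq ?s_size // => /eqP e.
  by move: kl; rewrite e ltnn.
exists pos; split.
  split=> //.
  - move=> i k l; apply/idP/idP => [h|]; last exact: lt_pos.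
    rewrite ltnNge leq_eqVlt; apply/negP => /orP[/eqP/val_inj e|/lt_pos h']; first by move: h; rewrite e lt_ir.
    by have := lt_tr _ _ _ h h'; rewrite lt_ir.
  - by move=> i k; rewrite inE.
  - move=> i x _ vx; have xs : x \in s i by rewrite s_mem vx.
    have xi : (index x (s i) < d i)%N by rewrite -s_size index_mem.
    by exists (Ordinal xi); rewrite (posE i _ x) /= nth_index.
move=> i k.
have perm : perm_eq [seq a' x | x <- s i] [seq @a i k | k <- enum 'I_(d i)].
  apply: (perm_trans (perm_map a' (sr i))); rewrite /r -map_comp; apply: prod_XsubC_eq.
  have prodE (p : 'I_(d i) -> C) :
      \prod_(x <- [seq p k | k <- enum 'I_(d i)]) ('X - x%:P) = \prod_k ('X - (p k)%:P).
    by rewrite big_map big_enum.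
  rewrite !prodE -aB.
  pose Pi := cutb idx P i.
  have gP' := graded_adj gP.
  have gB : graded v (glue idx B) by apply: glue_graded.
  have uPi : Pi *m adjmx Pi = 1%:M.
    rewrite /Pi -cutb_adj -(cutbM idx_v idx_inj idx_surj) // (uP : P *m _ = _).
    by rewrite /cutb mulmx1 blkK.
  have e1 : Pi *m B i *m adjmx Pi = diag_mx (\row_k a' (idx k)).
    rewrite -(cutb_glue idx_v idx_inj B i) /Pi -cutb_adj -!(cutbM idx_v idx_inj idx_surj) //; last exact: gradedM.
    rewrite eP; apply/matrixP => k1 k2; rewrite /cutb mul_blkTE blk_mulE !mxE.
    by rewrite (inj_eq (@idx_inj i)).
  rewrite -(char_poly_conj (B i) uPi) e1 char_poly_trig ?diag_mx_is_trig //.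
  by apply: eq_bigr => k1 _; rewrite !mxE eqxx mulr1n.
have eS : [seq a' x | x <- s i] = [seq @a i k | k <- enum 'I_(d i)].
  apply: (@sorted_eq _ <=%O) perm; [exact: le_trans|exact: le_anti| |].
    rewrite sorted_map; apply: sub_sorted (s_sorted i) => x y /orP[/eqP -> //|/mono //].
    by rewrite /= lexx.
  rewrite sorted_map; have : sorted ltn (map val (enum 'I_(d i))) by rewrite val_enum_ord iota_ltn_sorted.
  by rewrite sorted_map; apply: sub_sorted => x y /ltnW /a_sorted.
rewrite (posE i k (idx k)) -(nth_map _ 0) ?s_size // eS (nth_map k) ?size_enum_ord //.
by rewrite nth_ord_enum.
Qed.

End Eigen.

Theorem theorem2p1 (C : numClosedFieldType) (Q0 Ar : finType)
    (src tgt : Ar -> Q0) (d : Q0 -> nat)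
    (B : forall i : Q0, 'M[C]_(d i))
    (a : forall i : Q0, 'I_(d i) -> C) :
  (forall i, herm_mx (B i)) ->
  (forall i, char_poly (B i) = \prod_(k < d i) ('X - (a i k)%:P)) ->
  (forall i (k l : 'I_(d i)), (k <= l)%N -> a i k <= a i l) ->
  ((exists f : forall x : Ar, 'M[C]_(d (tgt x), d (src x)),
       forall i, @mu C Q0 Ar src tgt d f i = B i)
   <->
   (\sum_(i : Q0) \sum_(k < d i) a i k = 0 /\
    forall K : forall i, {set 'I_(d i)},
      @Shat Q0 Ar src tgt d K -> 0 <= \sum_(i : Q0) \sum_(k in K i) a i k)).
Proof.
move=> hB aB a_sorted.
pose T := {i : Q0 & 'I_(d i)}; pose N := #|{: T}|; pose v (x : 'I_N) : Q0 := tag (enum_val x).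
pose idx i (k : 'I_(d i)) : 'I_N := enum_rank (Tagged (fun i => 'I_(d i)) k).
have idx_v i k : v (@idx i k) = i by rewrite /v enum_rankK.
have idx_inj i : injective (@idx i).
  by move=> k l /enum_rank_inj /eqP; rewrite eq_Tagged => /eqP.
have idx_surj i x : v x = i -> exists k, x = @idx i k.
  rewrite /v; case E: (enum_val x) => [j k] /= ej; case: _ / ej.
  by exists k; rewrite /idx /Tagged -E enum_valK.
have gB : graded v (glue idx B) by apply: glue_graded.
have hBB : adjmx (glue idx B) = glue idx B.
  by rewrite glue_adj; apply: eq_glue => i; apply: hB.
rewrite (mu_imageP src tgt idx_v idx_inj idx_surj).
have eigen := eigen_enumer idx_v idx_inj idx_surj aB a_sorted.
have domE lt pos : order_on v lt -> enumer v lt setT pos -> forall K,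
    @Shat Q0 Ar src tgt d K <-> dominant C src tgt v lt (img pos K) (~: img pos K).
  by move=> lo en K; rewrite -setTD; apply: Shat_dominant.
have sumE lt pos (a' : 'I_N -> C) : order_on v lt -> enumer v lt setT pos ->
    (forall i k, a' (pos i k) = a i k) -> forall K : forall i, {set 'I_(d i)},
    \sum_(x in img pos K) a' x = \sum_i \sum_(k in K i) a i k.
  move=> lo en ea K; rewrite (big_img lo en).
  by apply: eq_bigr => i _; apply: eq_bigr => k _; rewrite ea.
have [P [a0 [b0 [[uP gP] a0r _ eP _]]]] := graded_commuting_diag idx_v idx_inj idx_surj hBB hBB erefl gB gB.
(* For necessity any order compatible with [a0] will do; the constant second key leaves ties to the
   index. *)
pose lt := lexlt v a0 (fun=> 0).
have lo : order_on v lt.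
  split; [exact: lexlt_v|exact: lexlt_trans|exact: lexlt_irr|].
  by apply: lexlt_total => // x; rewrite real0.
have mono : forall y x, lt y x -> a0 y <= a0 x by exact: lexlt_mono.
have [pos [en ea]] := eigen lt P a0 lo mono uP gP eP.
have trB : \tr (glue idx B) = \sum_i \sum_(k < d i) a i k.
  have -> : \tr (glue idx B) = \tr (P *m glue idx B *m adjmx P).
    by rewrite [RHS]mxtrace_mulC mulmxA (unitaryK uP) mul1mx.
  rewrite eP /mxtrace (eq_bigr a0) => [|x _]; last by rewrite !mxE eqxx.
  have := sumE lt pos a0 lo en ea (fun i => setT); rewrite (img_setT lo en).
  rewrite [LHS](eq_bigl predT) => [->|x]; last by rewrite inE.
  by apply: eq_bigr => i _; apply: eq_bigl => k; rewrite inE.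
split=> [[F [rF hF]]|[sum0 hK]].
  split.
    rewrite -trB -hF /mubig raddf_sum big1 // => b _.
    by rewrite raddfB /= mxtrace_mulC subrr.
  move=> K /(domE lt pos lo en) dom; rewrite -(sumE lt pos a0 lo en ea).
  have [lt_v _ _ _] := lo.
  apply: (dominant_sum_ge0 lt_v a0r mono dom (f := cnj P F)).
  rewrite -eP -hF -mubig_cnj //; apply: eq_bigr => b _.
  by rewrite isrep_mskA //; apply: isrep_cnj.
apply: (moment_of_dominant idx_v idx_inj idx_surj) => //; first by rewrite trB.
move=> P' a' lt' K' uP' gP' eP' lo' mono' dom'.
have [pos' [en' ea']] := eigen lt' P' a' lo' mono' uP' gP' eP'.
pose K i : {set 'I_(d i)} := [set k | pos' i k \in K'].
have eK : img pos' K = K'.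
  apply/setP => x; apply/imgP/idP => [[i [k kK ->]]|xK]; first by rewrite inE in kK.
  have [_ _ _ hs] := en'; have [k ek] := hs (v x) x (in_setT _) erefl.
  by exists (v x), k => //; rewrite inE -ek.
rewrite -eK (sumE lt' pos' a' lo' en' ea'); apply: hK.
by apply/(domE lt' pos' lo' en'); rewrite eK.
Qed.
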